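(* Consider the following decision problem. Input: two STRIPS instances $D_o=\langle \mathcal{P},\mathcal{O},\mathcal{I}_o,\mathcal{G}\rangle$ and $D=\langle \mathcal{P},\mathcal{O},\mathcal{I},\mathcal{G}\rangle$ that have the same set of conditions, the same set of operators and the same goal, and whose initial states $\mathcal{I}_o,\mathcal{I}$ differ in exactly one condition (i.e. $|\mathcal{I}_o \,\triangle\, \mathcal{I}|=1$), together with a plan $P_o$ for $D_o$. Question: does $D$ have a plan? This problem is PSPACE-complete. *)

(* Defs.v *)
From mathcomp Require Import all_boot.

Set Implicit Arguments.
Unset Strict Implicit.
Unset Printing Implicit Defensive.

Inductive move := MLeft | MRight | MStay.

Record TM := MkTM {
  tm_state : finType;
  tm_sym   : finType;
  tm_blank : tm_sym;
  tm_in    : bool -> tm_sym;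
  tm_out   : tm_sym -> option bool;
  tm_start : tm_state;
  tm_acc   : tm_state;
  tm_rej   : tm_state;
  tm_delta : tm_state -> tm_sym -> tm_state * tm_sym * move }.

(* configuration: state, tape left of head (reversed), head symbol,
   tape right of head; the tape is one-way infinite to the right *)
Record config (M : TM) := Config {
  c_state : tm_state M;
  c_left  : seq (tm_sym M);
  c_head  : tm_sym M;
  c_right : seq (tm_sym M) }.
Arguments Config {M}.

Definition halted (M : TM) (c : config M) : bool :=
  (c_state c == @tm_acc M) || (c_state c == @tm_rej M).

Definition step (M : TM) (c : config M) : config M :=
  if halted c then c else
  let: (q', a, m) := @tm_delta M (c_state c) (c_head c) in
  match m with
  | MStay => Config q' (c_left c) a (c_right c)
  | MLeft => match c_left c with
             | [::] => Config q' [::] a (c_right c)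
             | b :: l => Config q' l b (a :: c_right c)
             end
  | MRight => match c_right c with
              | [::] => Config q' (a :: c_left c) (@tm_blank M) [::]
              | b :: r => Config q' (a :: c_left c) b r
              end
  end.

Definition init_config (M : TM) (w : seq bool) : config M :=
  match w with
  | [::] => Config (@tm_start M) [::] (@tm_blank M) [::]
  | b :: w' => Config (@tm_start M) [::] (@tm_in M b) (map (@tm_in M) w')
  end.

Definition run (M : TM) (w : seq bool) (t : nat) : config M :=
  iter t (@step M) (init_config M w).

(* number of tape cells visited so far (the input counts) *)
Definition space (M : TM) (c : config M) : nat :=
  size (c_left c) + size (c_right c) + 1.

Definition tape_output (M : TM) (c : config M) : seq bool :=
  pmap (@tm_out M) (rev (c_left c) ++ c_head c :: c_right c).

Definition language := seq bool -> Prop.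

Definition decides_in_space (M : TM) (L : language) (s : nat -> nat) : Prop :=
  forall w : seq bool,
    (exists t, halted (run M w t)) /\
    (forall t, space (run M w t) <= s (size w)) /\
    (L w <-> exists t, c_state (run M w t) = @tm_acc M).

Definition in_PSPACE (L : language) : Prop :=
  exists (M : TM) (c k : nat), decides_in_space M L (fun n => c * n ^ k + c).

Definition computes_in_time (M : TM) (f : seq bool -> seq bool)
  (tb : nat -> nat) : Prop :=
  forall w : seq bool,
    c_state (run M w (tb (size w))) = @tm_acc M /\
    tape_output (run M w (tb (size w))) = f w.

Definition poly_time_computable (f : seq bool -> seq bool) : Prop :=
  exists (M : TM) (c k : nat), computes_in_time M f (fun n => c * n ^ k + c).

Definition poly_reducible (L1 L2 : language) : Prop :=
  exists f, poly_time_computable f /\ forall w, L1 w <-> L2 (f w).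

Definition PSPACE_hard (L : language) : Prop :=
  forall L', in_PSPACE L' -> poly_reducible L' L.

Definition PSPACE_complete (L : language) : Prop :=
  in_PSPACE L /\ PSPACE_hard L.

(* Propositional STRIPS; the condition set P is {0, ..., conds-1}      *)

Record operator := Op { op_pre : seq nat; op_add : seq nat; op_del : seq nat }.

Record strips := Strips {
  s_conds : nat;
  s_ops   : seq operator;
  s_init  : seq nat;
  s_goal  : seq nat }.

Definition wf_strips (D : strips) : bool :=
  let ok := all (fun c => c < s_conds D) in
  [&& ok (s_init D), ok (s_goal D) &
      all (fun o => [&& ok (op_pre o), ok (op_add o) & ok (op_del o)]) (s_ops D)].

Definition applicable (o : operator) (s : seq nat) : bool :=
  all (fun c => c \in s) (op_pre o).

Definition apply_op (o : operator) (s : seq nat) : seq nat :=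
  [seq c <- s | c \notin op_del o] ++ op_add o.

Fixpoint exec (D : strips) (p : seq nat) (s : seq nat) : option (seq nat) :=
  match p with
  | [::] => Some s
  | i :: p' =>
      if i < size (s_ops D) then
        let o := nth (Op [::] [::] [::]) (s_ops D) i in
        if applicable o s then exec D p' (apply_op o s) else None
      else None
  end.

Definition is_plan (D : strips) (p : seq nat) : bool :=
  if exec D p (s_init D) is Some s then all (fun c => c \in s) (s_goal D)
  else false.

Definition solvable (D : strips) : Prop := exists p, is_plan D p.

Record reuse_input := RI {
  ri_conds  : nat;
  ri_ops    : seq operator;
  ri_init_o : seq nat;
  ri_init   : seq nat;
  ri_goal   : seq nat;
  ri_plan   : seq nat }.

Definition ri_Do (x : reuse_input) : strips :=
  Strips (ri_conds x) (ri_ops x) (ri_init_o x) (ri_goal x).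
Definition ri_D (x : reuse_input) : strips :=
  Strips (ri_conds x) (ri_ops x) (ri_init x) (ri_goal x).

Definition differ_in_one (n : nat) (Io I : seq nat) : bool :=
  count (fun c => (c \in Io) != (c \in I)) (iota 0 n) == 1.

Definition reuse_promise (x : reuse_input) : bool :=
  [&& wf_strips (ri_Do x), wf_strips (ri_D x),
      differ_in_one (ri_conds x) (ri_init_o x) (ri_init x) &
      is_plan (ri_Do x) (ri_plan x)].

(* prefix-free encoding into bit strings (numbers in unary) *)
Definition enc_nat (n : nat) : seq bool := nseq n true ++ [:: false].
Definition enc_nats (s : seq nat) : seq bool :=
  enc_nat (size s) ++ flatten (map enc_nat s).
Definition enc_op (o : operator) : seq bool :=
  enc_nats (op_pre o) ++ enc_nats (op_add o) ++ enc_nats (op_del o).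
Definition enc_ops (os : seq operator) : seq bool :=
  enc_nat (size os) ++ flatten (map enc_op os).
Definition enc_input (x : reuse_input) : seq bool :=
  enc_nat (ri_conds x) ++ enc_ops (ri_ops x) ++ enc_nats (ri_init_o x)
  ++ enc_nats (ri_init x) ++ enc_nats (ri_goal x) ++ enc_nats (ri_plan x).

Definition plan_modification : language :=
  fun w => exists x, w = enc_input x /\ reuse_promise x /\ solvable (ri_D x).

(* Main.v *)
Require Import Defs.
From mathcomp Require Import all_boot.
From HB Require Import structures.
From mathcomp Require Import zify.
From Stdlib Require Import FunctionalExtensionality.

Set Implicit Arguments.
Unset Strict Implicit.
Unset Printing Implicit Defensive.

(* Both halves use one programming model: a pointer machine whose memory consists
   of pointers into the tape and of bit arrays stored on its cells. A program is
   compiled to a one-tape machine that keeps the marks of the pointers and the bits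
   of the arrays on separate tracks and performs each command in one sweep.

   Membership: a program checks that the word is a code, tabulates the operators,
   checks the promise by running the given plan, and decides reachability of the
   goal by Savitch's recursion. With n bits for a state and n levels, the recursion
   is a quantified Boolean formula with n blocks of n existential quantifiers (the
   middle state) and one universal quantifier (which half), which is evaluated by
   backtracking over one assignment; its matrix is a single-step test.

   Hardness: a machine M running in space Z on w is described by conditions "cell i
   holds a" and "the head is on i in state q", with one operator for each i < Z and
   each transition. A fresh condition enables an operator that reaches the goal
   directly. It holds in the initial state of D_o and is the only difference to that
   of D, so D_o has a one-step plan and D has a plan iff M accepts w. *)

(** * One-tape machines and pointer programs *)

(** A pointer machine has no stack, and this is why Savitch's recursion appears as a quantified
    formula: the current assignment is the stack, and the two states compared at a leaf are
    recomputed from it, so nothing is saved between calls. Numbers are coded in unary, so the length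
    [n] of the word bounds the number of conditions and of operators. The same [n] serves as number
    of state bits, length of a table row and depth of the recursion, which is enough because there
    are [2 ^ n] bit vectors. The recursion asks for an exact number of steps, and an idle operator
    supplies the padding. The two halves need different resources: membership needs termination and
    a bound on the pointers but no time bound, hardness needs a time bound, from which a pointer
    bound follows because a command moves a pointer by at most one cell. *)

Section Tape.
Variables (sym : Type) (bl : sym).

Record tape := Tape { tl : seq sym; th : sym; tr : seq sym }.

Definition act (tp : tape) (s : sym) (mv : move) : tape :=
  match mv with
  | MStay => Tape (tl tp) s (tr tp)
  | MLeft => match tl tp with
             | [::] => Tape [::] s (tr tp)
             | b :: l => Tape l b (s :: tr tp)
             end
  | MRight => match tr tp with
              | [::] => Tape (s :: tl tp) bl [::]
              | b :: r => Tape (s :: tl tp) b r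
              end
  end.

Definition mvpos (i : nat) (mv : move) : nat :=
  match mv with MStay => i | MLeft => i.-1 | MRight => i.+1 end.

Definition tpos (tp : tape) : nat := size (tl tp).
Definition tcells (tp : tape) : seq sym := rev (tl tp) ++ th tp :: tr tp.
(** Reading beyond the written cells gives the blank, so a tape becomes a total function on [nat]
    and its growth to the right is invisible; only [tsize] records it. *)
Definition tat (tp : tape) (j : nat) : sym := nth bl (tcells tp) j.
Definition tsize (tp : tape) : nat := size (tl tp) + size (tr tp) + 1.

Lemma tat_pos tp : tat tp (tpos tp) = th tp.
Proof. by rewrite /tat /tcells nth_cat size_rev ltnn subnn. Qed.

Lemma nth_rev_cat (l r : seq sym) x s j :
  nth bl (rev l ++ s :: r) j
  = if j == size l then s else nth bl (rev l ++ x :: r) j.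
Proof.
rewrite !nth_cat size_rev; case: ltngtP => // jl.
by case E: (j - size l) => //; lia.
by rewrite jl subnn.
Qed.

Lemma tat_act tp s mv j :
  tat (act tp s mv) j = if j == tpos tp then s else tat tp j.
Proof.
case: tp => l h r; rewrite /tat /tcells /tpos /= -(nth_rev_cat l r h s).
case: mv => //=.
  by case: l => [|b l] //=; rewrite rev_cons cat_rcons.
case: r => [|b r] /=; rewrite rev_cons cat_rcons //.
by rewrite !nth_cat size_rev; case: ifP => // _; case: (j - _) => [|[|k]] //=; rewrite nth_nil.
Qed.

Lemma tpos_act tp s mv : tpos (act tp s mv) = mvpos (tpos tp) mv.
Proof. by case: tp => l h r; case: mv; rewrite /tpos //=; [case: l | case: r]. Qed.

Lemma tsize_act tp s mv :
  tsize (act tp s mv) = maxn (tsize tp) (mvpos (tpos tp) mv).+1.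
Proof.
case: tp => l h r; case: mv; rewrite /tpos /tsize /=;
  [case: l => [|b l]|case: r => [|b r]|] => /=; lia.
Qed.

End Tape.
Arguments act {sym}.

(* Machines are sub-routines that leave through one of two exits. *)
Record mach (sym : Type) := Mach {
  mst : finType;
  mst0 : mst;
  mdelta : mst -> sym -> (mst + bool) * sym * move }.
Arguments mst0 {sym} m.
Arguments mdelta {sym} m.

Section Machines.
Variables (sym : finType) (bl : sym) (N : nat).
Implicit Types M : mach sym.

(** A derivation is a finite run up to an exit, hence a termination proof as well. The bound [N] is
    imposed after every step because a space bound concerns the whole run and not only its last
    tape. *)
Inductive exits M : mst M -> tape sym -> bool -> tape sym -> nat -> Prop :=
| exits_last s tp b a mv :
    mdelta M s (th tp) = (inr b, a, mv) -> tsize (act bl tp a mv) <= N ->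
    exits s tp b (act bl tp a mv) 1
| exits_step s tp s' a mv b tp' t :
    mdelta M s (th tp) = (inl s', a, mv) -> tsize (act bl tp a mv) <= N ->
    exits s' (act bl tp a mv) b tp' t ->
    exits s tp b tp' t.+1.

Definition mconst (c : bool) : mach sym :=
  @Mach sym unit tt (fun s x => (inr c, x, MStay)).

Definition mseq M1 M2 : mach sym :=
  @Mach sym (mst M1 + mst M2)%type (inl (mst0 M1)) (fun s x =>
    match s with
    | inl s1 => match mdelta M1 s1 x with
                | (inl s', a, mv) => (inl (inl s'), a, mv)
                | (inr b, a, mv) => (inl (inr (mst0 M2)), a, mv)
                end
    | inr s2 => match mdelta M2 s2 x with
                | (inl s', a, mv) => (inl (inr s'), a, mv)
                | (inr b, a, mv) => (inr b, a, mv)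
                end
    end).

Definition mif M M1 M2 : mach sym :=
  @Mach sym (mst M + (mst M1 + mst M2))%type (inl (mst0 M)) (fun s x =>
    match s with
    | inl s0 => match mdelta M s0 x with
                | (inl s', a, mv) => (inl (inl s'), a, mv)
                | (inr b, a, mv) =>
                    (inl (inr (if b then inl (mst0 M1) else inr (mst0 M2))), a, mv)
                end
    | inr (inl s1) => match mdelta M1 s1 x with
                | (inl s', a, mv) => (inl (inr (inl s')), a, mv)
                | (inr b, a, mv) => (inr b, a, mv)
                end
    | inr (inr s2) => match mdelta M2 s2 x with
                | (inl s', a, mv) => (inl (inr (inr s')), a, mv)
                | (inr b, a, mv) => (inr b, a, mv)
                end
    end).

Definition mwhile M M1 : mach sym :=
  @Mach sym (mst M + mst M1)%type (inl (mst0 M)) (fun s x =>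
    match s with
    | inl s0 => match mdelta M s0 x with
                | (inl s', a, mv) => (inl (inl s'), a, mv)
                | (inr true, a, mv) => (inl (inr (mst0 M1)), a, mv)
                | (inr false, a, mv) => (inr true, a, mv)
                end
    | inr s1 => match mdelta M1 s1 x with
                | (inl s', a, mv) => (inl (inr s'), a, mv)
                | (inr b, a, mv) => (inl (inl (mst0 M)), a, mv)
                end
    end).

Lemma exits_mseq M1 M2 tp b1 tp1 t1 b2 tp2 t2 :
  exits (mst0 M1) tp b1 tp1 t1 -> exits (mst0 M2) tp1 b2 tp2 t2 ->
  exits (mst0 (mseq M1 M2)) tp b2 tp2 (t1 + t2).
Proof.
(* The run of [M2] is first embedded in the right summand; it is then the fixed tail of an induction
   on the run of [M1]. *)
move=> H1 H2; have {}H2 : @exits (mseq M1 M2) (inr (mst0 M2)) tp1 b2 tp2 t2.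
  elim: H2 => [s tp' b a mv E L|s tp' s' a mv b tp3 t E L _ IH].
    by apply: exits_last => //=; rewrite E.
  by apply: exits_step IH => //=; rewrite E.
rewrite /=; elim: H1 H2 => {tp b1 tp1 t1}
    [s tp b a mv E L|s tp s' a mv b tp1 t E L _ IH] H2.
  by apply: (exits_step (M := mseq M1 M2)) H2 => //=; rewrite E.
by apply: (exits_step (M := mseq M1 M2)) (IH H2) => //=; rewrite E.
Qed.

Lemma exits_mif M M1 M2 tp b tp1 t1 b2 tp2 t2 :
  exits (mst0 M) tp b tp1 t1 ->
  exits (mst0 (if b then M1 else M2)) tp1 b2 tp2 t2 ->
  exits (mst0 (mif M M1 M2)) tp b2 tp2 (t1 + t2).
Proof.
move=> H1 H2.
have {}H2 : @exits (mif M M1 M2)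
    (inr (if b then inl (mst0 M1) else inr (mst0 M2))) tp1 b2 tp2 t2.
  case: b H1 H2 => _; elim=> [s tp' b a mv E L|s tp' s' a mv b tp3 t E L _ IH];
  by [apply: exits_last => //=; rewrite E|apply: exits_step IH => //=; rewrite E].
rewrite /=; elim: H1 H2 => {tp b tp1 t1}
    [s tp b a mv E L|s tp s' a mv b tp1 t E L _ IH] H2.
  by apply: (exits_step (M := mif M M1 M2)) H2 => //=; rewrite E.
by apply: (exits_step (M := mif M M1 M2)) (IH H2) => //=; rewrite E.
Qed.

Lemma exits_mwhile_stop M M1 tp tp1 t :
  exits (mst0 M) tp false tp1 t -> exits (mst0 (mwhile M M1)) tp true tp1 t.
Proof.
rewrite /=; move Eb: false => b H1.
elim: H1 Eb => {tp b tp1 t} [s tp b a mv E L|s tp s' a mv b tp1 t E L _ IH] Eb.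
  by subst b; apply: exits_last => //=; rewrite E.
by apply: (exits_step (M := mwhile M M1)) (IH Eb) => //=; rewrite E.
Qed.

Lemma exits_mwhile_go M M1 tp tp1 t1 b2 tp2 t2 b3 tp3 t3 :
  exits (mst0 M) tp true tp1 t1 -> exits (mst0 M1) tp1 b2 tp2 t2 ->
  exits (mst0 (mwhile M M1)) tp2 b3 tp3 t3 ->
  exits (mst0 (mwhile M M1)) tp b3 tp3 (t1 + t2 + t3).
Proof.
rewrite /= -addnA => H1 H2 H3.
have {}H2 : @exits (mwhile M M1) (inr (mst0 M1)) tp1 b3 tp3 (t2 + t3).
  elim: H2 H3 => [s tp' b a mv E L|s tp' s' a mv b tp4 t E L _ IH] H3.
    by apply: (exits_step (M := mwhile M M1)) H3 => //=; rewrite E.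
  by apply: (exits_step (M := mwhile M M1)) (IH H3) => //=; rewrite E.
move: H1; move Eb: true => b H1.
elim: H1 Eb H2 => {tp b tp1 t1}
    [s tp b a mv E L|s tp s' a mv b tp1 t E L _ IH] Eb H2.
  by subst b; apply: (exits_step (M := mwhile M M1)) H2 => //=; rewrite E.
by apply: (exits_step (M := mwhile M M1)) (IH Eb H2) => //=; rewrite E.
Qed.

End Machines.

(* Memories of a pointer machine: pointers into a common index set [nat], and
   bit arrays over it. Pointer 0 is never moved, so it stays at index 0. *)
Record memory := MkMem { ptr : nat -> nat; arr : nat -> nat -> bool }.

Definition setp (m : memory) (v x : nat) : memory :=
  MkMem (fun u => if u == v then x else ptr m u) (arr m).
Definition seta (m : memory) (x j : nat) (b : bool) : memory :=
  MkMem (ptr m)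
      (fun y => if y == x then fun i => if i == j then b else arr m y i else arr m y).

Inductive cmd :=
| CConst of bool
| CTest of nat & nat
| CSame of nat & nat
| CSet of nat & nat & bool
| CRight of nat
| CLeft of nat
| CSeq of cmd & cmd
| CIf of cmd & cmd & cmd
| CWhile of cmd & cmd.

(** [None] means no bound. The reduction is analysed by its running time alone and gets its pointer
    bound later from [ev_bounded]; the decision program is analysed with a bound from the start. *)
Definition below (B : option nat) (x : nat) : bool :=
  if B is Some B' then x < B' else true.

(* [ev B c m b m' t]: from [m], the command [c] returns [b] in memory [m'] after
   [t] elementary commands, and moves no pointer beyond [B]. *)
Inductive ev (B : option nat) : cmd -> memory -> bool -> memory -> nat -> Prop :=
| ev_const b m : ev B (CConst b) m b m 1
| ev_test x v m : ev B (CTest x v) m (arr m x (ptr m v)) m 1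
| ev_same u v m : ev B (CSame u v) m (ptr m u == ptr m v) m 1
| ev_set x v b m : ev B (CSet x v b) m true (seta m x (ptr m v) b) 1
| ev_right v m : below B (ptr m v) ->
    ev B (CRight v) m true (setp m v (ptr m v).+1) 1
| ev_left v m : ev B (CLeft v) m true (setp m v (ptr m v).-1) 1
| ev_seq c1 c2 m b1 m1 t1 b2 m2 t2 :
    ev B c1 m b1 m1 t1 -> ev B c2 m1 b2 m2 t2 -> ev B (CSeq c1 c2) m b2 m2 (t1 + t2)
| ev_if c c1 c2 m b m1 t1 b2 m2 t2 :
    ev B c m b m1 t1 -> ev B (if b then c1 else c2) m1 b2 m2 t2 ->
    ev B (CIf c c1 c2) m b2 m2 (t1 + t2)
| ev_stop c d m m1 t : ev B c m false m1 t -> ev B (CWhile c d) m true m1 t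
| ev_go c d m m1 t1 b2 m2 t2 b3 m3 t3 :
    ev B c m true m1 t1 -> ev B d m1 b2 m2 t2 -> ev B (CWhile c d) m2 b3 m3 t3 ->
    ev B (CWhile c d) m b3 m3 (t1 + t2 + t3).

(** An elementary command moves a pointer by at most one cell, so the running time is itself a bound
    on how far the pointers travel. *)
Lemma ev_bounded c m b m' t K :
  ev None c m b m' t -> (forall v, ptr m v <= K) ->
  ev (Some (K + t)) c m b m' t /\ (forall v, ptr m' v <= K + t).
Proof.
have mono c' m1 b1 m2 t1 B B' : ev (Some B) c' m1 b1 m2 t1 -> B <= B' ->
    ev (Some B') c' m1 b1 m2 t1.
  elim=> {c' m1 b1 m2 t1}; intros; try by econstructor; eauto.
  by apply: ev_right => /=; apply: leq_trans H0.
move=> H; elim: H K => {c m b m' t}.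
- by move=> b m K H; split=> [|v]; [constructor|rewrite (leq_trans (H v)) ?leq_addr].
- by move=> x v m K H; split=> [|w]; [constructor|rewrite (leq_trans (H w)) ?leq_addr].
- by move=> u v m K H; split=> [|w]; [constructor|rewrite (leq_trans (H w)) ?leq_addr].
- by move=> x v b m K H; split=> [|w]; [constructor|rewrite (leq_trans (H w)) ?leq_addr].
- move=> v m _ K H; split=> [|w]; first by constructor; rewrite /= addn1 ltnS.
  by rewrite /=; case: eqP => _; rewrite addn1 ?ltnS // ltnW // ltnS.
- move=> v m K H; split=> [|w]; first by constructor.
  by rewrite /=; case: eqP => _; have := H v; have := H w; lia.
- move=> c1 c2 m b1 m1 t1 b2 m2 t2 _ IH1 _ IH2 K H.
  have [E1 H1] := IH1 K H; have [E2 H2] := IH2 _ H1.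
  rewrite addnA; split=> //; apply: ev_seq E2; apply: mono E1 _; lia.
- move=> c c1 c2 m b m1 t1 b2 m2 t2 _ IH1 _ IH2 K H.
  have [E1 H1] := IH1 K H; have [E2 H2] := IH2 _ H1.
  rewrite addnA; split=> //; apply: ev_if E2; apply: mono E1 _; lia.
- move=> c d m m1 t _ IH K H; have [E1 H1] := IH K H; split=> //; exact: ev_stop.
- move=> c d m m1 t1 b2 m2 t2 b3 m3 t3 _ IH1 _ IH2 _ IH3 K H.
  have [E1 H1] := IH1 K H; have [E2 H2] := IH2 _ H1; have [E3 H3] := IH3 _ H2.
  rewrite !addnA; split=> //; apply: ev_go E3; [apply: mono E1 _|apply: mono E2 _]; lia.
Qed.

(** * Compiling pointer commands into one-tape machines *)

Section Compile.
Variables V A : nat.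

Definition psym : finType := ({ffun 'I_V -> bool} * {ffun 'I_A -> bool})%type.
Definition pblank : psym := ([ffun => false], [ffun => false]).

Definition fget (n : nat) (f : {ffun 'I_n -> bool}) (i : nat) : bool :=
  if insub i is Some k then f k else false.
Definition fset (n : nat) (f : {ffun 'I_n -> bool}) (i : nat) (b : bool) :=
  [ffun k : 'I_n => if val k == i then b else f k].

Definition cell (m : memory) (j : nat) : psym :=
  ([ffun v : 'I_V => ptr m v == j], [ffun x : 'I_A => arr m x j]).

Lemma fgetE n (f : nat -> bool) i :
  fget [ffun k : 'I_n => f k] i = (i < n) && f i.
Proof. by rewrite /fget; case: insubP => [k -> <-|/negbTE ->] //; rewrite ffunE. Qed.

Variant prim := PMove of bool | PLocal of (psym -> psym) & (psym -> bool).

(* States: searching for the mark of [v]; placing it again after a move; going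
   home with a result. *)
Definition mprim (v : nat) (o : prim) : mach psym :=
  @Mach psym (option (option bool)) None (fun s x =>
    match s with
    | None =>
        if fget x.1 v then
          match o with
          | PMove d => (inl (Some None), (fset x.1 v false, x.2),
                        if d then MRight else MLeft)
          | PLocal f g => (inl (Some (Some (g x))), f x, MStay)
          end
        else (inl None, x, MRight)
    | Some None => (inl (Some (Some true)), (fset x.1 v true, x.2), MStay)
    | Some (Some b) =>
        if fget x.1 0 then (inr b, x, MStay) else (inl (Some (Some b)), x, MLeft)
    end).

Fixpoint compile (c : cmd) : mach psym :=
  match c with
  | CConst b => mconst psym b
  | CTest x v => mprim v (PLocal id (fun s => fget s.2 x))
  | CSame u v => mprim v (PLocal id (fun s => fget s.1 u))
  | CSet x v b => mprim v (PLocal (fun s => (s.1, fset s.2 x b)) (fun _ => true))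
  | CRight v => mprim v (PMove true)
  | CLeft v => mprim v (PMove false)
  | CSeq c1 c2 => mseq (compile c1) (compile c2)
  | CIf c c1 c2 => mif (compile c) (compile c1) (compile c2)
  | CWhile c c1 => mwhile (compile c) (compile c1)
  end.

(** The condition [0 < v] on moves keeps the mark of pointer 0 on the first cell. A one-tape machine
    cannot sense the left end, so this mark is how it finds its way home. *)
Fixpoint okc (c : cmd) : bool :=
  match c with
  | CConst _ => true
  | CTest x v => (x < A) && (v < V)
  | CSame u v => (u < V) && (v < V)
  | CSet x v _ => (x < A) && (v < V)
  | CRight v | CLeft v => 0 < v < V
  | CSeq c1 c2 | CWhile c1 c2 => okc c1 && okc c2
  | CIf c c1 c2 => [&& okc c, okc c1 & okc c2]
  end.

Definition rep (f : nat -> psym) (i : nat) (tp : tape psym) : Prop :=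
  (forall j, tat pblank tp j = f j) /\ tpos tp = i.

Lemma rep_head f i tp : rep f i tp -> th tp = f i.
Proof. by case=> H <-; rewrite -H tat_pos. Qed.

Lemma rep_act f i tp s mv :
  rep f i tp ->
  rep (fun j => if j == i then s else f j) (mvpos i mv) (act pblank tp s mv).
Proof.
case=> H E; split=> [j|]; last by rewrite tpos_act E.
by rewrite tat_act E H.
Qed.

Lemma rep_ext f g i tp : f =1 g -> rep f i tp -> rep g i tp.
Proof. by move=> E [H1 H2]; split=> // j; rewrite H1. Qed.

Section Prims.
Variables (N : nat) (v : nat) (o : prim).

Lemma mprim_ret f i tp b :
  rep f i tp -> (forall j, fget (f j).1 0 = (j == 0)) ->
  tsize tp <= N -> i < N ->
  exists tp' t, exits pblank N (M := mprim v o) (Some (Some b)) tp b tp' t /\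
    [/\ t <= i.+1, rep f 0 tp' & tsize tp' <= N].
Proof.
elim: i tp => [|i IH] tp R H0 S I.
  exists (act pblank tp (th tp) MStay), 1; split.
    apply: exits_last; first by rewrite /= (rep_head R) H0.
    by rewrite tsize_act /= (proj2 R) geq_max S.
  by split.
have S' : tsize (act pblank tp (th tp) MLeft) <= N.
  by rewrite tsize_act /= (proj2 R) geq_max S /= ltnW.
have R' : rep f i (act pblank tp (th tp) MLeft).
  have := rep_act (th tp) MLeft R; apply: rep_ext => j.
  by case: eqP => // ->; rewrite (rep_head R).
have [tp' [t [H [T1 T2 T3]]]] := IH _ R' H0 S' (ltnW I).
exists tp', t.+1; split=> //.
by apply: exits_step H => //; rewrite /= (rep_head R) H0.
Qed.

(** [exits] speaks only about complete runs, so the partial run up to the mark is expressed as a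
    transformation of runs: whatever exits from the cell [p] also exits from here, [p - i] steps
    later. *)
Lemma mprim_find f i p tp :
  rep f i tp -> (forall j, fget (f j).1 v = (j == p)) ->
  tsize tp <= N -> i <= p -> p < N ->
  exists tp0, [/\ rep f p tp0, tsize tp0 <= N &
    forall b tp' t, exits pblank N (M := mprim v o) None tp0 b tp' t ->
      exits pblank N (M := mprim v o) None tp b tp' (t + (p - i))].
Proof.
move=> R H S; move Ed: (p - i) => d; elim: d i tp R S Ed => [|d IH] i tp R S Ed ip pN.
  by exists tp; split=> //; [have -> : p = i by lia|move=> b tp' t; rewrite addn0].
have S' : tsize (act pblank tp (th tp) MRight) <= N.
  by rewrite tsize_act /= (proj2 R) geq_max S /=; lia.
have R' : rep f i.+1 (act pblank tp (th tp) MRight).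
  have := rep_act (th tp) MRight R; apply: rep_ext => j.
  by case: eqP => // ->; rewrite (rep_head R).
have [|||tp0 [R0 S0 E0]] := IH _ _ R' S'; try lia.
exists tp0; split=> // b tp' t /E0 E; rewrite addnS.
apply: exits_step E => //; rewrite /= (rep_head R) H.
by case: eqP => // ?; lia.
Qed.

End Prims.

Definition tracks (m : memory) (K : nat) (tp : tape psym) : Prop :=
  [/\ rep (cell m) 0 tp, ptr m 0 = 0 & forall v, ptr m v <= K].

Lemma cell_mark m v j : v < V -> fget (cell m j).1 v = (j == ptr m v).
Proof. by move=> vV; rewrite (fgetE _ (fun k => ptr m k == j)) vV eq_sym. Qed.

Lemma cell_bit m x j : x < A -> fget (cell m j).2 x = arr m x j.
Proof. by move=> xA; rewrite (fgetE _ (fun k => arr m k j)) xA. Qed.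

(** The machine walks at most [K] cells to the mark and as many back to cell 0; [2 * K + 6] leaves
    some slack. *)
Lemma mprim_local N K m m' v f g tp :
  0 < V -> v < V -> tracks m K tp -> tsize tp <= N -> K.+2 <= N ->
  ptr m' =1 ptr m ->
  (forall j, cell m' j = if j == ptr m v then f (cell m j) else cell m j) ->
  exists tp' t, exits pblank N (mst0 (mprim v (PLocal f g))) tp
      (g (cell m (ptr m v))) tp' t /\
    [/\ t <= 2 * K + 6, tracks m' K tp' & tsize tp' <= N].
Proof.
move=> V0 vV [R E0 HK] S KN Ep Ec.
have HN : ptr m v < N by have := HK v; lia.
have [tp0 [R0 S0 F0]] := mprim_find (PLocal f g) R (fun j => cell_mark m j vV) S (leq0n _) HN.
set s := cell m (ptr m v).
have R1 : rep (cell m') (ptr m v) (act pblank tp0 (f s) MStay).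
  have := rep_act (f s) MStay R0; apply: rep_ext => j.
  by rewrite Ec /s; case: eqP => // ->.
have S1 : tsize (act pblank tp0 (f s) MStay) <= N.
  by rewrite tsize_act (proj2 R0) /= geq_max S0.
have H0 j : fget (cell m' j).1 0 = (j == 0) by rewrite cell_mark // Ep E0.
have [tp' [t [X [T1 T2 T3]]]] := mprim_ret v (PLocal f g) (g s) R1 H0 S1 HN.
exists tp', (t.+1 + (ptr m v - 0)); split.
  apply: F0; apply: exits_step X => //.
  by rewrite /= (rep_head R0) cell_mark // eqxx.
split=> //; first by have := HK v; lia.
by split=> // [|w]; rewrite Ep.
Qed.

Lemma mprim_move N K m v d tp :
  0 < V -> 0 < v < V -> tracks m K tp -> tsize tp <= N -> K.+2 <= N ->
  mvpos (ptr m v) (if d then MRight else MLeft) <= K ->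
  exists tp' t, exits pblank N (mst0 (mprim v (PMove d))) tp true tp' t /\
    [/\ t <= 2 * K + 6,
      tracks (setp m v (mvpos (ptr m v) (if d then MRight else MLeft))) K tp'
      & tsize tp' <= N].
Proof.
move=> V0 /andP[v0 vV] [R E0 HK] S KN; set mv := if d then _ else _ => HB.
have HN : ptr m v < N by have := HK v; lia.
have [tp0 [R0 S0 F0]] := mprim_find (PMove d) R (fun j => cell_mark m j vV) S (leq0n _) HN.
set s := cell m (ptr m v); set q := mvpos _ _ in HB *.
set tp1 := act pblank tp0 (fset s.1 v false, s.2) mv.
have R1 := rep_act (fset s.1 v false, s.2) mv R0.
rewrite -/tp1 -/q in R1.
have S1 : tsize tp1 <= N.
  by rewrite tsize_act (proj2 R0) /= geq_max S0 /=; apply: leq_trans KN; rewrite ltnS ltnW.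
set s1 := th tp1; set tp2 := act pblank tp1 (fset s1.1 v true, s1.2) MStay.
have R2 := rep_act (fset s1.1 v true, s1.2) MStay R1.
rewrite -/tp2 /= in R2.
have S2 : tsize tp2 <= N by rewrite tsize_act (proj2 R1) /= geq_max S1 /=; lia.
have {}R2 : rep (cell (setp m v q)) q tp2.
  apply: rep_ext R2 => j; rewrite /s1 (rep_head R1) /s /cell.
  transitivity ([ffun u : 'I_V => if val u == v then j == q else ptr m u == j],
                [ffun x : 'I_A => arr m x j]); last first.
    congr (_, _); apply/ffunP => k; rewrite !ffunE //=.
    by case: eqP => // _; rewrite eq_sym.
  (* The case where [q] equals [ptr m v] is a left move from cell 0: the machine stays there, and
     erasing and restoring the mark hit the same cell. *)
  case: (eqVneq j q) => [->|jq]; [case: (eqVneq q) => [<-|Nq] /= |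
    case: (eqVneq j) => [->|Nj] /=]; congr (_, _); apply/ffunP => k;
  rewrite !ffunE //=; try by case: eqP.
  by case: (val k =P v) => // ->; apply/negbTE; rewrite eq_sym.
have H0 j : fget (cell (setp m v q) j).1 0 = (j == 0).
  by rewrite cell_mark //=; case: (0 =P v) v0 => [<-|_ _]; rewrite ?E0.
have qN : q < N by lia.
have [tp' [t [X [T1 T2 T3]]]] := mprim_ret v (PMove d) true R2 H0 S2 qN.
exists tp', (t.+2 + (ptr m v - 0)); split.
  apply: F0; apply: (exits_step (s' := Some None : mst (mprim v (PMove d)))) S1 _.
    by rewrite /= (rep_head R0) cell_mark // eqxx.
  by apply: exits_step X.
split=> //; first by have := HK v; lia.
split=> //=; first by case: eqP v0 => // <-.
by move=> w; case: eqP => // _; exact: leq_trans HB.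
Qed.

(** Each elementary command is one sweep of cost at most [2 * B + 6], since every mark stays within
    the first [B + 1] cells. Control flow costs nothing, because exits are redirected in the
    transition table. *)
Theorem compileP B c m b m' t N tp :
  0 < V -> ev (Some B) c m b m' t -> okc c -> tracks m B tp ->
  tsize tp <= N -> B.+2 <= N ->
  exists tp' t', exits pblank N (mst0 (compile c)) tp b tp' t' /\
    [/\ t' <= t * (2 * B + 6), tracks m' B tp' & tsize tp' <= N].
Proof.
move=> V0 H; elim: H tp => {c m b m' t}.
- move=> b m tp _ T S BN; exists (act pblank tp (th tp) MStay), 1.
  have S' : tsize (act pblank tp (th tp) MStay) <= N.
    by case: T => R _ _; rewrite tsize_act (proj2 R) /= geq_max S /=; lia.
  split; first exact: exits_last.
  by split=> //; lia.
- move=> x v m tp /= /andP[xA vV] T S BN; rewrite mul1n -(cell_bit _ _ xA).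
  by apply: mprim_local T S BN _ _ => // j; case: ifP.
- move=> u v m tp /= /andP[uV vV] T S BN; rewrite mul1n eq_sym -(cell_mark _ _ uV).
  by apply: mprim_local T S BN _ _ => // j; case: ifP.
- move=> x v b m tp /= /andP[xA vV] T S BN; rewrite mul1n.
  apply: mprim_local T S BN _ _ => // j.
  rewrite /cell /=; case: eqP => [->|E]; congr (_, _); apply/ffunP => k;
  rewrite !ffunE /=; case: eqP => //; last by case: eqP.
  by rewrite eqxx.
- move=> v m /= lt tp ok T S BN; rewrite mul1n.
  exact: (mprim_move (d := true) V0 ok T S BN lt).
- move=> v m tp ok T S BN; rewrite mul1n.
  apply: (mprim_move (d := false) V0 ok T S BN) => /=.
  by case: T => _ _ /(_ v); lia.
- move=> c1 c2 m b1 m1 t1 b2 m2 t2 _ IH1 _ IH2 tp /= /andP[k1 k2] T S BN.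
  have [tp1 [u1 [X1 [L1 T1 S1]]]] := IH1 _ k1 T S BN.
  have [tp2 [u2 [X2 [L2 T2 S2]]]] := IH2 _ k2 T1 S1 BN.
  exists tp2, (u1 + u2); split; first exact: exits_mseq X1 X2.
  by split=> //; rewrite mulnDl leq_add.
- move=> c c1 c2 m b1 m1 t1 b2 m2 t2 _ IH1 _ IH2 tp /= /and3P[k k1 k2] T S BN.
  have [tp1 [u1 [X1 [L1 T1 S1]]]] := IH1 _ k T S BN.
  have kb : okc (if b1 then c1 else c2) by case: (b1).
  have [tp2 [u2 [X2 [L2 T2 S2]]]] := IH2 _ kb T1 S1 BN.
  exists tp2, (u1 + u2); split; last by split=> //; rewrite mulnDl leq_add.
  by apply: exits_mif X1 _; case: (b1) X2.
- move=> c d m m1 t _ IH tp /= /andP[k1 k2] T S BN.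
  have [tp1 [u1 [X1 [L1 T1 S1]]]] := IH _ k1 T S BN.
  by exists tp1, u1; split=> //; apply: exits_mwhile_stop.
- move=> c d m m1 t1 b2 m2 t2 b3 m3 t3 _ IH1 _ IH2 _ IH3 tp ok T S BN.
  have /andP[k1 k2] : okc c && okc d by [].
  have [tp1 [u1 [X1 [L1 T1 S1]]]] := IH1 _ k1 T S BN.
  have [tp2 [u2 [X2 [L2 T2 S2]]]] := IH2 _ k2 T1 S1 BN.
  have [tp3 [u3 [X3 [L3 T3 S3]]]] := IH3 _ ok T2 S2 BN.
  exists tp3, (u1 + u2 + u3); split; first exact: exits_mwhile_go X1 X2 X3.
  by split=> //; rewrite !mulnDl !leq_add.
Qed.

End Compile.

(** * Pointer programs as Turing machines that decide or compute *)

Definition cfg_tape (M : TM) (c : config M) : tape (tm_sym M) :=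
  Tape (c_left c) (c_head c) (c_right c).

Definition mkcfg (M : TM) (q : tm_state M) (tp : tape (tm_sym M)) : config M :=
  Config q (tl tp) (th tp) (tr tp).

Lemma step_act (M : TM) (c : config M) q a mv :
  ~~ halted c -> tm_delta (c_state c) (c_head c) = (q, a, mv) ->
  step c = mkcfg q (act (tm_blank M) (cfg_tape c) a mv).
Proof.
move=> /negbTE H E; rewrite /step H E.
by case: c {H E} => s [|b l] h [|b' r] /=; case: mv.
Qed.

Lemma halted_stable (M : TM) (c : config M) k : halted c -> iter k (@step M) c = c.
Proof. by move=> H; elim: k => //= k ->; rewrite /step H. Qed.

Section ProgramTM.
Variables (V A : nat) (c : cmd).
Hypotheses (V0 : 0 < V) (A4 : 3 < A) (okc_c : okc V A c).

Let S := mst (compile V A c).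

(* The first step puts all the marks on the first cell. Arrays 0 and 1 hold the
   input bits and their domain, arrays 2 and 3 those of the output. *)
Definition ptm : TM :=
  @MkTM (option (S + bool))%type (psym V A) (pblank V A)
    (fun b => ([ffun => false],
               [ffun x : 'I_A => if val x == 0 then b else val x == 1]))
    (fun s => if fget s.2 3 then Some (fget s.2 2) else None)
    None (Some (inr true)) (Some (inr false))
    (fun q x => match q with
       | None => (Some (inl (mst0 _)), ([ffun => true], x.2), MStay)
       | Some (inl s) => match mdelta (compile V A c) s x with
           | (inl s', a, mv) => (Some (inl s'), a, mv)
           | (inr b, a, mv) => (Some (inr b), a, mv)
           end
       | Some (inr b) => (q, x, MStay)
       end).

Definition mem0 (w : seq bool) : memory :=
  MkMem (fun _ => 0)
      (fun x j => if x == 0 then nth false w j else (x == 1) && (j < size w)).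

Let running (s : S) (tp : tape (psym V A)) : config ptm :=
  mkcfg (M := ptm) (Some (inl s)) tp.
Let stopped (b : bool) (tp : tape (psym V A)) : config ptm :=
  mkcfg (M := ptm) (Some (inr b)) tp.

Lemma halted_stopped b tp : halted (stopped b tp).
Proof. by case: b. Qed.

Lemma exits_run N s tp b tp' t :
  exits (M := compile V A c) (pblank V A) N s tp b tp' t ->
  iter t (@step ptm) (running s tp) = stopped b tp' /\
  forall k, 0 < k -> space (iter k (@step ptm) (running s tp)) <= N.
Proof.
elim=> {s tp b tp' t} [s tp b a mv E L|s tp s' a mv b tp' t E L X [IH1 IH2]].
  have Es : step (running s tp) = stopped b (act (pblank V A) tp a mv).
    by rewrite (step_act (M := ptm) (q := Some (inr b)) (a := a) (mv := mv)) //= ?E //; case: (tp).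
  split=> //= -[] // k _; rewrite iterSr Es halted_stable ?halted_stopped //.
have Es : step (running s tp) = running s' (act (pblank V A) tp a mv).
  by rewrite (step_act (M := ptm) (q := Some (inl s')) (a := a) (mv := mv)) //= ?E //; case: (tp).
split=> [|[//|k] _]; rewrite iterSr Es //.
by case: k => [|k]; [exact: L|exact: IH2].
Qed.

(** [maxn 1] covers the empty word, which still occupies one blank cell. *)
Lemma init_step w :
  exists tp, [/\ step (init_config ptm w) = running (mst0 _) tp,
    rep (cell V A (mem0 w)) 0 tp & tsize tp = (maxn 1 (size w))].
Proof.
set c0 := init_config ptm w.
have Ec : c_state c0 = None by rewrite /c0; case: (w).
have Hh : ~~ halted c0 by rewrite /halted Ec.
set tp0 := cfg_tape c0.
exists (act (pblank V A) tp0 ([ffun => true], (th tp0).2) MStay); split.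
- by rewrite (step_act (M := ptm) (q := Some (inl (mst0 _)))
        (a := ([ffun => true], (th tp0).2)) (mv := MStay)) // Ec.
- have P0 : tpos tp0 = 0 by rewrite /tp0 /c0; case: (w).
  split; last by rewrite tpos_act P0.
  move=> j; rewrite tat_act P0 /cell.
  have Ht j' : tat (pblank V A) tp0 j' =
    ([ffun => false], [ffun x : 'I_A => arr (mem0 w) x j']).
    rewrite /tat /tp0 /c0 /=; case: (w) => [|b w'] /=.
      by case: j' => [|j'] /=; rewrite ?nth_nil /=; congr (_, _); apply/ffunP => k;
        rewrite !ffunE /=; case: eqP => //; case: eqP.
    case: j' => [|j'] /=; first by congr (_, _); apply/ffunP => k; rewrite !ffunE //= andbT.
    have [H|H] := leqP (size w') j'.
      rewrite nth_default ?size_map //; congr (_, _); apply/ffunP => k; rewrite !ffunE //=.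
      by rewrite ltnS ltnNge H /= andbF nth_default //; case: eqP.
    rewrite (nth_map false) //; congr (_, _); apply/ffunP => k; rewrite !ffunE //=.
    by rewrite ltnS H andbT.
  case: (eqVneq j 0) => [->|j0].
    rewrite -(tat_pos (pblank V A) tp0) P0 Ht /=.
    by congr (_, _); apply/ffunP => k; rewrite !ffunE.
  by rewrite Ht; congr (_, _); apply/ffunP => k; rewrite !ffunE /= eq_sym (negbTE j0).
- rewrite /tsize /tp0 /c0; case: (w) => [|b w'] //=; rewrite size_map; lia.
Qed.

Lemma prog_run B b m' t w :
  ev (Some B) c (mem0 w) b m' t ->
  exists tp t', [/\ run ptm w t' = stopped b tp, t' <= t * (2 * B + 6) + 1,
    tracks (V := V) (A := A) m' B tp & forall k, space (run ptm w k) <= maxn (size w) B.+2].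
Proof.
move=> H; have [tp0 [E0 R0 S0]] := init_step w.
have T0 : tracks (V := V) (A := A) (mem0 w) B tp0 by split.
have [||tp [t' [X [L T SN]]]] := compileP (N := maxn (size w) B.+2) V0 H okc_c T0; try lia.
have [X1 X2] := exits_run X.
exists tp, t'.+1; split; [|lia|done|].
  by rewrite /run iterSr E0.
have S0' : tsize tp0 <= maxn (size w) B.+2 by lia.
move=> [|[|k]]; rewrite /run ?iterSr.
- rewrite /= /space; case: (w) => [|b' w'] /=; rewrite ?size_map; lia.
- by rewrite E0.
- by rewrite E0 -iterSr; apply: X2.
Qed.

Theorem ptm_decides (L : language) (B s : nat -> nat) :
  (forall n, maxn n (B n).+2 <= s n) ->
  (forall w, exists b m' t,
     ev (Some (B (size w))) c (mem0 w) b m' t /\ (b <-> L w)) ->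
  decides_in_space ptm L s.
Proof.
move=> Hs H w; have [b [m' [t [X HL]]]] := H w.
have [tp [t' [E _ _ Sp]]] := prog_run X.
split; first by exists t'; rewrite E halted_stopped.
split; first by move=> k; apply: leq_trans (Hs _).
rewrite -HL; split=> [bT|[k Ek]]; first by exists t'; rewrite E bT.
have Hk : halted (run ptm w k) by rewrite /halted Ek eqxx.
(* Halted configurations no longer change, so both runs agree when continued up to the later of the
   two times. *)
have : run ptm w t' = run ptm w k.
  rewrite -(halted_stable (maxn k t' - t') (c := run ptm w t')) ?E ?halted_stopped // -E.
  rewrite -[RHS](halted_stable (maxn k t' - k)) // /run -!iterD.
  by congr (iter _ _ _); lia.
by rewrite E => /(congr1 (@c_state _)); rewrite Ek; case: (b).
Qed.

(** [T] is used twice, as the number of commands and, through [ev_bounded], as the bound on the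
    pointers and thus on the length of each sweep; this makes the machine's time quadratic in
    [T]. *)
Theorem ptm_computes (f : seq bool -> seq bool) (T tb : nat -> nat) :
  (forall n, T n * (2 * T n + 6) + 1 <= tb n) ->
  (forall w, exists m' t, [/\ ev None c (mem0 w) true m' t, t <= T (size w),
     forall j, arr m' 3 j = (j < size (f w)), ptr m' 4 = size (f w) &
     forall j, j < size (f w) -> arr m' 2 j = nth false (f w) j]) ->
  4 < V -> computes_in_time ptm f tb.
Proof.
move=> Ht H V4 w; have [m' [t [X Lt O1 O2 O3]]] := H w.
have [{}X _] := ev_bounded X (fun v => leqnn 0).
have [tp [t' [E Lt' [[Ht1 _] _ _] _]]] := prog_run X.
have E2 : run ptm w (tb (size w)) = stopped true tp.
  have -> : tb (size w) = tb (size w) - t' + t'.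
    rewrite subnK //; apply: leq_trans (Ht _); apply: leq_trans Lt' _.
    by rewrite leq_add2r add0n leq_mul // leq_add2r leq_mul2l Lt orbT.
  by rewrite /run iterD -/(run ptm w t') E halted_stable ?halted_stopped.
rewrite E2; split=> //.
rewrite /tape_output -/(tcells tp) /=.
(* Pointer 4 stands just after the output. Its mark is not blank, so the written tape extends past
   the output. *)
have SL : size (f w) < size (tcells tp).
  rewrite ltnNge; apply/negP => HL.
  have := Ht1 (ptr m' 4); rewrite /tat nth_default ?O2 // => /(congr1 (fun s => fget s.1 4)).
  rewrite cell_mark // O2 eqxx /fget /=.
  by case: insubP => // k _ _; rewrite ffunE.
have -> : tcells tp = [seq cell V A m' j | j <- iota 0 (size (tcells tp))].
  apply: (@eq_from_nth _ (pblank V A)); rewrite ?size_map ?size_iota // => j Hj.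
  by rewrite (nth_map 0) ?size_iota // nth_iota // -Ht1.
set L := size (tcells tp) in SL *; rewrite -(subnKC SL) addSnnS iotaD map_cat pmap_cat add0n.
have -> : pmap (tm_out (t := ptm)) [seq cell V A m' j | j <- iota 0 (size (f w))] = f w.
  transitivity (pmap Some (f w)); last by elim: (f w) => //= x s ->.
  rewrite -[in RHS](mkseq_nth false (f w)) /mkseq.
  have : forall j, j \in iota 0 (size (f w)) -> j < size (f w).
    by move=> j; rewrite mem_iota.
  elim: (iota _ _) => //= j s IH Hj.
  have Hj1 : j < size (f w) by apply: Hj; rewrite inE eqxx.
  rewrite !cell_bit ?O1 ?Hj1 ?O3 ?IH //; last by lia.
  by move=> k Hk; apply: Hj; rewrite inE Hk orbT.
rewrite -[RHS]cats0; congr (_ ++ _).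
have : forall j, j \in iota (size (f w)) (L - (size (f w)).+1).+1 -> size (f w) <= j.
  by move=> j; rewrite mem_iota => /andP[].
elim: (iota _ _) => //= j s IH Hj.
rewrite cell_bit // O1 ltnNge Hj ?inE ?eqxx //= IH // => k Hk.
by apply: Hj; rewrite inE Hk orbT.
Qed.

End ProgramTM.

(** * A calculus for pointer programs *)

Fixpoint modp (c : cmd) : seq nat :=
  match c with
  | CRight v | CLeft v => [:: v]
  | CSeq c1 c2 | CWhile c1 c2 => modp c1 ++ modp c2
  | CIf c c1 c2 => modp c ++ modp c1 ++ modp c2
  | _ => [::]
  end.

Fixpoint moda (c : cmd) : seq nat :=
  match c with
  | CSet x _ _ => [:: x]
  | CSeq c1 c2 | CWhile c1 c2 => moda c1 ++ moda c2
  | CIf c c1 c2 => moda c ++ moda c1 ++ moda c2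
  | _ => [::]
  end.

(** A frame condition: [P] and [A] list what may have changed. The lists come from the program text
    by [modp] and [moda], so side conditions on concrete programs are settled by computation. *)
Definition agree (P A : seq nat) (m m' : memory) : Prop :=
  (forall v, v \notin P -> ptr m' v = ptr m v) /\
  (forall x, x \notin A -> arr m' x = arr m x).

Lemma agree_refl P A m : agree P A m m.
Proof. by []. Qed.

Lemma agree_trans P A m1 m2 m3 :
  agree P A m1 m2 -> agree P A m2 m3 -> agree P A m1 m3.
Proof. by case=> H1 H2 [H3 H4]; split=> z Hz; rewrite ?H3 ?H4 ?H1 ?H2. Qed.

Lemma agree_sub P A P' A' m1 m2 :
  {subset P <= P'} -> {subset A <= A'} -> agree P A m1 m2 -> agree P' A' m1 m2.
Proof.
move=> HP HA [H1 H2].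
by split=> z Hz; [apply: H1; apply: contra Hz => /HP|apply: H2; apply: contra Hz => /HA].
Qed.

Lemma agree_incl P A P' A' m1 m2 :
  all (fun z => z \in P') P && all (fun z => z \in A') A ->
  agree P A m1 m2 -> agree P' A' m1 m2.
Proof. by case/andP => /allP HP /allP HA; apply: agree_sub. Qed.

Lemma agree_setp P A m1 m2 v x :
  v \in P -> agree P A m1 m2 -> agree P A m1 (setp m2 v x).
Proof. by move=> vP [H1 H2]; split=> //= u uP; case: eqP uP vP => [->|_ /H1 //] /negbTE ->. Qed.

Lemma agree_seta P A m1 m2 x j b :
  x \in A -> agree P A m1 m2 -> agree P A m1 (seta m2 x j b).
Proof. by move=> xA [H1 H2]; split=> //= y yA; case: eqP yA xA => [->|_ /H2 //] /negbTE ->. Qed.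

Lemma ev_agree B c m b m' t : ev B c m b m' t -> agree (modp c) (moda c) m m'.
Proof.
have L (s1 s2 : seq nat) : {subset s1 <= s1 ++ s2} by move=> z; rewrite mem_cat => ->.
have R (s1 s2 : seq nat) : {subset s2 <= s1 ++ s2}.
  by move=> z; rewrite mem_cat => ->; rewrite orbT.
elim=> {c m b m' t} //=.
- by move=> x v b m; split=> //= y; rewrite inE => /negbTE ->.
- by move=> v m _; split=> //= y; rewrite inE => /negbTE ->.
- by move=> v m; split=> //= y; rewrite inE => /negbTE ->.
- move=> c1 c2 m b1 m1 t1 b2 m2 t2 _ H1 _ H2.
  exact: agree_trans (agree_sub (@L _ _) (@L _ _) H1) (agree_sub (@R _ _) (@R _ _) H2).
- move=> c c1 c2 m b m1 t1 b2 m2 t2 _ H1 _ H2.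
  apply: agree_trans (agree_sub (@L _ _) (@L _ _) H1) _.
  by case: b H1 H2 => _; apply: agree_sub => z Hz; rewrite !mem_cat Hz ?orbT.
- by move=> c d m m1 t _; apply: agree_sub; apply: L.
- move=> c d m m1 t1 b2 m2 t2 b3 m3 t3 _ H1 _ H2 _ H3.
  apply: agree_trans H3; apply: agree_trans (agree_sub (@L _ _) (@L _ _) H1) _.
  exact: (agree_sub (@R _ _) (@R _ _) H2).
Qed.

Fixpoint pure (c : cmd) : bool :=
  match c with
  | CConst _ | CTest _ _ | CSame _ _ => true
  | CIf c c1 c2 => [&& pure c, pure c1 & pure c2]
  | _ => false
  end.

Fixpoint beval (c : cmd) (m : memory) : bool :=
  match c with
  | CConst b => b
  | CTest x v => arr m x (ptr m v)
  | CSame u v => ptr m u == ptr m v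
  | CIf c c1 c2 => if beval c m then beval c1 m else beval c2 m
  | _ => true
  end.

Fixpoint csize (c : cmd) : nat :=
  match c with
  | CSeq c1 c2 | CWhile c1 c2 => csize c1 + csize c2
  | CIf c c1 c2 => csize c + csize c1 + csize c2
  | _ => 1
  end.

Lemma ev_pure B c m : pure c -> exists2 t, t <= csize c & ev B c m (beval c m) m t.
Proof.
elim: c => //= [b _|x v _|u v _|c IH c1 IH1 c2 IH2 /and3P[/IH [t Lt H] k1 k2]].
- by exists 1 => //; constructor.
- by exists 1 => //; constructor.
- by exists 1 => //; constructor.
case E: (beval c m).
  have [t1 L1 H1] := IH1 k1; exists (t + t1); first lia.
  by rewrite E in H; apply: ev_if H _.
have [t1 L1 H1] := IH2 k2; exists (t + t1); first lia.
by rewrite E in H; apply: ev_if H _.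
Qed.

Definition cskip := CConst true.
Definition cnot c := CIf c (CConst false) (CConst true).
Definition cand c1 c2 := CIf c1 c2 (CConst false).
Definition cor c1 c2 := CIf c1 (CConst true) c2.
Definition ceq c1 c2 := CIf c1 c2 (cnot c2).
Definition cassign x v c := CIf c (CSet x v true) (CSet x v false).
Definition czero v := CWhile (cnot (CSame v 0)) (CLeft v).
Definition ccopy v u := CSeq (czero v) (CWhile (cnot (CSame v u)) (CRight v)).
Definition cfor j e c := CSeq (czero j) (CWhile (cnot (CSame j e)) (CSeq c (CRight j))).

(** Functional extensionality gives equality of the memories themselves, so that the effect of a
    program can be stated as one updated memory. *)
Lemma setp_id m v : setp m v (ptr m v) = m.
Proof.
case: m => p a; rewrite /setp /=; congr MkMem.
by apply: functional_extensionality => u; case: eqP => // ->.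
Qed.

Lemma setp_setp m v x y : setp (setp m v x) v y = setp m v y.
Proof.
rewrite /setp /=; congr MkMem.
by apply: functional_extensionality => u; case: eqP.
Qed.

(** A round costs at most 3 for the test and 1 for the move, and the last test costs at most 3. *)
Lemma ev_czero B v m :
  v != 0 -> ptr m 0 = 0 ->
  exists2 t, t <= 4 * ptr m v + 3 & ev B (czero v) m true (setp m v 0) t.
Proof.
move=> v0 E0; move Ek: (ptr m v) => k; elim: k m E0 Ek => [|k IH] m E0 Ek.
  have [t Lt H] := ev_pure B m (c := cnot (CSame v 0)) isT.
  exists t => //; rewrite -Ek setp_id; apply: ev_stop.
  by rewrite /= Ek E0 in H.
have [t Lt H] := ev_pure B m (c := cnot (CSame v 0)) isT.
rewrite /= Ek E0 /= in H Lt.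
have E0' : ptr (setp m v k) 0 = 0 by rewrite /= [0 == v]eq_sym (negbTE v0).
have Ek' : ptr (setp m v k) v = k by rewrite /= eqxx.
have [t2 L2 H2] := IH _ E0' Ek'.
exists (t + 1 + t2); first lia.
rewrite setp_setp in H2; apply: (ev_go H _ H2).
by have := ev_left B v m; rewrite Ek; apply.
Qed.

Lemma ev_ccopy B v u m :
  v != 0 -> v != u -> ptr m 0 = 0 ->
  (if B is Some b then ptr m u <= b else true) ->
  exists2 t, t <= 4 * (ptr m v + ptr m u) + 6
           & ev B (ccopy v u) m true (setp m v (ptr m u)) t.
Proof.
move=> v0 vu E0 LB; have [t0 L0 H0] := ev_czero B v0 E0.
suff [t Lt H] : exists2 t, t <= 4 * ptr m u + 3 &
    ev B (CWhile (cnot (CSame v u)) (CRight v)) (setp m v 0) true (setp m v (ptr m u)) t.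
  by exists (t0 + t); [lia|apply: ev_seq H0 H].
(* Zero is written as a difference so that the induction can run on the distance still to be
   covered. *)
have -> : setp m v 0 = setp m v (ptr m u - ptr m u) by rewrite subnn.
set fin := setp m v (ptr m u); move: {1 3 5}(ptr m u) (leqnn (ptr m u)) => k.
elim: k => [|k IH] Lk.
  rewrite subn0 -/fin; have [t Lt H] := ev_pure B fin (c := cnot (CSame v u)) isT.
  exists t; first by rewrite /= in Lt; lia.
  by apply: ev_stop; rewrite /fin /= !eqxx [u == v]eq_sym (negbTE vu) eqxx in H *.
set m1 := setp m v _.
have [t Lt H] := ev_pure B m1 (c := cnot (CSame v u)) isT.
have [t2 L2 H2] := IH (ltnW Lk).
rewrite /= eqxx [u == v]eq_sym (negbTE vu) in H.
have Hne : (ptr m u - k.+1 == ptr m u) = false by apply/eqP; lia.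
rewrite Hne in H.
exists (t + 1 + t2); first by rewrite /= in Lt; lia.
apply: (ev_go H _ H2).
have := @ev_right B v m1; rewrite /= eqxx setp_setp.
have -> : (ptr m u - k.+1).+1 = ptr m u - k by lia.
by apply; case: (B) LB => //= b; lia.
Qed.

Section WP.
Variable B : nat.

(** Total correctness: a terminating run that moves no pointer beyond [B] is exhibited. Its length
    is forgotten, since deciding in bounded space asks only for halting. *)
Definition wp (c : cmd) (m : memory) (Q : bool -> memory -> Prop) : Prop :=
  exists b m' t, ev (Some B) c m b m' t /\ Q b m'.

Lemma wp_conseq c m Q Q' :
  wp c m Q -> (forall b m', agree (modp c) (moda c) m m' -> Q b m' -> Q' b m') ->
  wp c m Q'.
Proof.
move=> [b [m' [t [H HQ]]]] HQ'; exists b, m', t; split=> //.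
by apply: HQ' => //; apply: ev_agree H.
Qed.

Lemma wp_seq c1 c2 m Q :
  wp c1 m (fun _ m1 => wp c2 m1 Q) -> wp (CSeq c1 c2) m Q.
Proof.
move=> [b [m1 [t1 [H1 [b2 [m2 [t2 [H2 HQ]]]]]]]].
by exists b2, m2, (t1 + t2); split=> //; apply: ev_seq H1 H2.
Qed.

Lemma wp_if c c1 c2 m Q :
  wp c m (fun b m1 => wp (if b then c1 else c2) m1 Q) -> wp (CIf c c1 c2) m Q.
Proof.
move=> [b [m1 [t1 [H1 [b2 [m2 [t2 [H2 HQ]]]]]]]].
by exists b2, m2, (t1 + t2); split=> //; apply: ev_if H1 H2.
Qed.

Lemma wp_pure c m (Q : bool -> memory -> Prop) : pure c -> Q (beval c m) m -> wp c m Q.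
Proof. by move=> /(ev_pure (Some B) m)[t _ H] HQ; exists (beval c m), m, t. Qed.

Lemma wp_ifp c c1 c2 m Q :
  pure c -> (beval c m = true -> wp c1 m Q) -> (beval c m = false -> wp c2 m Q) ->
  wp (CIf c c1 c2) m Q.
Proof.
move=> Pc H1 H2; apply: wp_if; apply: wp_pure => //.
by case: (beval c m) H1 H2 => H1 H2; [apply: H1|apply: H2].
Qed.

Lemma wp_set x v b m (Q : bool -> memory -> Prop) :
  Q true (seta m x (ptr m v) b) -> wp (CSet x v b) m Q.
Proof. by move=> HQ; exists true, (seta m x (ptr m v) b), 1; split=> //; constructor. Qed.

Lemma wp_assign x v c m (Q : bool -> memory -> Prop) :
  pure c -> Q true (seta m x (ptr m v) (beval c m)) -> wp (cassign x v c) m Q.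
Proof.
move=> Pc HQ; apply: wp_ifp => // E; apply: wp_set; by rewrite E in HQ.
Qed.

Lemma wp_right v m (Q : bool -> memory -> Prop) :
  ptr m v < B -> Q true (setp m v (ptr m v).+1) -> wp (CRight v) m Q.
Proof. by move=> LB HQ; exists true, (setp m v (ptr m v).+1), 1; split=> //; constructor. Qed.

Lemma wp_left v m (Q : bool -> memory -> Prop) :
  Q true (setp m v (ptr m v).-1) -> wp (CLeft v) m Q.
Proof. by move=> HQ; exists true, (setp m v (ptr m v).-1), 1; split=> //; constructor. Qed.

Lemma wp_zero v m (Q : bool -> memory -> Prop) :
  v != 0 -> ptr m 0 = 0 -> Q true (setp m v 0) -> wp (czero v) m Q.
Proof. by move=> v0 E0 HQ; have [t _ H] := ev_czero (Some B) v0 E0; exists true, (setp m v 0), t. Qed.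

Lemma wp_copy v u m (Q : bool -> memory -> Prop) :
  v != 0 -> v != u -> ptr m 0 = 0 -> ptr m u <= B ->
  Q true (setp m v (ptr m u)) -> wp (ccopy v u) m Q.
Proof.
move=> v0 vu E0 LB HQ; have [t _ H] := ev_ccopy (B := Some B) v0 vu E0 LB.
by exists true, (setp m v (ptr m u)), t.
Qed.

Lemma wp_while c d m Q :
  pure c ->
  (beval c m = true -> wp d m (fun _ m1 => wp (CWhile c d) m1 Q)) ->
  (beval c m = false -> Q true m) ->
  wp (CWhile c d) m Q.
Proof.
move=> Pc Hgo Hstop; have [t _ H] := ev_pure (Some B) m Pc.
case E: (beval c m) Hgo Hstop H => Hgo Hstop H; last first.
  by exists true, m, t; split; [apply: ev_stop|apply: Hstop].
have [b1 [m1 [t1 [H1 [b2 [m2 [t2 [H2 HQ]]]]]]]] := Hgo erefl.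
by exists b2, m2, (t + t1 + t2); split=> //; apply: ev_go H H1 H2.
Qed.

Definition for_ok j e c :=
  [&& j != 0, j != e, j \notin modp c, e \notin modp c & 0 \notin modp c].

(** The invariant after a round refers to the memory in which [j] is already advanced. The body also
    receives [agree] with the memory before the loop, so facts about what the loop leaves alone need
    not be part of [I]. *)
Lemma wp_for j e c (I : nat -> memory -> Prop) m (Q : bool -> memory -> Prop) :
  for_ok j e c -> ptr m 0 = 0 -> ptr m e <= B ->
  I 0 (setp m j 0) ->
  (forall i m1, i < ptr m e -> agree (j :: modp c) (moda c) m m1 -> ptr m1 j = i ->
     I i m1 -> wp c m1 (fun _ m2 => I i.+1 (setp m2 j i.+1))) ->
  (forall m1, agree (j :: modp c) (moda c) m m1 -> ptr m1 j = ptr m e ->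
     I (ptr m e) m1 -> Q true m1) ->
  wp (cfor j e c) m Q.
Proof.
case/and5P => j0 je jc ec zc E0 EB I0 IS HQ.
apply: wp_seq; apply: wp_zero => //.
have : agree (j :: modp c) (moda c) m (setp m j 0) by apply: agree_setp => //; rewrite inE eqxx.
have : ptr (setp m j 0) j = 0 by rewrite /= eqxx.
move: (setp m j 0) I0 => m1 I0 Ej Ag.
have : 0 + ptr m e = ptr m e by [].
move: {1 2 3}0 {1}(ptr m e) I0 Ej => i d; elim: d i m1 Ag => [|d IH] i m1 Ag Ii Ej Ed.
  have Hb : beval (cnot (CSame j e)) m1 = false.
    by rewrite /= Ej (proj1 Ag e) ?inE ?negb_or ?[e == j]eq_sym ?je // -Ed addn0 eqxx.
  apply: wp_while; rewrite ?Hb // => _.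
  by apply: HQ; rewrite // -Ed addn0.
have Hb : beval (cnot (CSame j e)) m1 = true.
  rewrite /= Ej (proj1 Ag e) ?inE ?negb_or ?[e == j]eq_sym ?je // -Ed.
  by case: eqP => //; lia.
apply: wp_while; rewrite ?Hb //.
move=> _; apply: wp_seq; have Li : i < ptr m e by lia.
apply: wp_conseq (IS i m1 Li Ag Ej Ii) _ => _ m2 Ag2 HI.
have Ej2 : ptr m2 j = i by rewrite (proj1 Ag2).
apply: wp_right; first by rewrite Ej2; lia.
rewrite Ej2; apply: (IH i.+1); rewrite ?addSnnS //; last by rewrite /= eqxx.
apply: agree_setp; first by rewrite inE eqxx.
apply: agree_trans Ag _; apply: agree_sub Ag2 => // z Hz; by rewrite inE Hz orbT.
Qed.

End WP.

(** * Codes, quantified formulas and Savitch's recursion *)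

(** Prefix-freeness, stated with arbitrary continuations so that it passes through
    concatenations. *)
Lemma enc_nat_cat_inj a b u v :
  enc_nat a ++ u = enc_nat b ++ v -> a = b /\ u = v.
Proof.
by elim: a b => [|a IH] [|b] //= => [[]|[/IH [-> ->]]].
Qed.

Lemma enc_flatten_inj (T : Type) (enc : T -> seq bool) (s t : seq T) u v :
  (forall x y u v, enc x ++ u = enc y ++ v -> x = y /\ u = v) ->
  size s = size t ->
  flatten (map enc s) ++ u = flatten (map enc t) ++ v -> s = t /\ u = v.
Proof.
move=> Hinj; elim: s t => [|x s IH] [|y t] //= [Est].
by rewrite -!catA => /Hinj[-> /(IH _ Est)[-> ->]].
Qed.

Lemma enc_nats_cat s u :
  enc_nats s ++ u = enc_nat (size s) ++ (flatten (map enc_nat s) ++ u).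
Proof. by rewrite catA. Qed.

Lemma enc_op_cat o u :
  enc_op o ++ u = enc_nats (op_pre o) ++ (enc_nats (op_add o) ++ (enc_nats (op_del o) ++ u)).
Proof. by rewrite -(catA (enc_nats (op_pre o))) -(catA (enc_nats (op_add o))). Qed.

Lemma enc_ops_cat s u :
  enc_ops s ++ u = enc_nat (size s) ++ (flatten (map enc_op s) ++ u).
Proof. by rewrite catA. Qed.

Lemma enc_nats_cat_inj a b u v :
  enc_nats a ++ u = enc_nats b ++ v -> a = b /\ u = v.
Proof.
rewrite !enc_nats_cat => /enc_nat_cat_inj[E].
exact: enc_flatten_inj enc_nat_cat_inj E.
Qed.

Lemma enc_op_cat_inj a b u v : enc_op a ++ u = enc_op b ++ v -> a = b /\ u = v.
Proof.
case: a b => [p1 a1 d1] [p2 a2 d2]; rewrite !enc_op_cat /=.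
by do 3 (move=> /enc_nats_cat_inj[->]); move=> ->.
Qed.

Lemma enc_ops_cat_inj a b u v : enc_ops a ++ u = enc_ops b ++ v -> a = b /\ u = v.
Proof.
rewrite !enc_ops_cat => /enc_nat_cat_inj[E].
exact: enc_flatten_inj enc_op_cat_inj E.
Qed.

(** Makes the instance behind a word unique, so the existential in [plan_modification] can be
    resolved to the instance at hand. *)
Lemma enc_input_inj : injective enc_input.
Proof.
case=> [c1 o1 a1 b1 g1 p1] [c2 o2 a2 b2 g2 p2]; rewrite /enc_input /=.
move=> /enc_nat_cat_inj[-> /enc_ops_cat_inj[->]].
do 3 (move=> /enc_nats_cat_inj[->]).
by rewrite -[enc_nats p1]cats0 -[enc_nats p2]cats0 => /enc_nats_cat_inj[->].
Qed.

(* A total reader for codes: [rdn] reads a number, and running past the end of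
   the word is recorded by the Boolean. *)
Definition rdn (u : seq bool) : nat := index false u.
Definition vnat (s : seq bool * bool) : seq bool * bool :=
  (drop (rdn s.1).+1 s.1, s.2 && (false \in s.1)).
Definition vnats (s : seq bool * bool) : seq bool * bool :=
  iter (rdn s.1) vnat (vnat s).
(** An operator is coded as three lists without a separator. After the number of conditions and the
    number [k] of operators, a code is therefore a plain sequence of [3 * k + 4] lists, the last
    four being the two states, the goal and the plan; the word must end there. *)
Definition valid (w : seq bool) : bool :=
  let s := vnat (w, true) in
  iter (3 * rdn s.1 + 4) vnats (vnat s) == ([::], true).

Lemma enc_nat_split u : false \in u -> u = enc_nat (rdn u) ++ drop (rdn u).+1 u.
Proof.
elim: u => // -[] u IH; last by rewrite /= drop0.
by rewrite inE /= => /IH; exact: (congr1 (cons true)).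
Qed.

Lemma rdn_enc a u : rdn (enc_nat a ++ u) = a.
Proof. by elim: a => //= a; rewrite /rdn /= => ->. Qed.

Lemma drop_enc a u : drop a.+1 (enc_nat a ++ u) = u.
Proof. by elim: a => [|a IH]; rewrite /= ?drop0. Qed.

Lemma vnat_enc a u b : vnat (enc_nat a ++ u, b) = (u, b).
Proof.
rewrite /vnat rdn_enc drop_enc /=; suff -> : false \in enc_nat a ++ u by rewrite andbT.
by rewrite /enc_nat !mem_cat inE eqxx orbT.
Qed.

Lemma iter_vnat_enc s u b :
  iter (size s) vnat (flatten (map enc_nat s) ++ u, b) = (u, b).
Proof. by elim: s => //= a s IH; rewrite -iterS iterSr -catA vnat_enc. Qed.

Lemma vnats_enc s u b : vnats (enc_nats s ++ u, b) = (u, b).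
Proof. by rewrite /vnats enc_nats_cat rdn_enc vnat_enc iter_vnat_enc. Qed.

Lemma iter_vnats_enc s u b :
  iter (size s) vnats (flatten (map enc_nats s) ++ u, b) = (u, b).
Proof. by elim: s => //= a s IH; rewrite -iterS iterSr -catA vnats_enc. Qed.

Lemma vnatK u b v : vnat (u, b) = (v, true) -> b /\ u = enc_nat (rdn u) ++ v.
Proof. by case=> <- /andP[-> /enc_nat_split]. Qed.

Lemma iter_vnatK k u b v : iter k vnat (u, b) = (v, true) ->
  b /\ exists2 s, size s = k & u = flatten (map enc_nat s) ++ v.
Proof.
elim: k u b => [|k IH] u b; first by case=> -> ->; split=> //; exists [::].
rewrite iterSr; case E: (vnat (u, b)) => [u1 b1] /IH[b1T [s Es E1]].
rewrite b1T in E; have [-> ->] := vnatK E; split=> //.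
by exists (rdn u :: s); rewrite /= ?Es // E1 catA.
Qed.

Lemma vnatsK u b v : vnats (u, b) = (v, true) -> b /\ exists s, u = enc_nats s ++ v.
Proof.
rewrite /vnats; case E: (vnat (u, b)) => [u1 b1] /iter_vnatK[b1T [s Es E1]].
rewrite b1T in E; have [-> Eu] := vnatK E; split=> //.
by exists s; rewrite enc_nats_cat Es -E1.
Qed.

Lemma iter_vnatsK k u b v : iter k vnats (u, b) = (v, true) ->
  b /\ exists2 s, size s = k & u = flatten (map enc_nats s) ++ v.
Proof.
elim: k u b => [|k IH] u b; first by case=> -> ->; split=> //; exists [::].
rewrite iterSr; case E: (vnats (u, b)) => [u1 b1] /IH[b1T [s Es E1]].
rewrite b1T in E; have [-> [t ->]] := vnatsK E; split=> //.
by exists (t :: s); rewrite /= ?Es // E1 catA.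
Qed.

Lemma enc_ops_flatten os :
  flatten (map enc_op os)
  = flatten (map enc_nats (flatten [seq [:: op_pre o; op_add o; op_del o] | o <- os])).
Proof. by elim: os => //= o os ->; rewrite enc_op_cat. Qed.

Lemma group3 k (s : seq (seq nat)) : size s = 3 * k ->
  exists2 os, size os = k &
    s = flatten [seq [:: op_pre o; op_add o; op_del o] | o <- os].
Proof.
elim: k s => [|k IH] s; first by case: s => // _; exists [::].
case: s => [|a [|b [|c s]]] /=; try lia.
move=> Es; have [|os Eos ->] := IH s; first lia.
by exists (Op a b c :: os); rewrite /= ?Eos.
Qed.

Lemma validP w : valid w <-> exists x, w = enc_input x.
Proof.
rewrite /valid; split=> [|[x ->]].
  case E: (vnat (w, true)) => [u b] /=; case E1: (vnat (u, b)) => [u1 b1].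
  case/eqP/iter_vnatsK => b1T [s Es E2].
  rewrite b1T in E1; have [bT Eu] := vnatK E1.
  rewrite bT in E; have [_ Ew] := vnatK E.
  set k := rdn u in Es Eu.
  have Et : size (take (3 * k) s) = 3 * k by rewrite size_takel // Es leq_addr.
  have [os Eos Eto] := group3 Et.
  move: Es E2; rewrite -{1 2}(cat_take_drop (3 * k) s) size_cat Et => /addnI.
  case: (drop _ s) => [|a [|b' [|c [|d []]]]] // _.
  rewrite map_cat flatten_cat Eto -enc_ops_flatten /= !cats0 => E2.
  exists (RI (rdn w) os a b' c d); rewrite /enc_input /= /enc_ops Eos.
  by rewrite {1}Ew Eu E2; congr (_ ++ _); rewrite -(catA (enc_nat k)).
apply/eqP; rewrite /enc_input vnat_enc /= enc_ops_cat rdn_enc vnat_enc enc_ops_flatten.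
set s := flatten [seq [:: op_pre o; op_add o; op_del o] | o <- ri_ops x].
set t := [:: ri_init_o x; ri_init x; ri_goal x; ri_plan x].
have Es : size s = 3 * size (ri_ops x).
  by rewrite /s; elim: (ri_ops x) => //= o os /= ->; rewrite mulnS.
have -> : enc_nats (ri_init_o x) ++ enc_nats (ri_init x) ++ enc_nats (ri_goal x) ++
    enc_nats (ri_plan x) = flatten (map enc_nats t) by rewrite /= cats0.
rewrite -flatten_cat -map_cat.
have -> : 3 * size (ri_ops x) + 4 = size (s ++ t) by rewrite size_cat Es.
by rewrite -[flatten _]cats0 iter_vnats_enc.
Qed.

Lemma exec_cat D p q s : exec D (p ++ q) s = obind (exec D q) (exec D p s).
Proof. by elim: p s => //= i p IH s; case: ifP => // _; case: ifP. Qed.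

(* [false] marks an existential and [true] a universal quantifier. *)
Fixpoint qval (qs : seq bool) (phi : seq bool -> bool) : bool :=
  match qs with
  | [::] => phi [::]
  | q :: qs' =>
      let r b := qval qs' (fun u => phi (b :: u)) in
      if q then r false && r true else r false || r true
  end.

Lemma qval_ext qs phi phi' :
  (forall u, size u = size qs -> phi u = phi' u) -> qval qs phi = qval qs phi'.
Proof.
elim: qs phi phi' => [|q qs IH] phi phi' H /=; first exact: H.
have Hb b u : size u = size qs -> phi (b :: u) = phi' (b :: u).
  by move=> Eu; apply: H; rewrite /= Eu.
by rewrite (IH _ _ (Hb true)) (IH _ _ (Hb false)).
Qed.

Lemma qval_exists n qs phi :
  qval (nseq n false ++ qs) phi <->
  exists m : n.-tuple bool, qval qs (fun u => phi (m ++ u)).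
Proof.
elim: n phi => [|n IH] phi /=.
  by split=> [H|[m]]; [exists [tuple]|rewrite tuple0].
split=> [/orP[] /IH[m Hm]|[m]].
- by exists [tuple of false :: m].
- by exists [tuple of true :: m].
case/tupleP: m => -[] m Hm; apply/orP; [right|left]; apply/IH; exists m; exact: Hm.
Qed.

(** * Savitch's recursion as a quantified Boolean formula *)

Section Savitch.
Variables (n : nat) (e : rel (seq bool)) (G : pred (seq bool)).

(* [leaf k s t u] follows the branch [u] of the Savitch recursion for "[t] is
   reached from [s]", where [t = None] stands for the goal. *)
Fixpoint leaf (k : nat) (s : seq bool) (t : option (seq bool)) (u : seq bool) : bool :=
  match k with
  | 0 => if t is Some t' then e s t' else G s
  | k'.+1 => if nth false u n then leaf k' (take n u) t (drop n.+1 u)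
             else leaf k' s (Some (take n u)) (drop n.+1 u)
  end.

Definition qblocks (k : nat) : seq bool := flatten (nseq k (rcons (nseq n false) true)).

Definition sav (k : nat) (s : seq bool) (t : option (seq bool)) : bool :=
  qval (qblocks k) (leaf k s t).

Lemma savS k s t :
  sav k.+1 s t <-> exists m : n.-tuple bool, sav k s (Some (m : seq bool)) /\ sav k m t.
Proof.
rewrite /sav /qblocks [flatten _]/= cat_rcons qval_exists.
have E (m : n.-tuple bool) b u :
    leaf k.+1 s t (m ++ b :: u) = if b then leaf k m t u else leaf k s (Some (m : seq bool)) u.
  rewrite /= nth_cat size_tuple ltnn subnn /= take_size_cat ?size_tuple //.
  by rewrite -cat_rcons drop_size_cat ?size_rcons ?size_tuple.
have Em (m : n.-tuple bool) : qval (true :: qblocks k) (fun u => leaf k.+1 s t (m ++ u))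
  = sav k s (Some (m : seq bool)) && sav k m t.
  by rewrite /=; congr (_ && _); apply: qval_ext => u _; rewrite -/(leaf k.+1 s t _) E.
by split=> -[m Hm]; exists m; move: Hm; rewrite Em => /andP.
Qed.

Hypothesis e_refl : forall s, e s s.

Let eT : rel (n.-tuple bool) := fun a b => e a b.

Lemma sav_some k (s t : n.-tuple bool) :
  sav k s (Some (t : seq bool)) <->
  exists p, [/\ path eT s p, last s p = t & size p = 2 ^ k].
Proof.
elim: k s t => [|k IH] s t.
  rewrite /sav /=; split=> [H|[[|x [|y p]] [] //= H <- _]].
    by exists [:: t]; split=> //=; rewrite andbT.
  by rewrite andbT in H.
rewrite savS; split=> [[m [/IH[p [P1 P2 P3]] /IH[p' [P1' P2' P3']]]]|[p [P1 P2 P3]]].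
  exists (p ++ p'); rewrite cat_path last_cat size_cat P2 P1 P1' P2' P3 P3'.
  by split=> //; rewrite expnS; lia.
have L : size (take (2 ^ k) p) = 2 ^ k by rewrite size_takel // P3 expnS; lia.
rewrite -(cat_take_drop (2 ^ k) p) cat_path last_cat size_cat L in P1 P2 P3.
case/andP: P1 => P1 P1'; exists (last s (take (2 ^ k) p)).
split; apply/IH; first by exists (take (2 ^ k) p).
by exists (drop (2 ^ k) p); split=> //; move: P3; rewrite expnS; lia.
Qed.

(** The last of the [2 ^ k] leaves tests the goal instead of a step, which leaves one step fewer:
    hence [(size p).+1]. *)
Lemma sav_none k (s : n.-tuple bool) :
  sav k s None <-> exists p, [/\ path eT s p, G (last s p) & (size p).+1 = 2 ^ k].
Proof.
elim: k s => [|k IH] s.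
  by rewrite /sav /=; split=> [H|[[|x p] [_ H Ep] //]]; exists [::].
rewrite savS; split=> [[m [/sav_some[p [P1 P2 P3]] /IH[p' [P1' P2' P3']]]]|[p [P1 P2 P3]]].
  exists (p ++ p'); rewrite cat_path last_cat size_cat P2 P1 P1' P2'.
  by split=> //; rewrite expnS; lia.
have K0 : 0 < 2 ^ k by rewrite expn_gt0.
have L : size (take (2 ^ k) p) = 2 ^ k by rewrite size_takel //; rewrite expnS in P3; lia.
rewrite -(cat_take_drop (2 ^ k) p) cat_path last_cat size_cat L in P1 P2 P3.
case/andP: P1 => P1 P1'; exists (last s (take (2 ^ k) p)).
split; first by apply/sav_some; exists (take (2 ^ k) p).
by apply/IH; exists (drop (2 ^ k) p); split=> //; move: P3; rewrite expnS; lia.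
Qed.

Lemma sav_connect (s : n.-tuple bool) :
  sav n s None <-> exists2 p, path eT s p & G (last s p).
Proof.
split=> [/sav_none[p [P1 P2 _]]|[p P1 P2]]; first by exists p.
(* A path without repetitions among the [2 ^ n] states has fewer than [2 ^ n] steps; repeating its
   last state by reflexivity fills it up to the exact length. *)
case/shortenP: P1 P2 => p' P1 U _ P2; apply/sav_none.
set d := 2 ^ n - (size p').+1; exists (p' ++ nseq d (last s p')).
rewrite cat_path P1 last_cat size_cat size_nseq; split.
- by elim: d => //= d ->; rewrite andbT /eT e_refl.
- suff -> : last (last s p') (nseq d (last s p')) = last s p' by [].
  by elim: d.
- rewrite addnC -addnS subnK //.
  have := max_card (mem (s :: p')); rewrite (card_uniqP U) card_tuple card_bool /=.
  by [].
Qed.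

End Savitch.

(** * Planning states as bit vectors *)

Section BitStates.
Variables (n : nat) (ops : seq operator) (goal : seq nat).

(** Appended to the operators to make the step relation reflexive, as the exact step count of
    Savitch's recursion demands. It is also the default value for reading an operator list out of
    range. *)
Definition noop : operator := Op [::] [::] [::].
Definition bits (s : seq nat) : n.-tuple bool := [tuple of mkseq (fun j => j \in s) n].
Definition opstep (o : operator) (s t : seq bool) : bool :=
  all (fun j => ((j \in op_pre o) ==> nth false s j) &&
    (nth false t j == (j \in op_add o) || nth false s j && (j \notin op_del o)))
    (iota 0 n).
Definition estep (s t : seq bool) : bool :=
  has (fun o => opstep o s t) (rcons ops noop).
Definition gsat (s : seq bool) : bool :=
  all (fun j => (j \in goal) ==> nth false s j) (iota 0 n).

Lemma estep_refl s : estep s s.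
Proof.
rewrite /estep has_rcons; apply/orP; left; apply/allP => j _ /=.
by rewrite andbT eqxx.
Qed.

Let below_n := all (fun c => c < n).

Lemma all_mem_bits (s l : seq nat) : below_n l ->
  all (fun j => (j \in l) ==> nth false (bits s) j) (iota 0 n)
  = all (fun c => c \in s) l.
Proof.
move=> /allP Hl; apply/allP/allP => [H c cl|H j].
  have cn := Hl c cl; have := H c; rewrite mem_iota cl /= => /(_ cn).
  by rewrite nth_mkseq.
rewrite mem_iota => /andP[_ jn]; apply/implyP => /H; by rewrite nth_mkseq.
Qed.

Lemma opstep_bits o s (t : n.-tuple bool) : below_n (op_pre o) ->
  opstep o (bits s) t = applicable o s && (t == bits (apply_op o s)).
Proof.
move=> Ho; rewrite /applicable -(all_mem_bits s Ho) /opstep all_predI.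
congr (_ && _); apply/allP/eqP => [H|-> j].
  apply: val_inj; apply: (@eq_from_nth _ false); rewrite ?size_tuple // => j jn.
  have := H j; rewrite mem_iota jn => /(_ isT) /eqP ->.
  by rewrite !nth_mkseq // mem_cat mem_filter orbC andbC.
rewrite mem_iota => /andP[_ jn].
by rewrite /= !nth_mkseq // mem_cat mem_filter orbC andbC.
Qed.

(** Well-formedness keeps all preconditions and goals below [n], so the first [n] bits decide
    applicability and the goal. In the direction from paths to plans, steps of [noop] do not change
    the bits and are dropped. *)
Lemma plan_path D (s : seq nat) :
  wf_strips D -> s_conds D <= n -> s_ops D = ops -> s_goal D = goal ->
  (exists p s', exec D p s = Some s' /\ all (fun c => c \in s') goal) <->
  exists2 p : seq (n.-tuple bool),
     path (fun a b : n.-tuple bool => estep a b) (bits s) p & gsat (last (bits s) p).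
Proof.
case/and3P => _ wg wo Pn Eo Eg.
have wb l : all (fun c => c < s_conds D) l -> below_n l.
  by apply: sub_all => c /leq_trans; apply.
have Eops i : i < size ops -> below_n (op_pre (nth noop ops i)).
  move=> il; rewrite Eo in wo; have := all_nthP noop wo i il.
  by case/and3P => /wb.
split=> [[p [s' []]]|[p]].
  elim: p s => [|i p IH] s /=.
    by case=> <- H; exists [::] => //=; rewrite /gsat all_mem_bits // -Eg; apply: wb.
  rewrite Eo; case: ifP => // il; case: ifP => // app /IH{IH} H /H [q q1 q2].
  exists (bits (apply_op (nth noop ops i) s) :: q) => //=.
  rewrite q1 andbT /estep has_rcons; apply/orP; right.
  apply/(has_nthP noop); exists i => //.
  by rewrite opstep_bits ?Eops // app eqxx.
elim: p s => [|t p IH] s /=.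
  by move=> _; rewrite /gsat all_mem_bits => [H|]; [exists [::], s|rewrite -Eg; apply: wb].
case/andP; rewrite /estep has_rcons => /orP[].
  rewrite opstep_bits // => /andP[_ /eqP ->].
  have -> : bits (apply_op noop s) = bits s.
    by apply: val_inj; apply: eq_mkseq => j; rewrite /apply_op /= cats0 filter_predT.
  exact: IH.
case/(has_nthP noop) => i il; rewrite opstep_bits ?Eops // => /andP[app /eqP ->].
move=> H1 H2; have [q [s' [Q1 Q2]]] := IH _ H1 H2.
by exists (i :: q), s'; rewrite /= Eo il app.
Qed.

End BitStates.

(** * The decision program *)

Local Notation pN := 1.    (* length of the input *)
Local Notation pH := 2.    (* reading position *)
Local Notation pJ := 3.
Local Notation pI := 4.
Local Notation pM := 5.    (* length of the list being read *)
Local Notation pR := 6.    (* number being read *)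
Local Notation pZ := 7.    (* position in the operator table *)
Local Notation pB := 8.    (* start of the current row *)
Local Notation pK := 9.    (* number of rows *)
Local Notation pQ := 10.   (* current quantifier *)
Local Notation pE := 11.   (* number of quantifiers *)
Local Notation pX := 12.   (* position in the quantified bits *)
Local Notation pC := 13.   (* current row *)

(* Arrays; flags use index 0 only. Row [c] of the tables aPre, aAdd, aDel holds
   operator [c] from index [c * n] on. *)
Local Notation aErr := 4.
Local Notation aCond := 5.
Local Notation aPre := 6.
Local Notation aAdd := 7.
Local Notation aDel := 8.
Local Notation aRow := 9.
Local Notation aIo := 10.
Local Notation aI := 11.
Local Notation aG := 12.
Local Notation aDiff := 13.
Local Notation aS := 14.
Local Notation aT := 15.
Local Notation aM := 16.
Local Notation aGoalT := 17.
Local Notation aV := 18.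
Local Notation aOk := 19.
Local Notation aDown := 20.
Local Notation aX := 21.
Local Notation aQ := 22.

Definition cfail := CSet aErr 0 true.
(** [c] runs once for each [true] of a unary number, so reading a number and acting on it are one
    loop. Programs have no early exit: an unterminated number only raises the flag [aErr], and the
    run goes on. *)
Definition cread c :=
  CSeq (CWhile (cand (CTest 1 pH) (CTest 0 pH)) (CSeq (CRight pH) c))
       (CIf (CTest 1 pH) (CRight pH) cfail).

(** Reads of pointers and arrays outside the frame are pulled back to the earlier memory; [isT]
    checks non-membership in the concrete lists by computation. *)
Ltac agrw := repeat match goal with
  | H : agree ?P ?A ?m ?m' |- context [ptr ?m' ?v] => rewrite (proj1 H v isT)
  | H : agree ?P ?A ?m ?m' |- context [arr ?m' ?x] => rewrite (proj2 H x isT)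
  end.

(** * Checking that the word is a code *)

Definition cvnats := CSeq (czero pR) (CSeq (cread (CRight pR)) (cfor pJ pR (cread cskip))).
Definition cvalid :=
  CSeq (CWhile (CTest 1 pN) (CRight pN)) (
  CSeq (cread cskip) (
  CSeq (cread (CSeq (CRight pM) (CSeq (CRight pM) (CRight pM)))) (
  CSeq (CSeq (CRight pM) (CSeq (CRight pM) (CSeq (CRight pM) (CRight pM)))) (
  CSeq (cfor pI pM cvnats)
       (cand (CSame pH pN) (cnot (CTest aErr 0))))))).

Ltac agsolve := solve [repeat first
  [ exact: agree_refl
  | match goal with
    | H : agree _ _ ?m ?m' |- agree _ _ _ ?m' =>
        apply: (agree_trans (m2 := m)); [|by apply: (agree_incl _ H)]
    end
  | apply: agree_setp; [done|]
  | apply: agree_seta; [done|] ]].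

Ltac agsimp := repeat progress (agrw; repeat match goal with
  | m := _ : memory |- context [ptr ?m' _] => constr_eq m m'; unfold m
  | m := _ : memory |- context [arr ?m' _] => constr_eq m m'; unfold m
  end; rewrite /=).

Section Decider.
Variable w : seq bool.
Local Notation n := (size w).
Variable B : nat.
Hypothesis nB : n <= B.

Definition inputm (m : memory) : Prop :=
  [/\ ptr m 0 = 0, arr m 0 = nth false w & arr m 1 = fun j => j < n].

Lemma inputm_agree P A m m' :
  0 \notin P -> 0 \notin A -> 1 \notin A -> agree P A m m' -> inputm m -> inputm m'.
Proof. by move=> h0 h1 h2 [H1 H2] [I1 I2 I3]; split; rewrite ?H1 ?H2. Qed.

Definition read_ok c :=
  [&& 0 \notin modp c, pH \notin modp c, 0 \notin moda c & 1 \notin moda c].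

(** [rdn u] is the number of rounds in both cases. Without a terminating [false] it is the length of
    [u], and array 1 stops the loop at the end of the word. *)
Lemma wp_read c (I : nat -> memory -> Prop) m (Q : bool -> memory -> Prop) :
  let u := drop (ptr m pH) w in
  read_ok c -> inputm m -> ptr m pH <= n -> I 0 m ->
  (forall i m1, i < rdn u -> agree (pH :: modp c) (moda c) m m1 ->
     ptr m1 pH = ptr m pH + i -> I i m1 ->
     wp B c (setp m1 pH (ptr m pH + i.+1)) (fun _ m2 => I i.+1 m2)) ->
  (forall m1, agree (pH :: modp c) (moda c) m m1 -> ptr m1 pH = ptr m pH + rdn u ->
     I (rdn u) m1 ->
     if false \in u then Q true (setp m1 pH (ptr m pH + (rdn u).+1))
     else Q true (seta m1 aErr 0 true)) ->
  wp B (cread c) m Q.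
Proof.
move=> u /and4P[z1 h1 a0 a1] Im Hn I0 IS HQ; apply: wp_seq.
have Su : size u = n - ptr m pH by rewrite size_drop.
have Ru : rdn u <= n - ptr m pH by rewrite -Su index_size.
have Im1 m1 : agree (pH :: modp c) (moda c) m m1 -> inputm m1.
  by move=> Ag; apply: inputm_agree Ag Im; rewrite ?inE ?negb_or.
suff H d i m1 : i + d = rdn u -> agree (pH :: modp c) (moda c) m m1 ->
    ptr m1 pH = ptr m pH + i -> I i m1 ->
    wp B (CWhile (cand (CTest 1 pH) (CTest 0 pH)) (CSeq (CRight pH) c)) m1
       (fun _ m2 => wp B (CIf (CTest 1 pH) (CRight pH) cfail) m2 Q).
  by apply: (H (rdn u) 0) => //; rewrite addn0.
elim: d i m1 => [|d IH] i m1 Ei Ag Eh Ii; have [J0 J1 J2] := Im1 _ Ag.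
  rewrite addn0 in Ei; subst i.
  have Hb : beval (cand (CTest 1 pH) (CTest 0 pH)) m1 = false.
    rewrite /= J1 J2 Eh; case: ifP => // L; rewrite -nth_drop -/u.
    have : false \in u by rewrite -index_mem -/(rdn u) Su; lia.
    exact: nth_index.
  apply: wp_while; rewrite ?Hb // => _.
  have := HQ m1 Ag Eh Ii; rewrite -index_mem -/(rdn u) Su => {}HQ.
  apply: wp_ifp => //= E; rewrite J2 Eh in E.
    apply: wp_right; first by rewrite Eh; lia.
    by move: HQ; rewrite Eh -addnS ifT //; lia.
  by apply: wp_set; rewrite J0; move: HQ; rewrite ifF //; lia.
have Lu : i < rdn u by lia.
have Hb : beval (cand (CTest 1 pH) (CTest 0 pH)) m1 = true.
  rewrite /= J1 J2 Eh ifT; last by lia.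
  by rewrite -nth_drop -/u; have := before_find false Lu; case: nth.
apply: wp_while; rewrite ?Hb // => _; apply: wp_seq; apply: wp_right; first by rewrite Eh; lia.
rewrite Eh -addnS; apply: wp_conseq (IS i _ Lu Ag Eh Ii) _ => _ m2 Ag2 Ii2.
apply: (IH i.+1) => //; first by rewrite addSnnS.
  apply: (agree_trans (m2 := setp m1 pH (ptr m pH + i.+1))).
    by apply: agree_setp => //; rewrite inE.
  by apply: agree_sub Ag2 => // z Hz; rewrite inE Hz orbT.
by rewrite (proj1 Ag2) //= eqxx.
Qed.
(** Ties the memory to a state of the total reader [vnat], so that validation can be proved by
    following [valid] command by command. *)
Definition hd (m : memory) (s : seq bool * bool) : Prop :=
  [/\ drop (ptr m pH) w = s.1, ptr m pH <= n & arr m aErr 0 = ~~ s.2].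

(** [k] is the distance that [r] travels for each unit read: 0 for a number that is skipped, 1 for
    one that is counted, 3 for the number of operators, each of which stands for three lists. *)
Lemma wp_vread c r k m s (Q : bool -> memory -> Prop) :
  r \notin [:: 0; pH] -> all (pred1 r) (modp c) -> nilp (moda c) ->
  (forall m1, ptr m1 r + k <= B -> wp B c m1 (fun _ m2 => ptr m2 r = ptr m1 r + k)) ->
  inputm m -> hd m s -> ptr m r + k * rdn s.1 <= B ->
  (forall m', agree [:: pH; r] [:: aErr] m m' -> hd m' (vnat s) ->
     ptr m' r = ptr m r + k * rdn s.1 -> Q true m') ->
  wp B (cread c) m Q.
Proof.
move=> rn /allP Mp /nilP Ma Hc Im [Hd Hn He] HB HQ.
move: rn; rewrite !inE negb_or => /andP[r0 rH].
have nm z : z != r -> z \notin modp c by move=> zr; apply/negP => /Mp /=; rewrite (negbTE zr).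
have rok : read_ok c by rewrite /read_ok Ma !nm // eq_sym.
have Ag1 P m1 : agree (pH :: modp c) (moda c) m m1 -> agree [:: pH; r] (aErr :: P) m m1.
  by apply: agree_sub; rewrite ?Ma // => z; rewrite !inE => /orP[->|/Mp /= ->]; rewrite ?orbT.
apply: (wp_read (I := fun i m1 => ptr m1 r = ptr m r + k * i)) => //; rewrite ?Hd.
- by rewrite muln0 addn0.
- move=> i m1 iL Ag Eh Ei; apply: wp_conseq (Hc _ _) _ => /=; rewrite (negbTE rH) Ei.
    by apply: leq_trans HB; rewrite -addnA leq_add2l -mulnSr leq_mul2l iL orbT.
  by move=> _ m2 _ ->; rewrite mulnSr addnA.
move=> m1 Ag Eh Er.
have Su : size s.1 = n - ptr m pH by rewrite -Hd size_drop.
case: ifP => Fu; apply: HQ.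
- by apply: agree_setp; rewrite ?inE //; apply: Ag1.
- split; rewrite /= ?Fu ?andbT.
  + by rewrite -Hd drop_drop; congr (drop _ _); rewrite addnC.
  + by move: Fu; rewrite -index_mem -/(rdn s.1) Su ltn_subRL addnS.
  + by rewrite (proj2 Ag) ?Ma.
- by rewrite /= (negbTE rH).
- by apply: agree_seta; rewrite ?inE //; apply: Ag1.
- split; rewrite /= ?Fu ?andbF //.
  + rewrite Eh; have Fi : rdn s.1 = n - ptr m pH.
      by rewrite -Su; apply/memNindex/negbT.
    by rewrite Fi subnKC // drop_size drop_oversize // Su.
  + by rewrite Eh -leq_subRL // -Su index_size.
- by [].
Qed.

Lemma wp_setlen m (Q : bool -> memory -> Prop) :
  inputm m -> ptr m pN = 0 -> Q true (setp m pN n) ->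
  wp B (CWhile (CTest 1 pN) (CRight pN)) m Q.
Proof.
move=> Im E1; have : ptr m pN + n = n by rewrite E1.
move: {1}n => d {E1}; elim: d m Im => [|d IH] m Im Ed HQ; have [_ _ I1] := Im.
  apply: wp_while => //=; rewrite I1; first lia.
  by move=> _; move: HQ; rewrite -Ed addn0 setp_id.
apply: wp_while => //=; rewrite I1; last lia.
move=> _; apply: wp_right; first lia.
by apply: IH => /=; rewrite ?addSnnS ?setp_setp.
Qed.

Lemma rdn_hd m s : hd m s -> rdn s.1 <= n.
Proof.
case=> <- _ _; apply: leq_trans (index_size _ _) _.
by rewrite size_drop leq_subr.
Qed.

Lemma wp_cvnats m s (Q : bool -> memory -> Prop) :
  inputm m -> hd m s ->
  (forall m', agree [:: pH; pR; pJ] [:: aErr] m m' -> hd m' (vnats s) -> Q true m') ->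
  wp B cvnats m Q.
Proof.
move=> Im Hs HQ; have [Z0 _ _] := Im.
apply: wp_seq; apply: wp_zero => //; apply: wp_seq.
have Rs := rdn_hd Hs.
apply: (wp_vread (r := pR) (k := 1) (s := s)) => //=.
- by move=> m1 L1; apply: wp_right; rewrite ?addn1 //= in L1 *.
- by rewrite mul1n; lia.
move=> m1 Ag1 Hs1; rewrite add0n mul1n => Er.
have Im1 : inputm m1 by apply: inputm_agree Ag1 _.
apply: (wp_for (I := fun i m2 => hd m2 (iter i vnat (vnat s)))) => //.
- by agrw.
- by rewrite Er; lia.
- move=> i m2 Li Ag2 Ej Hi.
  have Im2 : inputm m2 by apply: inputm_agree Ag2 _.
  apply: (wp_vread (r := pR) (k := 0) (s := iter i vnat (vnat s))) => //.
  + by move=> m3 _; apply: wp_pure; rewrite // addn0.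
  + by agrw; rewrite mul0n; lia.
- move=> m2 Ag2 Ej; rewrite Er => Hs2; apply: HQ => //.
  agsolve.
Qed.

Lemma wp_cvalid m (Q : bool -> memory -> Prop) :
  3 * n + 4 <= B -> inputm m ->
  ptr m pN = 0 -> ptr m pH = 0 -> ptr m pM = 0 -> arr m aErr 0 = false ->
  (forall m', agree [:: pN; pH; pI; pJ; pM; pR] [:: aErr] m m' -> ptr m' pN = n ->
     (valid w -> arr m' aErr 0 = false) -> Q (valid w) m') ->
  wp B cvalid m Q.
Proof.
move=> LB Im EN EH EM EE HQ.
apply: wp_seq; apply: wp_setlen => //; set m0 := setp m pN n.
have Im0 : inputm m0 by [].
have H0 : hd m0 (w, true) by rewrite /hd /= EH EE drop0.
apply: wp_seq; apply: (wp_vread (r := pM) (k := 0) (s := (w, true))) => //.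
- by move=> m3 _; apply: wp_pure; rewrite // addn0.
- by rewrite /= EM.
move=> m1 Ag1 H1 E1; have Im1 : inputm m1 by apply: inputm_agree Ag1 _.
rewrite /= EM mul0n in E1.
have R1 := rdn_hd H1.
apply: wp_seq; apply: (wp_vread (r := pM) (k := 3) (s := vnat (w, true))) => //.
- move=> m3 L3; do 2 (apply: wp_seq; apply: wp_right => /=; first lia).
  by apply: wp_right => /=; rewrite ?addn3 //; lia.
- by rewrite E1; lia.
move=> m2 Ag2 H2 E2; have Im2 : inputm m2 by apply: inputm_agree Ag2 _.
rewrite E1 in E2; set s := vnat (vnat (w, true)) in H2.
apply: wp_seq; do 3 (apply: wp_seq; apply: wp_right => /=; first lia).
apply: wp_right => /=; first lia.
set m3 := setp _ _ _.
have E3 : ptr m3 pM = 3 * rdn (vnat (w, true)).1 + 4.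
  by move: E2; rewrite /m3; set k := rdn _ => /= ->; lia.
have Im3 : inputm m3 by [].
apply: wp_seq; apply: (wp_for (I := fun i m4 => hd m4 (iter i vnats s))) => //.
- by case: Im3.
- by rewrite E3; lia.
- move=> i m4 Li Ag4 Ej Hi; have Im4 : inputm m4 by apply: inputm_agree Ag4 _.
  exact: wp_cvnats Hi _.
rewrite E3 => m4 Ag4 _ H4; have Im4 : inputm m4 by apply: inputm_agree Ag4 _.
have Ag : agree [:: pN; pH; pI; pJ; pM; pR] [:: aErr] m m4.
  by agsolve.
have EN4 : ptr m4 pN = n.
  by rewrite (proj1 Ag4) //= (proj1 Ag2) // (proj1 Ag1) //= eqxx.
apply: wp_pure => //.
case: (Im4) => Z4 _ _.
have -> : beval (cand (CSame pH pN) (cnot (CTest aErr 0))) m4 = valid w.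
  rewrite /= Z4 EN4 /valid; move: H4; rewrite -/s.
  case: (iter _ _ _) => u b [/= Hd Hn ->].
  by rewrite xpair_eqE -Hd -size_eq0 size_drop subn_eq0 eqn_leq Hn /=; case: leqP; case: b.
apply: HQ => //; rewrite /valid -/s => /eqP Es.
by case: H4 => _ _; rewrite Es.
Qed.

End Decider.

(** * Loading the instance into tables *)

Definition cnats A :=
  CSeq (czero pM) (CSeq (cread (CRight pM)) (cfor pI pM (
    CSeq (czero pR) (CSeq (ccopy pZ pB) (
    CSeq (cread (CSeq (CRight pR) (CRight pZ)))
         (CIf (CTest aCond pR) (CSet A pZ true) cfail)))))).

(** The [CRight pK] after the table adds one row that is never written, hence empty: it is the row
    of [noop]. [aRow] marks only the rows of actual operators, so that a plan step with an index out
    of range is recognised. *)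
Definition cload :=
  CSeq (czero pH) (CSeq (czero pR) (
  CSeq (cread (CSeq (CSet aCond pR true) (CRight pR))) (
  CSeq (czero pK) (CSeq (cread (CRight pK)) (
  CSeq (czero pB) (
  CSeq (cfor pC pK (CSeq (CSet aRow pB true) (
     CSeq (cnats aPre) (CSeq (cnats aAdd) (CSeq (cnats aDel)
     (cfor pJ pN (CRight pB))))))) (
  CSeq (CRight pK) (CSeq (czero pB) (
  CSeq (cnats aIo) (CSeq (cnats aI) (CSeq (cnats aG)
  (cnot (CTest aErr 0))))))))))))).

(** Unary coding pays off here: the conditions, and likewise the table rows with [noop] included,
    number at most the length of the word. *)
Lemma size_input w x :
  w = enc_input x -> (ri_conds x + size (ri_ops x)).+2 <= size w.
Proof. by move=> ->; rewrite /enc_input !size_cat !size_nseq /=; lia. Qed.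

Section Load.
Variable w : seq bool.
Local Notation n := (size w).
Variable B : nat.
Hypothesis nB : n <= B.

(** For words already known to be codes: the terminating [false] exists, and the error branch of
    [cread] is not taken. *)
Lemma wp_readn c (I : nat -> memory -> Prop) m a v (Q : bool -> memory -> Prop) :
  read_ok c -> inputm w m -> drop (ptr m pH) w = enc_nat a ++ v ->
  (forall i m1 y, I i m1 -> I i (setp m1 pH y)) -> I 0 m ->
  (forall i m1, i < a -> a < n -> agree (pH :: modp c) (moda c) m m1 -> I i m1 ->
     wp B c m1 (fun _ m2 => I i.+1 m2)) ->
  (forall m1, a < n -> agree (pH :: modp c) (moda c) m m1 -> drop (ptr m1 pH) w = v ->
     I a m1 -> Q true m1) ->
  wp B (cread c) m Q.
Proof.
move=> rok Im Hd IH I0 IS HQ.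
have Sd : n - ptr m pH = a.+1 + size v.
  by rewrite -size_drop Hd size_cat /enc_nat size_cat size_nseq addn1.
apply: (wp_read nB (I := I)) => //; rewrite ?Hd ?rdn_enc //; first lia.
  move=> i m1 Li Ag Eh Ii; apply: IS => //; [lia| |exact: IH].
  by apply: agree_setp; rewrite ?inE.
move=> m1 Ag Eh Ia; rewrite mem_cat /enc_nat mem_cat inE eqxx orbT /=.
apply: HQ => /=; [lia| | |exact: IH].
  by apply: agree_setp; rewrite ?inE.
by rewrite addnC -drop_drop Hd drop_enc.
Qed.

(** A list is stored as its characteristic bits in the row from [base] on. While a number is read,
    [pZ] walks along the row in parallel with [pR], which then looks the number up in [aCond], the
    set of legal conditions. An illegal number is not stored but raises [aErr], so loading checks
    well-formedness at the same time. *)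
Lemma wp_cnats A m s v P base (Q : bool -> memory -> Prop) :
  5 < A -> inputm w m -> drop (ptr m pH) w = enc_nats s ++ v ->
  ptr m pB = base -> base + n <= B -> (forall j, arr m aCond j = (j < P)) ->
  (forall m', agree [:: pH; pM; pI; pR; pZ] [:: A; aErr] m m' ->
     drop (ptr m' pH) w = v ->
     (forall y, arr m' A y = arr m A y || has (fun c => (c < P) && (y == base + c)) s) ->
     arr m' aErr 0 = arr m aErr 0 || ~~ all (fun c => c < P) s -> Q true m') ->
  wp B (cnats A) m Q.
Proof.
move=> A5 Im Hd Eb Lb HC HQ; have [Z0 _ _] := Im.
have nA k : k <= 5 -> k == A = false by move=> ?; apply/eqP; lia.
rewrite enc_nats_cat in Hd.
apply: wp_seq; apply: wp_zero => //; apply: wp_seq.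
apply: (wp_readn (m := setp m pM 0) (I := fun i m1 => ptr m1 pM = i) _ _ Hd) => //=.
  by move=> i m1 Li Ln Ag Ei; apply: wp_right; rewrite /= Ei //; lia.
move=> m1 Ln Ag1 Hd1 E1.
have Im1 : inputm w m1 by apply: inputm_agree Ag1 _.
apply: (wp_for (I := fun i m2 =>
  [/\ drop (ptr m2 pH) w = flatten (map enc_nat (drop i s)) ++ v,
      forall y, arr m2 A y = arr m A y ||
         has (fun c => (c < P) && (y == base + c)) (take i s) &
      arr m2 aErr 0 = arr m aErr 0 || ~~ all (fun c => c < P) (take i s)])).
- by [].
- by case: Im1.
- by rewrite E1; lia.
- by split=> [|y|]; rewrite ?drop0 ?take0 /= ?orbF; agrw.
- rewrite E1 => i m2 Li Ag2 Ei [Hd2 HA HE].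
  have Im2 : inputm w m2.
    by apply: inputm_agree Ag2 _; rewrite //= !inE ?nA.
  have Z2 : ptr m2 0 = 0 by case: Im2.
  rewrite (drop_nth 0) //= -catA in Hd2.
  apply: wp_seq; apply: wp_zero => //; apply: wp_seq; apply: wp_copy => //=.
    by agrw; rewrite /= Eb; lia.
  apply: wp_seq.
  set m3 := setp _ _ _.
  have Im3 : inputm w m3 by [].
  apply: (wp_readn (m := m3) (I := fun i m1 => ptr m1 pR = i /\ ptr m1 pZ = base + i) _ _ Hd2) => //.
  + by split=> //=; agrw; rewrite /= Eb addn0.
  + move=> j m4 Lj Lj2 Ag4 [E4 E4'].
    apply: wp_seq; apply: wp_right; first by rewrite E4; lia.
    apply: wp_right; first by rewrite /= E4'; lia.
    by rewrite /= E4 E4' addnS.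
  move=> m4 Ln4 Ag4 Hd4 [E4 E4'].
  have EC4 : arr m4 aCond = arr m aCond.
    rewrite (proj2 Ag4) //= (proj2 Ag2) ?(proj2 Ag1) //=.
    by rewrite !inE nA.
  have A4 y : arr m4 y = arr m2 y by rewrite (proj2 Ag4).
  have Z4 : ptr m4 0 = 0 by rewrite (proj1 Ag4).
  apply: wp_ifp => //= HT; rewrite EC4 E4 HC in HT; apply: wp_set; split=> //=.
  + by move=> y; rewrite eqxx E4' (take_nth 0) // has_rcons HT A4 HA /=; case: eqP => // _; rewrite orbT.
  + by rewrite nA // (take_nth 0) // all_rcons HT A4 HE.
  + by move=> y; rewrite eq_sym nA // (take_nth 0) // has_rcons HT A4 HA.
  + by rewrite Z4 (take_nth 0) // all_rcons HT /= orbT.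
- rewrite E1 => m2 Ag2 Ej []; rewrite drop_size take_size => Hd2 HA HE.
  apply: HQ => //.
  apply: (agree_trans (m2 := m1)); first by agsolve.
  by apply: agree_incl _ Ag2; rewrite /= !inE !eqxx ?orbT.
Qed.

Variable x : reuse_input.
Hypothesis wE : w = enc_input x.
Let ops := ri_ops x.
Let P := ri_conds x.
Hypothesis LB : n * n + n <= B.

Lemma row_eq c i j r : j < n -> r < n -> (c * n + j == i * n + r) = (c == i) && (j == r).
Proof.
move=> jn rn; apply/eqP/andP => [E|[/eqP -> /eqP -> //]].
have n0 : 0 < n by lia.
have := congr1 (fun y => y %/ n) E; rewrite !divnMDl // !divn_small // !addn0 => Ec.
by move: E; rewrite Ec => /addnI ->; rewrite !eqxx.
Qed.

Definition okl (l : seq nat) : bool := all (fun c => c < P) l.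
Definition okop (o : operator) : bool :=
  [&& okl (op_pre o), okl (op_add o) & okl (op_del o)].

Definition table (A : nat) (f : operator -> seq nat) (i : nat) (m : memory) : Prop :=
  forall c j, j < n ->
    arr m A (c * n + j) = [&& c < i, j < P & j \in f (nth noop ops c)].

Lemma table_next A f i m m' :
  table A f i m ->
  (forall y, arr m' A y = arr m A y ||
     has (fun c => (c < P) && (y == i * n + c)) (f (nth noop ops i))) ->
  table A f i.+1 m'.
Proof.
move=> HT HA c j jn; rewrite HA HT // ltnS [c <= i]leq_eqVlt; have SI : (P + size ops).+2 <= n := size_input wE.
have -> : has (fun r => (r < P) && (c * n + j == i * n + r)) (f (nth noop ops i))
  = [&& c == i, j < P & j \in f (nth noop ops i)].
  apply/hasP/and3P => [[r Hr /andP[rP]]|[/eqP -> jP Hj]].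
    by rewrite row_eq //; last lia; move=> /andP[/eqP -> /eqP ->].
  by exists j; rewrite ?jP ?eqxx.
by case: (c =P i) => [->|_]; rewrite ?ltnn /= ?orbF.
Qed.

Record loaded (m : memory) : Prop := Loaded {
  ld_input : inputm w m;
  ld_N : ptr m pN = n;
  ld_K : ptr m pK = (size ops).+1;
  ld_pre : forall c j, j < n -> arr m aPre (c * n + j) = (j \in op_pre (nth noop ops c));
  ld_add : forall c j, j < n -> arr m aAdd (c * n + j) = (j \in op_add (nth noop ops c));
  ld_del : forall c j, j < n -> arr m aDel (c * n + j) = (j \in op_del (nth noop ops c));
  ld_row : forall c, arr m aRow (c * n) = (c < size ops);
  ld_io : forall j, j < n -> arr m aIo j = (j \in ri_init_o x);
  ld_i : forall j, j < n -> arr m aI j = (j \in ri_init x);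
  ld_g : forall j, j < n -> arr m aG j = (j \in ri_goal x) }.

Definition op_rest := enc_nats (ri_init_o x) ++ enc_nats (ri_init x)
  ++ enc_nats (ri_goal x) ++ enc_nats (ri_plan x).

Definition loading (i : nat) (m : memory) : Prop :=
  [/\ drop (ptr m pH) w = flatten (map enc_op (drop i ops)) ++ op_rest,
      ptr m pB = i * n, arr m aErr 0 = ~~ all okop (take i ops),
      (forall c, arr m aRow (c * n) = (c < i)) &
      [/\ table aPre op_pre i m, table aAdd op_add i m & table aDel op_del i m]].

Definition cload_op := CSeq (CSet aRow pB true) (
     CSeq (cnats aPre) (CSeq (cnats aAdd) (CSeq (cnats aDel)
     (cfor pJ pN (CRight pB))))).

Lemma wp_load_op i m :
  i < size ops -> inputm w m -> ptr m pN = n -> (forall j, arr m aCond j = (j < P)) ->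
  ptr m pC = i -> loading i m ->
  wp B cload_op m (fun _ m' => loading i.+1 (setp m' pC i.+1)).
Proof.
move=> Li Im EN HC Ei [Hd Eb HE HR [T1 T2 T3]]; have SI : (P + size ops).+2 <= n := size_input wE.
have n0 : 0 < n by lia.
have ib : i * n + n <= B.
  apply: leq_trans LB; rewrite leq_add2r leq_mul2r; lia.
rewrite (drop_nth noop) //= -catA enc_op_cat in Hd.
set o := nth noop ops i in Hd.
apply: wp_seq; apply: wp_set; apply: wp_seq.
set m0 := seta m _ _ _; have Im0 : inputm w m0 by [].
apply: (wp_cnats (m := m0) _ _ Hd Eb ib HC) => // m1 Ag1 Hd1 HA1 HE1.
have Im1 : inputm w m1 by apply: inputm_agree Ag1 _.
have Eb1 : ptr m1 pB = i * n by agrw.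
have HC1 j : arr m1 aCond j = (j < P) by agrw; apply: HC.
apply: wp_seq; apply: (wp_cnats (m := m1) _ _ Hd1 Eb1 ib HC1) => // m2 Ag2 Hd2 HA2 HE2.
have Im2 : inputm w m2 by apply: inputm_agree Ag2 _.
have Eb2 : ptr m2 pB = i * n by agrw.
have HC2 j : arr m2 aCond j = (j < P) by agrw; apply: HC.
apply: wp_seq; apply: (wp_cnats (m := m2) _ _ Hd2 Eb2 ib HC2) => // m3 Ag3 Hd3 HA3 HE3.
have Im3 : inputm w m3 by apply: inputm_agree Ag3 _.
have Eb3 : ptr m3 pB = i * n by agrw.
have EN3 : ptr m3 pN = n by agrw.
apply: (wp_for (I := fun j m4 => ptr m4 pB = i * n + j)) => //.
- by case: Im3.
- by rewrite EN3.
- by rewrite addn0.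
- move=> j m4 Lj Ag4 Ej E4; rewrite EN3 in Lj; apply: wp_right; rewrite /= E4 ?addnS //; lia.
move=> m4 Ag4 Ej; rewrite EN3 => E4.
have A4 y : arr m4 y = arr m3 y by rewrite (proj2 Ag4).
split => /=; rewrite ?A4.
- by agrw.
- by rewrite E4 mulSn addnC.
- rewrite HE3 HE2 HE1 /= HE (take_nth noop) // all_rcons -/o.
  case: (all okop _); rewrite ?andbF // andbT /okop /okl.
  by case: (all _ (op_pre o)); case: (all _ (op_add o)).
- move=> c; agrw; rewrite /= Eb HR ltnS [c <= i]leq_eqVlt.
  have := row_eq c i n0 n0; rewrite !addn0 => ->; rewrite andbT.
  by case: eqP.
split.
- apply: (table_next (m := m)) T1 _ => y; rewrite A4 (proj2 Ag3) // (proj2 Ag2) //; exact: HA1.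
- apply: (table_next (m := m)) T2 _ => y; rewrite A4 (proj2 Ag3) // HA2 (proj2 Ag1) //.
- apply: (table_next (m := m)) T3 _ => y; rewrite A4 HA3 (proj2 Ag2) // (proj2 Ag1) //.
Qed.

Lemma wp_cload m (Q : bool -> memory -> Prop) :
  inputm w m -> ptr m pN = n -> arr m aErr 0 = false ->
  (forall A y, 4 < A -> arr m A y = false) ->
  (forall b m', b = wf_strips (ri_Do x) && wf_strips (ri_D x) ->
    agree [:: pH; pJ; pI; pM; pR; pZ; pB; pK; pC]
      [:: aErr; aCond; aPre; aAdd; aDel; aRow; aIo; aI; aG] m m' ->
    (b -> [/\ loaded m', drop (ptr m' pH) w = enc_nats (ri_plan x) &
             arr m' aErr 0 = false]) -> Q b m') ->
  wp B cload m Q.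
Proof.
move=> Im EN EE EA HQ; have [Z0 _ _] := Im; have SI : (P + size ops).+2 <= n := size_input wE.
have n0 : 0 < n by lia.
apply: wp_seq; apply: wp_zero => //; apply: wp_seq; apply: wp_zero => //; apply: wp_seq.
set m0 := setp _ _ _; have Im0 : inputm w m0 by [].
have Hd0 : drop (ptr m0 pH) w = enc_nat P ++ (enc_ops ops ++ op_rest).
  by rewrite /= drop0 wE.
apply: (wp_readn (I := fun i m1 => ptr m1 pR = i /\ forall j, arr m1 aCond j = (j < i))
  _ _ Hd0) => //.
- by split=> // j; rewrite /= EA.
- move=> i m1 Li Ln Ag [E1 HC]; apply: wp_seq; apply: wp_set.
  apply: wp_right => /=; first by rewrite E1; lia.
  rewrite E1; split=> // j; rewrite HC ltnS [j <= i]leq_eqVlt.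
  by case: eqP.
move=> m1 _ Ag1 Hd1 [E1 HC1].
have Im1 : inputm w m1 by apply: inputm_agree Ag1 _.
apply: wp_seq; apply: wp_zero => //; first by case: Im1.
set m2 := setp _ _ _; have Im2 : inputm w m2 by [].
rewrite enc_ops_cat in Hd1.
apply: wp_seq; apply: (wp_readn (m := m2) (I := fun i m1 => ptr m1 pK = i) _ _ Hd1) => //.
  by move=> i m3 Li Ln Ag E3; apply: wp_right; rewrite /= E3 //; lia.
move=> m3 _ Ag3 Hd3 E3.
have Im3 : inputm w m3 by apply: inputm_agree Ag3 _.
apply: wp_seq; apply: wp_zero => //; first by case: Im3.
set m4 := setp _ _ _; have Im4 : inputm w m4 by [].
have F A y : 5 < A -> arr m3 A y = false.
  move=> A5; rewrite (proj2 Ag3) //= (proj2 Ag1) /= ?EA ?inE //; lia.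
apply: wp_seq; apply: (wp_for (I := loading)) => //.
- by case: Im4.
- by rewrite /= E3; lia.
- split=> //=; rewrite ?drop0 ?take0 //=.
  + by agsimp.
  + by move=> c; rewrite F.
  + by split=> c j jn; rewrite F.
- move=> i m5 Li Ag5 Ei Hi; rewrite /= E3 in Li.
  have Im5 : inputm w m5 by apply: inputm_agree Ag5 _.
  apply: wp_load_op => //; first by agsimp.
  by move=> j; agrw => /=; agrw => /=; apply: HC1.
rewrite [ptr m4 pK]/= E3 => m5 Ag5 Ei.
rewrite /loading drop_size take_size => -[Hd5 Eb5 HE5 HR5 [T1 T2 T3]].
have Im5 : inputm w m5 by apply: inputm_agree Ag5 _.
have HC5 j : arr m5 aCond j = (j < P).
  by agsimp; apply: HC1.
have EK5 : ptr m5 pK = size ops by agsimp; rewrite E3.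
apply: wp_seq; apply: wp_right; first by rewrite EK5; lia.
apply: wp_seq; apply: wp_zero => //; first by case: Im5.
set m6 := setp _ _ _; have Im6 : inputm w m6 by [].
have nB0 : 0 + n <= B by [].
apply: wp_seq; apply: (wp_cnats (m := m6) _ _ Hd5 erefl nB0 HC5) => // m7 Ag7 Hd7 HA7 HE7.
have Im7 : inputm w m7 by apply: inputm_agree Ag7 _.
have HC7 j : arr m7 aCond j = (j < P) by agsimp; apply: HC1.
have Eb7 : ptr m7 pB = 0 by agsimp.
apply: wp_seq; apply: (wp_cnats (m := m7) _ _ Hd7 Eb7 nB0 HC7) => // m8 Ag8 Hd8 HA8 HE8.
have Im8 : inputm w m8 by apply: inputm_agree Ag8 _.
have HC8 j : arr m8 aCond j = (j < P) by agsimp; apply: HC1.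
have Eb8 : ptr m8 pB = 0 by agsimp.
apply: wp_seq; apply: (wp_cnats (m := m8) _ _ Hd8 Eb8 nB0 HC8) => // m9 Ag9 Hd9 HA9 HE9.
have Im9 : inputm w m9 by apply: inputm_agree Ag9 _.
apply: wp_pure => //.
have HE : arr m9 aErr 0 = ~~ (wf_strips (ri_Do x) && wf_strips (ri_D x)).
  rewrite HE9 HE8 HE7 /= HE5 /wf_strips /= -/P.
  rewrite -[all (fun o => _) (ri_ops x)]/(all okop ops).
  case: (all okop ops); case: (all _ (ri_init_o x)); case: (all _ (ri_init x));
  by case: (all _ (ri_goal x)).
apply: HQ.
- by rewrite /=; case: (Im9) => -> _ _; rewrite HE; case: (_ && _).
- by agsolve.
rewrite /=; case: (Im9) => -> _ _; rewrite HE.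
case E: (_ && _) => //= _.
move: E => /andP[/and3P[W1 W2 W3] /and3P[W4 _ _]].
have tab A f (T : table A f (size ops) m5) : (forall o, okop o -> okl (f o)) -> f noop = [::] ->
    forall c j, j < n -> arr m5 A (c * n + j) = (j \in f (nth noop ops c)).
  move=> Hf f0 c j jn; rewrite T //; have [Lc|Lc] := ltnP c (size ops); last first.
    by rewrite nth_default // f0.
  have /Hf/allP Ho : okop (nth noop ops c) by apply: (all_nthP noop W3).
  by case: (boolP (j \in f _)) => [/Ho ->|]; rewrite ?andbF.
have lst (l : seq nat) j : okl l -> has (fun c => (c < P) && (j == 0 + c)) l = (j \in l).
  move=> /allP Hl; apply/hasP/idP => [[c cl /andP[_ /eqP ->]] //|jl].
  by exists j; rewrite // eqxx andbT; apply: Hl.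
split=> //.
split.
- by [].
- by agsimp.
- by agsimp; rewrite E3.
- by move=> c j jn; agsimp; apply: tab => // o /and3P[].
- by move=> c j jn; agsimp; apply: tab => // o /and3P[].
- by move=> c j jn; agsimp; apply: tab => // o /and3P[].
- by move=> c; agsimp; apply: HR5.
- move=> j jn; rewrite (proj2 Ag9) // (proj2 Ag8) // HA7 lst //=; agsimp.
  by rewrite EA.
- move=> j jn; rewrite (proj2 Ag9) // HA8 lst //; agsimp; by rewrite EA.
- by move=> j jn; rewrite HA9 lst //; agsimp; rewrite EA.
Qed.

End Load.

(** * Checking the promise *)

Definition cdiff :=
  CSeq (cfor pJ pN (CIf (ceq (CTest aIo pJ) (CTest aI pJ)) cskip
         (CIf (CTest aDiff 0) cfail (CSet aDiff 0 true))))
       (cand (CTest aDiff 0) (cnot (CTest aErr 0))).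

Definition cneed c := CIf c cskip (CSet aOk 0 false).
Definition ccopyarr X Y := cfor pJ pN (cassign X pJ (CTest Y pJ)).
Definition cpre := cneed (cor (cnot (CTest aPre pZ)) (CTest aS pJ)).
Definition cnext := cor (CTest aAdd pZ) (cand (CTest aS pJ) (cnot (CTest aDel pZ))).
(** Updating [aS] in place is sound because bit [j] of the successor depends only on bit [j] of the
    state, and the precondition on [j] is tested before that bit is overwritten. *)
Definition capply := cfor pJ pN (CSeq cpre (CSeq (cassign aS pJ cnext) (CRight pZ))).
Definition cgoal := cfor pJ pN (cneed (cor (cnot (CTest aG pJ)) (CTest aS pJ))).
(** Each [true] of a unary plan step advances [pZ] by one row, so the start of the row is reached
    without a multiplication. A bad step clears [aOk], which is not set again. *)
Definition cplan :=
  CSeq (CSet aOk 0 true) (CSeq (ccopyarr aS aIo) (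
  CSeq (czero pM) (CSeq (cread (CRight pM)) (
  CSeq (cfor pI pM (CSeq (czero pZ) (CSeq (cread (cfor pJ pN (CRight pZ)))
         (CIf (CTest aRow pZ) capply (CSet aOk 0 false))))) (
  CSeq cgoal (CTest aOk 0)))))).

Lemma all_iotaS (q : pred nat) i : all q (iota 0 i.+1) = all q (iota 0 i) && q i.
Proof. by rewrite -addn1 iotaD all_cat /= andbT. Qed.

Section Stages.
Variables (w : seq bool) (x : reuse_input) (B : nat).
Local Notation n := (size w).
Hypothesis nB : n <= B.
Hypothesis wE : w = enc_input x.
Let ops := ri_ops x.
Lemma loaded_agree P A m m' :
  all (fun z => z \notin P) [:: 0; pN; pK] ->
  all (fun z => z \notin A) [:: 0; 1; aPre; aAdd; aDel; aRow; aIo; aI; aG] ->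
  agree P A m m' -> loaded w x m -> loaded w x m'.
Proof.
move=> /and4P[p0 p1 p2 _] /and5P[a0 a1 a2 a3 /and5P[a4 a5 a6 a7 /andP[a8 _]]] Ag.
case=> Im H1 H2 H3 H4 H5 H6 H7 H8 H9.
by split; rewrite ?(proj1 Ag) ?(proj2 Ag) //; apply: (inputm_agree _ _ _ Ag).
Qed.

(** Counting saturates at two: [aDiff] records the first difference, and a second one raises
    [aErr]. *)
Lemma wp_cdiff m (Q : bool -> memory -> Prop) :
  loaded w x m -> wf_strips (ri_Do x) -> wf_strips (ri_D x) ->
  arr m aErr 0 = false -> arr m aDiff 0 = false ->
  (forall m', agree [:: pJ] [:: aErr; aDiff] m m' ->
     Q (differ_in_one (ri_conds x) (ri_init_o x) (ri_init x)) m') ->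
  wp B cdiff m Q.
Proof.
move=> Lm W1 W2 HE HD HQ; have [Z0 _ _] := ld_input Lm.
have EN := ld_N Lm.
set q := fun c => (c \in ri_init_o x) != (c \in ri_init x).
apply: wp_seq; apply: (wp_for (I := fun i m1 =>
  arr m1 aDiff 0 = (0 < count q (iota 0 i)) /\ arr m1 aErr 0 = (1 < count q (iota 0 i)))) => //.
- by rewrite EN.
- move=> i m1; rewrite EN => Li Ag Ei [H1 H2].
  have Lm1 : loaded w x m1 by apply: loaded_agree Ag Lm.
  have [Z1 _ _] := ld_input Lm1.
  have Eq : beval (ceq (CTest aIo pJ) (CTest aI pJ)) m1 = ~~ q i.
    rewrite /= Ei (ld_io Lm1) // (ld_i Lm1) // /q.
    by case: (_ \in _); case: (_ \in _).
  rewrite -[i.+1]addn1 iotaD count_cat /= addn0.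
  apply: wp_ifp => //; rewrite Eq => qi.
    by apply: wp_pure => //=; rewrite H1 H2 (negbTE qi) addn0.
  rewrite (negbFE qi); apply: wp_ifp => //=; rewrite Z1 H1 => C0; apply: wp_set; rewrite /= Z1 /=.
    by rewrite H1 addn1 ltnS C0.
  by move/negbT: C0; rewrite -eqn0Ngt H2 => /eqP ->.
move=> m1 Ag Ej; rewrite EN => -[H1 H2].
have Lm1 : loaded w x m1 by apply: loaded_agree Ag Lm.
have [Z1 _ _] := ld_input Lm1.
apply: wp_pure => //.
have -> : beval (cand (CTest aDiff 0) (cnot (CTest aErr 0))) m1
   = differ_in_one (ri_conds x) (ri_init_o x) (ri_init x).
  rewrite /= Z1 H1 H2 /differ_in_one -/q.
  (* The scan runs to [n], past the conditions; there well-formedness leaves both initial states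
     empty. *)
  suff -> : count q (iota 0 n) = count q (iota 0 (ri_conds x)) by case: (count _ _) => [|[|k]].
  have /subnKC <- : ri_conds x <= n by have := size_input wE; lia.
  rewrite iotaD count_cat -[RHS]addn0; congr (_ + _); apply/eqP.
  rewrite -leqn0 leqNgt -has_count; apply/hasPn => j.
  rewrite mem_iota add0n => /andP[Pj _]; rewrite /q.
  case/and3P: W1 => /allP V1 _ _; case/and3P: W2 => /allP V2 _ _.
  have -> : (j \in ri_init_o x) = false by apply/negbTE/negP => /V1 /=; lia.
  by have -> : (j \in ri_init x) = false by apply/negbTE/negP => /V2 /=; lia.
by apply: HQ; agsolve.
Qed.

Lemma wp_ccopyarr X Y m (Q : bool -> memory -> Prop) :
  X != Y -> ptr m 0 = 0 -> ptr m pN = n ->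
  (forall m', agree [:: pJ] [:: X] m m' -> (forall j, j < n -> arr m' X j = arr m Y j) ->
     Q true m') ->
  wp B (ccopyarr X Y) m Q.
Proof.
move=> XY Z0 EN HQ.
apply: (wp_for (I := fun i m1 => forall j, j < i -> arr m1 X j = arr m Y j)) => //.
- by rewrite EN.
- move=> i m1 Li Ag Ei HI; apply: wp_assign => //= j; rewrite eqxx ltnS leq_eqVlt Ei.
  case: eqP => [->|_ /HI //] _; rewrite (proj2 Ag) //= !inE; by rewrite eq_sym !negb_or XY.
rewrite EN => m1 Ag Ej HI; apply: HQ => //.
by apply: agree_sub Ag => // z; rewrite !inE orbb.
Qed.

Hypothesis LB : n * n + n <= B.

Lemma wp_capply m c (Q : bool -> memory -> Prop) :
  loaded w x m -> ptr m pZ = c * n -> c < n ->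
  let o := nth noop ops c in
  (forall m', agree [:: pJ; pZ] [:: aOk; aS] m m' ->
     arr m' aOk 0 = arr m aOk 0 && all (fun j => (j \in op_pre o) ==> arr m aS j) (iota 0 n) ->
     (forall j, j < n -> arr m' aS j = (j \in op_add o) || arr m aS j && (j \notin op_del o)) ->
     Q true m') ->
  wp B capply m Q.
Proof.
move=> Lm EZ Lc o HQ; have EN := ld_N Lm; have [Z0 _ _] := ld_input Lm.
have cB : c * n + n <= B by apply: leq_trans LB; rewrite leq_add2r leq_mul2r ltnW ?orbT.
apply: (wp_for (I := fun i m1 =>
  [/\ ptr m1 pZ = c * n + i,
     arr m1 aOk 0 = arr m aOk 0 && all (fun j => (j \in op_pre o) ==> arr m aS j) (iota 0 i) &
     forall j, arr m1 aS j = if j < i then (j \in op_add o) || arr m aS j && (j \notin op_del o)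
                             else arr m aS j])) => //.
- by rewrite EN.
- by split; rewrite ?addn0 ?andbT.
- move=> i m1; rewrite EN => Li Ag Ei [E1 E2 E3].
  have Lm1 : loaded w x m1 by apply: loaded_agree Ag Lm.
  have [Z1 _ _] := ld_input Lm1.
  apply: wp_seq; set r := (i \in op_pre o) ==> arr m aS i.
  have Er : beval (cor (cnot (CTest aPre pZ)) (CTest aS pJ)) m1 = r.
    rewrite /= E1 Ei (ld_pre Lm1) // E3 ltnn /r.
    by rewrite -/o; case: (_ \in _).
  have rest m2 : agree [::] [:: aOk] m1 m2 -> arr m2 aOk 0 = arr m1 aOk 0 && r ->
     wp B (CSeq (cassign aS pJ cnext) (CRight pZ)) m2 (fun _ m3 =>
  [/\ ptr m3 pZ = c * n + i.+1,
     arr m3 aOk 0 = arr m aOk 0 && all (fun j => (j \in op_pre o) ==> arr m aS j) (iota 0 i.+1) &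
     forall j, arr m3 aS j = if j < i.+1 then (j \in op_add o) || arr m aS j && (j \notin op_del o)
                             else arr m aS j]).
    have K : arr m1 aOk 0 && r = arr m aOk 0 &&
      all (fun j => (j \in op_pre o) ==> arr m aS j) (iota 0 i.+1).
      by rewrite all_iotaS E2 andbA.
    move=> Ag2 Eo; apply: wp_seq; apply: wp_assign => //.
    apply: wp_right; first by rewrite /=; agrw; rewrite E1; lia.
    split=> [||j]; [by rewrite /=; agrw; rewrite E1 addnS|by rewrite -[RHS]K -Eo|].
    rewrite /=; agrw; rewrite E1.
    rewrite (ld_add Lm) // (ld_del Lm) // -/ops -/o Ei ltnS [j <= i]leq_eqVlt.
    case: (j =P i) => [->|_] /=; last exact: E3.
    by rewrite E3 ltnn; case: (_ \in _) => //=; case: (arr m aS i) => //=; case: (_ \in _).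
  apply: wp_ifp => //; rewrite Er => ri.
    by apply: wp_pure => //; apply: rest; rewrite ?ri ?andbT.
  by apply: wp_set; apply: rest; [agsolve|rewrite ri andbF /= Z1].
rewrite EN => m1 Ag Ej [E1 E2 E3]; apply: HQ => //; first by agsolve.
by move=> j jn; rewrite E3 jn.
Qed.

Lemma wp_cgoal m (Q : bool -> memory -> Prop) :
  loaded w x m ->
  (forall m', agree [:: pJ] [:: aOk] m m' ->
     arr m' aOk 0 = arr m aOk 0 && all (fun j => (j \in ri_goal x) ==> arr m aS j) (iota 0 n) ->
     Q true m') ->
  wp B cgoal m Q.
Proof.
move=> Lm HQ; have EN := ld_N Lm; have [Z0 _ _] := ld_input Lm.
apply: (wp_for (I := fun i m1 => arr m1 aOk 0 = arr m aOk 0 &&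
    all (fun j => (j \in ri_goal x) ==> arr m aS j) (iota 0 i))) => //.
- by rewrite EN.
- by rewrite andbT.
- move=> i m1; rewrite EN => Li Ag Ei E1.
  have Lm1 : loaded w x m1 by apply: loaded_agree Ag Lm.
  have [Z1 _ _] := ld_input Lm1.
  set r := (i \in ri_goal x) ==> arr m aS i.
  have Er : beval (cor (cnot (CTest aG pJ)) (CTest aS pJ)) m1 = r.
    rewrite /= Ei (ld_g Lm1) // /r; agrw.
    by case: (_ \in _).
  have K : arr m1 aOk 0 && r = arr m aOk 0 &&
    all (fun j => (j \in ri_goal x) ==> arr m aS j) (iota 0 i.+1).
    by rewrite all_iotaS E1 andbA.
  apply: wp_ifp => //; rewrite Er => rE; rewrite rE ?andbT ?andbF in K.
    exact: wp_pure.
  by apply: wp_set; rewrite -[RHS]K /= Z1.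
by rewrite EN => m1 Ag Ej E1; apply: HQ => //; agsolve.
Qed.

Lemma wp_cplan m (Q : bool -> memory -> Prop) :
  loaded w x m -> wf_strips (ri_Do x) -> drop (ptr m pH) w = enc_nats (ri_plan x) ->
  (forall m', agree [:: pH; pJ; pI; pM; pZ] [:: aOk; aS; aErr] m m' ->
     Q (is_plan (ri_Do x) (ri_plan x)) m') ->
  wp B cplan m Q.
Proof.
move=> Lm W Hd HQ; have SI := size_input wE.
have [Z0 _ _] := ld_input Lm; have EN := ld_N Lm.
apply: wp_seq; apply: wp_set; set m0 := seta _ _ _ _.
have Lm0 : loaded w x m0 by apply: (@loaded_agree [::] [:: aOk] m) => //; agsolve.
apply: wp_seq; apply: wp_ccopyarr => // m1 Ag1 HS.
have Lm1 : loaded w x m1 by apply: loaded_agree Ag1 Lm0.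
have Im1 := ld_input Lm1; have [Z1 _ _] := Im1.
apply: wp_seq; apply: wp_zero => //.
set m2 := setp _ _ _.
have Lm2 : loaded w x m2 by apply: (@loaded_agree [:: pM] [::] m1) => //; agsolve.
have Hd2 : drop (ptr m2 pH) w =
  enc_nat (size (ri_plan x)) ++ flatten (map enc_nat (ri_plan x)).
  by rewrite -[RHS]/(enc_nats _) -Hd; agsimp.
apply: wp_seq; apply: (wp_readn nB (m := m2) (I := fun i m1 => ptr m1 pM = i) _ _ Hd2) => //.
  by move=> i m3 Li Ln Ag E3; apply: wp_right; rewrite /= E3 //; lia.
move=> m3 Lp Ag3 Hd3 E3.
have Lm3 : loaded w x m3 by apply: loaded_agree Ag3 Lm2.
have Im3 := ld_input Lm3; have [Z3 _ _] := Im3.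
pose ex i := exec (ri_Do x) (take i (ri_plan x)) (ri_init_o x).
apply: wp_seq; apply: (wp_for (I := fun i m4 =>
  drop (ptr m4 pH) w = flatten (map enc_nat (drop i (ri_plan x))) /\
  if arr m4 aOk 0 then exists s, ex i = Some s /\ forall j, j < n -> arr m4 aS j = (j \in s)
  else ex i = None)) => //.
- by rewrite E3; lia.
- rewrite drop0; split=> //=; agsimp; rewrite Z0 /=.
  exists (ri_init_o x); split; first by rewrite /ex take0.
  move=> j jn; rewrite HS //= (ld_io Lm) //.
- rewrite E3 => i m4 Li Ag4 Ei [Hd4 HI].
  have Lm4 : loaded w x m4 by apply: loaded_agree Ag4 Lm3.
  have Im4 := ld_input Lm4; have [Z4 _ _] := Im4.
  apply: wp_seq; apply: wp_zero => //; set m5 := setp _ _ _.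
  rewrite (drop_nth 0) //= in Hd4; set b := nth 0 _ i in Hd4.
  have Lm5 : loaded w x m5 by apply: (@loaded_agree [:: pZ] [::] m4) => //; agsolve.
  apply: wp_seq; apply: (wp_readn nB (m := m5) (I := fun k m6 => ptr m6 pZ = k * n) _ _ Hd4) => //.
  + move=> k m6 Lk Lb Ag6 E6.
    have Lm6 : loaded w x m6 by apply: loaded_agree Ag6 Lm5.
    have kB : k * n + n <= B by apply: leq_trans LB; rewrite leq_add2r leq_mul2r; lia.
    apply: (wp_for (I := fun j m7 => ptr m7 pZ = k * n + j)) => //=.
    * by case: (ld_input Lm6).
    * by rewrite (ld_N Lm6).
    * by rewrite addn0.
    * by rewrite (ld_N Lm6) => j m7 Lj Ag7 Ej E7; apply: wp_right; rewrite /= E7 ?addnS //; lia.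
    * by move=> m7 Ag7 Ej ->; rewrite (ld_N Lm6) mulSn addnC.
  move=> m6 Lb Ag6 Hd6 E6.
  have Lm6 : loaded w x m6 by apply: loaded_agree Ag6 Lm5.
  have [Z6 _ _] := ld_input Lm6.
  have ES6 : ex i.+1 = obind (fun s => exec (ri_Do x) [:: b] s) (ex i).
    by rewrite /ex (take_nth 0) // -cats1 exec_cat.
  have A6 : arr m6 aOk = arr m4 aOk by agsimp.
  have S6 : arr m6 aS = arr m4 aS by agsimp.
  apply: wp_ifp => //= Tb; rewrite E6 (ld_row Lm6) -/ops in Tb.
    apply: (wp_capply Lm6 E6 Lb) => m7 Ag7 Ok7 S7.
    split; first by rewrite /= (proj1 Ag7).
    rewrite /= Ok7 A6.
    case Eok: (arr m4 aOk 0) HI => HI /=; last by rewrite ES6 HI.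
    case: HI => s [Es Hs].
    have Wb : all (fun c => c < n) (op_pre (nth noop ops b)).
      case/and3P: W => _ _ /(all_nthP noop) /(_ b Tb) /and3P[W _ _].
      by apply: sub_all W => c /=; lia.
    have -> : all (fun j => (j \in op_pre (nth noop ops b)) ==> arr m6 aS j) (iota 0 n)
      = applicable (nth noop ops b) s.
      rewrite /applicable -(all_mem_bits s Wb); apply: eq_in_all => j.
      by rewrite mem_iota => /andP[_ jn]; rewrite S6 Hs // nth_mkseq.
    rewrite ES6 Es /= Tb; case: ifP => app; rewrite -/ops -/noop app //.
    eexists; split; first by [].
    move=> j jn; rewrite S7 // S6 Hs // mem_cat mem_filter orbC.
    by rewrite [_ && (j \in s)]andbC.
  apply: wp_set; split=> //=; rewrite Z6 /= ES6.
  by case: (ex i) => //= s; rewrite Tb.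
rewrite E3 => m4 Ag4 Ei [_ HI].
have Lm4 : loaded w x m4 by apply: loaded_agree Ag4 Lm3.
apply: wp_seq; apply: wp_cgoal => // m5 Ag5 Ok5.
have Lm5 : loaded w x m5 by apply: loaded_agree Ag5 Lm4.
have [Z5 _ _] := ld_input Lm5.
apply: wp_pure => //.
have -> : beval (CTest aOk 0) m5 = is_plan (ri_Do x) (ri_plan x).
  rewrite /= Z5 Ok5 /is_plan; move: HI; rewrite /ex take_size.
  case: (arr m4 aOk 0) => [[s [-> Hs]]|-> //] /=.
  have Wg : all (fun c => c < n) (ri_goal x).
    by case/and3P: W => _ W _; apply: sub_all W => c /=; lia.
  rewrite -(all_mem_bits s Wg); apply: eq_in_all => j.
  by rewrite mem_iota => /andP[_ jn]; rewrite Hs // nth_mkseq.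
apply: HQ; agsolve.
Qed.

End Stages.

(** * Evaluating the Savitch formula by backtracking *)

Definition cquant :=
  CSeq (czero pE) (cfor pI pN
    (CSeq (cfor pJ pN (CRight pE)) (CSeq (CSet aQ pE true) (CRight pE)))).

Definition crow :=
  cfor pJ pN (CSeq cpre (CSeq (cneed (ceq (CTest aT pJ) cnext)) (CRight pZ))).
Definition cvote := CIf (CTest aOk 0) (CSet aV 0 true) cskip.

(** The middle state is first read into [aM] because the bit that decides whether it replaces the
    source or the target comes after it. *)
Definition clevel :=
  CSeq (cfor pJ pN (CSeq (cassign aM pJ (CTest aX pX)) (CRight pX)))
  (CSeq (CIf (CTest aX pX) (ccopyarr aS aM) (CSeq (ccopyarr aT aM) (CSet aGoalT 0 false)))
        (CRight pX)).

Definition cfinal :=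
  CSeq (CSet aV 0 false)
  (CIf (CTest aGoalT 0)
     (CSeq (CSet aOk 0 true) (CSeq cgoal cvote))
     (CSeq (czero pZ) (cfor pC pK (CSeq (CSet aOk 0 true) (CSeq crow cvote))))).

Definition cleaf :=
  CSeq (ccopyarr aS aI) (CSeq (CSet aGoalT 0 true) (CSeq (czero pX)
  (CSeq (cfor pI pN clevel) cfinal))).

(** Going down, a leaf is evaluated at once, as all bits not yet chosen are 0. Going up past a
    quantifier, the value [aV] is not final when the bit is still 0 and [aV] equals the code of the
    quantifier, that is, for a false first branch of an existential or a true one of a universal
    quantifier; then the second branch is entered. Otherwise the bit is reset and [aV] is passed
    on. *)
Definition cturn :=
  CIf (CTest aDown 0) (CSeq cleaf (CSeq (ccopy pQ pE) (CSet aDown 0 false)))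
    (CSeq (CLeft pQ)
      (CIf (cand (cnot (CTest aX pQ)) (ceq (CTest aV 0) (CTest aQ pQ)))
           (CSeq (CSet aX pQ true) (CSet aDown 0 true)) (CSet aX pQ false))).
Definition cloop := CWhile (cor (CTest aDown 0) (cnot (CSame pQ 0))) cturn.
Definition csearch :=
  CSeq cquant (CSeq (CSet aDown 0 true) (CSeq cloop (CTest aV 0))).

Lemma size_qblocks n k : size (qblocks n k) = k * n.+1.
Proof. by rewrite size_flatten /shape map_nseq size_rcons size_nseq sumn_nseq mulnC. Qed.

Lemma qblocksS n k : qblocks n k.+1 = qblocks n k ++ rcons (nseq n false) true.
Proof.
rewrite /qblocks; set X := rcons _ _; elim: k => [|k IH]; first by rewrite /= cats0.
by rewrite -[LHS]/(X ++ flatten (nseq k.+1 X)) [in LHS]IH catA.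
Qed.

Lemma nth_qblocksS n k y :
  nth false (qblocks n k.+1) y = (y == k * n.+1 + n) || nth false (qblocks n k) y.
Proof.
rewrite qblocksS nth_cat size_qblocks; case: ltnP => Hy.
  by case: eqP => // E; lia.
rewrite [nth _ (qblocks _ _) _]nth_default ?size_qblocks // orbF.
rewrite nth_rcons size_nseq nth_nseq if_same; case: ltngtP => H; try by apply/esym/eqP; lia.
Qed.

(** The last index is out of range, where the default value of [nth] is [noop]. *)
Lemma has_rows (p : pred operator) ops :
  has p (rcons ops noop) = has (fun c => p (nth noop ops c)) (iota 0 (size ops).+1).
Proof.
rewrite -[RHS]has_map; congr (has _ _).
apply: (@eq_from_nth _ noop); rewrite size_rcons ?size_map ?size_iota // => i Hi.
rewrite (nth_map 0) ?size_iota // nth_iota // nth_rcons add0n.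
by case: ltngtP => // H; rewrite nth_default //; lia.
Qed.

Section Search.
Variables (w : seq bool) (x : reuse_input) (B : nat).
Local Notation n := (size w).
Hypothesis nB : n <= B.
Hypothesis wE : w = enc_input x.
Let ops := ri_ops x.
Hypothesis LB : n * n + n <= B.

Lemma wp_cquant m (Q : bool -> memory -> Prop) :
  loaded w x m -> (forall y, arr m aQ y = false) ->
  (forall m', agree [:: pE; pI; pJ] [:: aQ] m m' -> ptr m' pE = size (qblocks n n) ->
     (forall y, arr m' aQ y = nth false (qblocks n n) y) -> Q true m') ->
  wp B cquant m Q.
Proof.
move=> Lm HF HQ; have [Z0 _ _] := ld_input Lm; have EN := ld_N Lm.
apply: wp_seq; apply: wp_zero => //; set m0 := setp _ _ _.
apply: (wp_for (I := fun i m1 => ptr m1 pE = i * n.+1 /\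
   forall y, arr m1 aQ y = nth false (qblocks n i) y)) => //.
- by rewrite /= EN.
- by split=> // y; rewrite /= HF nth_nil.
- rewrite [ptr m0 pN]/= EN => i m1 Li Ag Ei [E1 HA].
  have iB : i * n.+1 + n < B.
    by apply: leq_trans LB; rewrite -addnS addnC -mulSn -mulnSr leq_mul2r Li orbT.
  have EN1 : ptr m1 pN = n by agsimp.
  apply: wp_seq; apply: (wp_for (I := fun j m2 => ptr m2 pE = i * n.+1 + j)) => //.
  + by agsimp.
  + by rewrite EN1.
  + by rewrite /= E1 addn0.
  + rewrite EN1 => j m2 Lj Ag2 Ej E2; apply: wp_right; rewrite /= E2 ?addnS //; lia.
  rewrite EN1 => m2 Ag2 Ej E2; apply: wp_seq; apply: wp_set; apply: wp_right => /=; first by rewrite E2.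
  rewrite E2; split=> [|y]; first by rewrite mulSn addSn addnC.
  by rewrite (proj2 Ag2) // HA nth_qblocksS; case: eqP.
rewrite [ptr m0 pN]/= EN => m1 Ag Ej [E1 HA]; apply: HQ => //; first by agsolve.
by rewrite size_qblocks.
Qed.

Definition stateof (A : nat) (m : memory) (s : seq bool) : Prop :=
  size s = n /\ forall j, j < n -> arr m A j = nth false s j.

Lemma wp_crow m c s t (Q : bool -> memory -> Prop) :
  loaded w x m -> ptr m pZ = c * n -> c < n -> stateof aS m s -> stateof aT m t ->
  arr m aOk 0 = true ->
  (forall m', agree [:: pJ; pZ] [:: aOk] m m' ->
     arr m' aOk 0 = opstep n (nth noop ops c) s t -> ptr m' pZ = c.+1 * n ->
     Q true m') ->
  wp B crow m Q.
Proof.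
move=> Lm EZ Lc [Ss HS] [St HT] Ok HQ; have EN := ld_N Lm; have [Z0 _ _] := ld_input Lm.
have cB : c * n + n <= B by apply: leq_trans LB; rewrite leq_add2r leq_mul2r ltnW ?orbT.
set o := nth noop ops c.
pose r1 j := (j \in op_pre o) ==> nth false s j.
pose r2 j := nth false t j == (j \in op_add o) || nth false s j && (j \notin op_del o).
apply: (wp_for (I := fun i m1 => ptr m1 pZ = c * n + i /\
    arr m1 aOk 0 = all (fun j => r1 j && r2 j) (iota 0 i))) => //.
- by rewrite EN.
- by rewrite addn0.
- move=> i m1; rewrite EN => Li Ag Ei [E1 E2].
  have Lm1 : loaded w x m1 by apply: loaded_agree Ag Lm.
  have [Z1 _ _] := ld_input Lm1.
  have need k d m2 (r : bool) Q' : pure k -> beval k m2 = r -> ptr m2 0 = 0 ->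
     (forall m3, agree [::] [:: aOk] m2 m3 -> arr m3 aOk 0 = arr m2 aOk 0 && r -> wp B d m3 Q') ->
     wp B (CSeq (cneed k) d) m2 Q'.
    move=> pk bk Z2 H; apply: wp_seq; apply: wp_ifp; rewrite // bk => rE.
      by apply: wp_pure => //; apply: H; rewrite ?rE ?andbT.
    by apply: wp_set; apply: H; [agsolve|rewrite rE andbF /= Z2].
  have Er1 : beval (cor (cnot (CTest aPre pZ)) (CTest aS pJ)) m1 = r1 i.
    rewrite /= E1 Ei (ld_pre Lm1) // /r1 -/o; agrw; rewrite HS //.
    by case: (_ \in _).
  rewrite /cpre; apply: (need _ _ _ _ _ _ Er1 Z1) => // m2 Ag2 Ok2.
  have Lm2 : loaded w x m2 by apply: loaded_agree Ag2 Lm1.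
  have [Z2 _ _] := ld_input Lm2.
  have Er2 : beval (ceq (CTest aT pJ) cnext) m2 = r2 i.
    rewrite /= (proj1 Ag2 pZ) // (proj1 Ag2 pJ) // E1 Ei (ld_add Lm2) // (ld_del Lm2) // -/ops -/o.
    rewrite /r2; agrw; rewrite HS // HT //.
    by case: (_ \in op_add o); case: (_ \in op_del o); case: (nth _ s i); case: (nth _ t i).
  apply: (need _ _ _ _ _ _ Er2 Z2) => // m3 Ag3 Ok3.
  have E3 : ptr m3 pZ = c * n + i by rewrite (proj1 Ag3) // (proj1 Ag2).
  apply: wp_right; first by rewrite E3; lia.
  split; first by rewrite /= E3 addnS.
  by rewrite all_iotaS -E2 andbA -Ok2 -Ok3.
rewrite EN => m1 Ag Ej [E1 E2]; apply: HQ; [by agsolve|by rewrite E2|by rewrite E1 mulSn addnC].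
Qed.

Lemma wp_cvote m (Q : bool -> memory -> Prop) :
  ptr m 0 = 0 ->
  (forall m', agree [::] [:: aV] m m' -> arr m' aV 0 = arr m aV 0 || arr m aOk 0 -> Q true m') ->
  wp B cvote m Q.
Proof.
move=> Z0 HQ; apply: wp_ifp => //=; rewrite Z0 => E.
  by apply: wp_set; apply: HQ; [agsolve|rewrite /= Z0 E orbT].
by apply: wp_pure => //; apply: HQ; rewrite ?E ?orbF.
Qed.

Let est := estep n ops.
Let gst := gsat n (ri_goal x).

Definition target (m : memory) (t : option (seq bool)) : Prop :=
  if t is Some t' then arr m aGoalT 0 = false /\ stateof aT m t'
  else arr m aGoalT 0 = true.

Lemma wp_cfinal m s t (Q : bool -> memory -> Prop) :
  loaded w x m -> stateof aS m s -> target m t ->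
  (forall m', agree [:: pJ; pZ; pC] [:: aOk; aV] m m' ->
     arr m' aV 0 = leaf n est gst 0 s t [::] -> Q true m') ->
  wp B cfinal m Q.
Proof.
move=> Lm Hs Ht HQ; have SI := size_input wE.
have [Z0 _ _] := ld_input Lm; have EN := ld_N Lm; have EK := ld_K Lm.
apply: wp_seq; apply: wp_set; set m0 := seta _ _ _ _.
have Lm0 : loaded w x m0 by apply: (@loaded_agree w x [::] [:: aV] m) => //; agsolve.
apply: wp_ifp; rewrite // [beval _ _]/= Z0 => TG.
- case: t Ht HQ => [t|] Ht HQ; first by case: Ht; rewrite TG.
  apply: wp_seq; apply: wp_set; set m1 := seta _ _ _ _.
  have Lm1 : loaded w x m1 by apply: (@loaded_agree w x [::] [:: aOk] m0) => //; agsolve.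
  apply: wp_seq; apply: (wp_cgoal nB Lm1) => m2 Ag2 Ok2.
  apply: wp_cvote; first by agsimp.
  move=> m3 Ag3 V3; apply: HQ; first by agsolve.
  rewrite V3 Ok2; agsimp; rewrite Z0 /= /gst /gsat; apply: eq_in_all => j.
  by rewrite mem_iota => /andP[_ jn]; case: Hs => _ ->.
- case: t Ht HQ => [t|] Ht HQ; last by rewrite /target TG in Ht.
  case: Ht => _ Ht; apply: wp_seq; apply: wp_zero => //; set m1 := setp _ _ _.
  apply: (wp_for (I := fun i m2 => ptr m2 pZ = i * n /\
     arr m2 aV 0 = has (fun c => opstep n (nth noop ops c) s t) (iota 0 i))) => //.
  + by rewrite /= EK; lia.
  + by rewrite /= Z0.
  + rewrite [ptr m1 pK]/= EK => i m2 Li Ag2 Ei [E2 V2].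
    have Lm2 : loaded w x m2.
      by apply: loaded_agree Ag2 _ => //; apply: (@loaded_agree w x [:: pZ] [::] m0) => //; agsolve.
    have [Z2 _ _] := ld_input Lm2.
    apply: wp_seq; apply: wp_set; set m3 := seta _ _ _ _.
    have Lm3 : loaded w x m3 by apply: (@loaded_agree w x [::] [:: aOk] m2) => //; agsolve.
    have Li' : i < n by rewrite /ops in SI; lia.
    have Hs3 : stateof aS m3 s by case: Hs => ? Hs; split=> // j jn; agsimp; apply: Hs.
    have Ht3 : stateof aT m3 t by case: Ht => ? Ht; split=> // j jn; agsimp; apply: Ht.
    apply: wp_seq; apply: (wp_crow (c := i) Lm3 E2 Li' Hs3 Ht3); first by rewrite /= Z2.
    move=> m4 Ag4 Ok4 E4; apply: wp_cvote; first by agsimp.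
    move=> m5 Ag5 V5; split; first by rewrite /= (proj1 Ag5).
    rewrite -[LHS]/(arr m5 aV 0) V5 Ok4 (proj2 Ag4) // -[arr m3 aV 0]/(arr m2 aV 0) V2.
    by rewrite -addn1 iotaD has_cat /= orbF.
  rewrite [ptr m1 pK]/= EK => m2 Ag2 Ej [E2 V2].
  apply: HQ; first by agsolve.
  by rewrite V2 -(has_rows (fun o => opstep n o s t)).
Qed.

Lemma wp_clevel m i s t u k v (Q : bool -> memory -> Prop) :
  loaded w x m -> stateof aS m s -> target m t -> ptr m pX = i * n.+1 -> i < n ->
  size u = n * n.+1 -> (forall y, y < size u -> arr m aX y = nth false u y) ->
  v = drop (i * n.+1) u ->
  (forall m' s' t', agree [:: pJ; pX] [:: aM; aS; aT; aGoalT] m m' ->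
     stateof aS m' s' -> target m' t' -> ptr m' pX = i.+1 * n.+1 ->
     leaf n est gst k.+1 s t v = leaf n est gst k s' t' (drop (i.+1 * n.+1) u) ->
     Q true m') ->
  wp B clevel m Q.
Proof.
move=> Lm Hs Ht EX Li Su HX Ev HQ.
have [Z0 _ _] := ld_input Lm; have EN := ld_N Lm.
have iu : i * n.+1 + n < size u.
  by rewrite Su -addnS addnC -mulSn leq_mul2r Li orbT.
have iB : i * n.+1 + n < B by apply: leq_trans iu _; rewrite Su mulnSr.
set f := take n v.
have nf j : j < n -> nth false f j = nth false u (i * n.+1 + j).
  by move=> jn; rewrite nth_take // Ev nth_drop.
have Sf : size f = n by rewrite size_takel // Ev size_drop; lia.
apply: wp_seq; apply: (wp_for (I := fun j m1 => ptr m1 pX = i * n.+1 + j /\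
   forall y, y < j -> arr m1 aM y = nth false f y)) => //.
- by rewrite EN.
- by split=> //; rewrite addn0.
- rewrite EN => j m1 Lj Ag Ej [E1 HM].
  apply: wp_seq; apply: wp_assign => //; apply: wp_right; first by rewrite /= E1; lia.
  split=> [|y]; first by rewrite /= E1 addnS.
  rewrite /= Ej ltnS leq_eqVlt; case: eqP => [-> _|_ /HM //].
  by rewrite E1 nf //; agrw; rewrite HX //; lia.
rewrite EN => m1 Ag Ej [E1 HM].
have Lm1 : loaded w x m1 by apply: loaded_agree Ag Lm.
have [Z1 _ _] := ld_input Lm1; have EN1 := ld_N Lm1.
have nb : nth false v n = nth false u (i * n.+1 + n) by rewrite Ev nth_drop.
have Ed : drop n.+1 v = drop (i.+1 * n.+1) u by rewrite Ev drop_drop mulSn.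
have EL : leaf n est gst k.+1 s t v = if nth false v n
     then leaf n est gst k f t (drop (i.+1 * n.+1) u)
     else leaf n est gst k s (Some f) (drop (i.+1 * n.+1) u) by rewrite -Ed.
apply: wp_seq; apply: wp_ifp; rewrite // [beval _ _]/= E1 (proj2 Ag) // HX // -nb => Eb;
  rewrite Eb in EL.
- apply: (wp_ccopyarr nB) => // m2 Ag2 HS2.
  apply: wp_right; first by agrw; rewrite E1.
  apply: (HQ _ f t) => //.
  + by agsolve.
  + by split=> // j jn; rewrite -[LHS]/(arr m2 aS j) HS2 // HM.
  + case: (t) Ht => [t'|] /=; last by agsimp.
    by case=> G [S' T']; split; [agsimp|split=> // j jn; agsimp; apply: T'].
  + by rewrite /=; agrw; rewrite E1 mulSn addSn addnC.
- apply: wp_seq; apply: (wp_ccopyarr nB) => // m2 Ag2 HT2.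
  apply: wp_set; apply: wp_right; first by rewrite /=; agrw; rewrite E1.
  apply: (HQ _ s (Some f)) => //.
  + by agsolve.
  + by case: Hs => Ss Hs; split=> // j jn; agsimp; apply: Hs.
  + split; first by rewrite /=; agsimp; rewrite Z0.
    by split=> // j jn; rewrite -[LHS]/(arr m2 aT j) HT2 // HM.
  + by rewrite /=; agrw; rewrite E1 mulSn addSn addnC.
Qed.

Definition start : seq bool := bits n (ri_init x).
Definition phi (u : seq bool) : bool := leaf n est gst n start None u.

Lemma wp_cleaf m u (Q : bool -> memory -> Prop) :
  loaded w x m -> size u = n * n.+1 -> (forall y, y < size u -> arr m aX y = nth false u y) ->
  (forall m', agree [:: pJ; pI; pX; pZ; pC] [:: aOk; aV; aM; aS; aT; aGoalT] m m' ->
     arr m' aV 0 = phi u -> Q true m') ->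
  wp B cleaf m Q.
Proof.
move=> Lm Su HX HQ.
have [Z0 _ _] := ld_input Lm; have EN := ld_N Lm.
apply: wp_seq; apply: (wp_ccopyarr nB) => // m1 Ag1 HS1.
have Lm1 : loaded w x m1 by apply: loaded_agree Ag1 Lm.
have [Z1 _ _] := ld_input Lm1.
apply: wp_seq; apply: wp_set; apply: wp_seq; apply: wp_zero => //.
set m2 := setp _ _ _.
have Lm2 : loaded w x m2.
  by apply: (@loaded_agree w x [:: pX] [:: aGoalT] m1) => //; agsolve.
have [Z2 _ _] := ld_input Lm2; have EN2 := ld_N Lm2.
(* After [i] levels, the rest of the branch still has the value of the whole, [phi u]. *)
apply: wp_seq; apply: (wp_for (I := fun i m3 => ptr m3 pX = i * n.+1 /\
   exists s t, [/\ stateof aS m3 s, target m3 t &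
     phi u = leaf n est gst (n - i) s t (drop (i * n.+1) u)])) => //.
- by rewrite EN2.
- split=> //; exists start, None; split.
  + split=> [|j jn]; first by rewrite size_tuple.
    by rewrite nth_mkseq // -(ld_i Lm) // -HS1.
  + by rewrite /= Z1.
  + by rewrite subn0 drop0.
- rewrite EN2 => i m3 Li Ag3 Ei [EX [s [t [Hs Ht Hphi]]]].
  have Lm3 : loaded w x m3 by apply: loaded_agree Ag3 Lm2.
  have HX3 y : y < size u -> arr m3 aX y = nth false u y.
    by move=> Hy; agsimp; apply: HX.
  apply: (wp_clevel (k := n - i.+1) Lm3 Hs Ht EX Li Su HX3 erefl) => m4 s' t' Ag4 Hs' Ht' EX4 EL.
  split=> //; exists s', t'; split=> //.
  by rewrite -EL Hphi; congr (leaf _ _ _ _ _ _ _); lia.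
rewrite EN2 => m3 Ag3 Ej [EX [s [t [Hs Ht Hphi]]]].
have Lm3 : loaded w x m3 by apply: loaded_agree Ag3 Lm2.
apply: (wp_cfinal Lm3 Hs Ht) => m4 Ag4 V4; apply: HQ; first by agsolve.
by rewrite V4 Hphi subnn.
Qed.

Let qs := qblocks n n.

(** [nth] defaults to [false], so [sg_X] also says that all bits of the assignment beyond [u] are 0;
    this permits the jump from an inner node straight to its first leaf. *)
Record searching (m : memory) (u : seq bool) (b : bool) : Prop := Searching {
  sg_loaded : loaded w x m;
  sg_E : ptr m pE = size qs;
  sg_Q : forall y, arr m aQ y = nth false qs y;
  sg_X : forall y, y < size qs -> arr m aX y = nth false u y;
  sg_down : arr m aDown 0 = b }.

(** A single loop carries the whole recursion, so correctness is stated with a continuation: entered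
    downwards at the prefix [u], the loop later stands at [u] again, going upwards, with the value
    of the remaining formula. The induction is on the quantifiers [qs2] still open below [u]. *)
Lemma wp_cloop qs2 : forall qs1 u m (Q : bool -> memory -> Prop),
  qs = qs1 ++ qs2 -> size u = size qs1 -> searching m u true ->
  (forall m', searching m' u false -> ptr m' pQ = size u ->
     arr m' aV 0 = qval qs2 (fun v => phi (u ++ v)) -> wp B cloop m' Q) ->
  wp B cloop m Q.
Proof.
have Sqs : size qs = n * n.+1 by rewrite size_qblocks.
have go m Q : (arr m aDown 0 || (ptr m pQ != 0)) -> ptr m 0 = 0 ->
    wp B cturn m (fun _ m1 => wp B cloop m1 Q) -> wp B cloop m Q.
  move=> C Z0 H; apply: wp_while => //=; rewrite Z0.
  by case: (arr m aDown 0) C => //= /negbTE ->.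
elim: qs2 => [|q qs2 IH] qs1 u m Q Eq Su [Lm HE HQ HX HD] K.
  rewrite cats0 in Eq.
  have [Z0 _ _] := ld_input Lm.
  apply: go; rewrite ?HD //; apply: wp_ifp; rewrite //= Z0 HD // => _.
  have Su' : size u = n * n.+1 by rewrite Su -Eq.
  apply: wp_seq; apply: (wp_cleaf Lm Su') => [y Hy|m1 Ag1 V1]; first by apply: HX; rewrite Eq -Su.
  have Lm1 : loaded w x m1 by apply: loaded_agree Ag1 Lm.
  have [Z1 _ _] := ld_input Lm1.
  apply: wp_seq; apply: wp_copy => //; first by agrw; rewrite HE Sqs mulnSr.
  apply: wp_set; apply: K.
  - split; last by rewrite /= Z1.
    + apply: (@loaded_agree w x [:: pQ] [:: aDown] m1) => //; agsolve.
    + by agsimp.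
    + by move=> y; agsimp.
    + by move=> y Hy; agsimp; apply: HX.
  - by rewrite /=; agrw; rewrite HE Eq Su.
  - by rewrite /= V1 cats0.
have Lu : size u < size qs by rewrite Eq size_cat Su /=; lia.
have nu b y : y < size qs -> nth false (rcons u b) y = if y == size u then b else nth false u y.
  move=> _; rewrite nth_rcons; case: ltngtP => // H; rewrite nth_default //; lia.
have Qu : nth false qs (size u) = q by rewrite Eq Su nth_cat ltnn subnn.
have Eq' : qs = rcons qs1 q ++ qs2 by rewrite cat_rcons.
pose r b := qval qs2 (fun v => phi (u ++ b :: v)).
have Er b m1 : arr m1 aV 0 = qval qs2 (fun v => phi (rcons u b ++ v)) -> arr m1 aV 0 = r b.
  by move=> ->; apply: qval_ext => v _; rewrite cat_rcons.
(* One upward turn past the quantifier that follows [u]: it either enters the second branch or hands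
   the value on to [u]. *)
have back b m1 vv : searching m1 (rcons u b) false -> ptr m1 pQ = (size u).+1 ->
    arr m1 aV 0 = vv ->
    (if ~~ b && (vv == q) then forall m2, searching m2 (rcons u true) true -> wp B cloop m2 Q
     else forall m2, searching m2 u false -> ptr m2 pQ = size u -> arr m2 aV 0 = vv ->
          wp B cloop m2 Q) -> wp B cloop m1 Q.
  move=> [Lm1 HE1 HQ1 HX1 HD1] EQ1 V1 H; have [Z1 _ _] := ld_input Lm1.
  apply: go; rewrite ?EQ1 ?orbT //; apply: wp_ifp; rewrite //= Z1 HD1 // => _.
  apply: wp_seq; apply: wp_left; rewrite EQ1.
  apply: wp_ifp; rewrite // [beval _ _]/= Z1 V1 HQ1 Qu HX1 // nu // eqxx => C.
    have {C} [b0 vq] : ~~ b /\ vv == q by case: (b) C; case: (vv); case: (q).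
    rewrite b0 vq in H; apply: wp_seq; apply: wp_set; apply: wp_set; apply: H.
    split; last by rewrite /= Z1.
    - by apply: (@loaded_agree w x [:: pQ] [:: aDown; aX] m1) => //; agsolve.
    - by [].
    - by [].
    - by move=> y Hy; rewrite /= nu //; case: eqP => // /eqP Ey; rewrite HX1 // nu // (negbTE Ey).
  have {C} E : ~~ b && (vv == q) = false by case: (b) C; case: (vv); case: (q).
  rewrite E in H; apply: wp_set; apply: H => //.
  split=> //.
  - by apply: (@loaded_agree w x [:: pQ] [:: aX] m1) => //; agsolve.
  - move=> y Hy; rewrite /=; case: eqP => [->|/eqP Ey]; first by rewrite nth_default.
    by rewrite HX1 // nu // (negbTE Ey).
have S1 : searching m (rcons u false) true.
  split=> // y Hy; rewrite nu // HX //; case: eqP => // ->.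
  by rewrite nth_default.
have SS b : size (rcons u b) = size (rcons qs1 q) by rewrite !size_rcons Su.
apply: (IH (rcons qs1 q) (rcons u false)) => //.
move=> m1 S2; rewrite size_rcons => EQ1 /Er V1.
apply: (back false m1 (r false)) => //=.
have Ev : qval (q :: qs2) (fun v => phi (u ++ v)) = if q then r false && r true else r false || r true by [].
(* If the first value differs from the code of the quantifier, it already is the value of the
   quantified formula; otherwise the second branch decides. *)
case: eqP => Rq m2 S3; last first.
  by move=> EQ2 V2; apply: K => //; rewrite V2 Ev; move: Rq; case: (r false); case: (q).
apply: (IH (rcons qs1 q) (rcons u true)) => // m3 S4; rewrite size_rcons => EQ3 /Er V3.
apply: (back true m3 (r true)) => //= m4 S5 EQ4 V4; apply: K => //.
by rewrite V4 Ev Rq; case: (q).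
Qed.

Lemma wp_csearch m (Q : bool -> memory -> Prop) :
  loaded w x m -> (forall A y, aDown <= A -> arr m A y = false) ->
  (forall b m', b = sav n est gst n start None -> Q b m') ->
  wp B csearch m Q.
Proof.
move=> Lm HF HQ; have [Z0 _ _] := ld_input Lm.
apply: wp_seq; apply: (wp_cquant Lm); first by move=> y; apply: HF.
move=> m1 Ag1 HE1 HQ1.
have Lm1 : loaded w x m1 by apply: loaded_agree Ag1 Lm.
have [Z1 _ _] := ld_input Lm1.
apply: wp_seq; apply: wp_set; apply: wp_seq.
apply: (wp_cloop (qs2 := qs) (qs1 := [::]) (u := [::])) => //.
  split=> //; last by rewrite /= Z1.
  - by apply: (@loaded_agree w x [::] [:: aDown] m1) => //; agsolve.
  - by move=> y _; rewrite nth_nil /=; agrw; apply: HF.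
move=> m2 [Lm2 _ _ _ HD2] EQ2 V2; have [Z2 _ _] := ld_input Lm2.
apply: wp_while => //=; rewrite Z2 HD2 EQ2 // => _.
by apply: wp_pure => //; apply: HQ; rewrite /= Z2 V2.
Qed.

End Search.

Definition cdecide :=
  let no := CConst false in
  CIf cvalid (CIf cload (CIf cdiff (CIf cplan csearch no) no) no) no.

Lemma sav_solvable w x :
  w = enc_input x -> wf_strips (ri_D x) ->
  sav (size w) (estep (size w) (ri_ops x)) (gsat (size w) (ri_goal x)) (size w)
    (start w x) None <-> solvable (ri_D x).
Proof.
move=> wE W; set n := size w.
rewrite /start (sav_connect (n := n) _ (@estep_refl n (ri_ops x))).
have SI : s_conds (ri_D x) <= n by have := size_input wE; rewrite -/n /=; lia.
rewrite -(plan_path (n := n) (D := ri_D x) (ri_init x) W SI erefl erefl).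
split=> [[p [s [E H]]]|[p]]; first by exists p; rewrite /is_plan E.
by rewrite /is_plan; case E: (exec _ _ _) => [s|] // H; exists p, s.
Qed.

Lemma wp_cdecide w :
  let n := size w in
  wp (n * n + 3 * n + 4) cdecide (mem0 w) (fun b _ => b <-> plan_modification w).
Proof.
(* [n * n + n] indices hold the tables and the quantifiers, and [3 * n + 4] bounds the number of
   lists that [cvalid] counts up to. *)
move=> n; set B := n * n + 3 * n + 4.
have nB : n <= B by rewrite /B; lia.
have LB : n * n + n <= B by rewrite /B; lia.
have LB3 : 3 * n + 4 <= B by rewrite /B; lia.
have no m1 (Q : bool -> memory -> Prop) : Q false m1 -> wp B (CConst false) m1 Q.
  exact: wp_pure.
have I0 : inputm w (mem0 w) by split.
apply: wp_if; apply: (wp_cvalid nB) => // m1 Ag1 EN1 HE1.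
case V: (valid w) HE1; last first.
  move=> _; apply: no; split=> // -[x [Ex _]].
  by have := proj2 (validP w) (ex_intro _ x Ex); rewrite V.
move=> /(_ isT) HE1; have /validP[x wE] := V.
have I1 : inputm w m1 by apply: inputm_agree Ag1 I0.
have pmE : plan_modification w <-> reuse_promise x /\ solvable (ri_D x).
  split=> [[y [Ey]]|]; last by exists x.
  by rewrite wE in Ey; rewrite (enc_input_inj Ey).
have F1 A y : 4 < A -> arr m1 A y = false.
  move=> A4; rewrite (proj2 Ag1) /= ?inE; last by lia.
  by rewrite -[4.+1]/5 in A4; case: A A4 => [|[|A]].
have dead b m2 : (b -> False) -> (reuse_promise x -> b) -> wp B (CConst false) m2 (fun b' _ => b' <-> plan_modification w).
  by move=> bF Hb; apply: no; rewrite pmE; split=> // -[/Hb/bF].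
apply: wp_if; apply: (wp_cload nB wE LB I1 EN1 HE1 F1) => b m2 Eb Ag2 Lm2.
case: b Eb Lm2 => Eb Lm2; last first.
  by apply: (dead false) => //; rewrite Eb => /and4P[-> ->].
have /andP[W1 W2] := esym Eb; have [{}Lm2 Hd2 HE2] := Lm2 isT.
have F2 A y : 12 < A -> arr m2 A y = false.
  by move=> A4; rewrite (proj2 Ag2) ?F1 // ?inE; lia.
apply: wp_if; apply: (wp_cdiff nB wE Lm2 W1 W2 HE2 (F2 aDiff 0 isT)) => m3 Ag3.
case D: (differ_in_one _ _ _); last first.
  by apply: (dead false) => //; case/and4P => _ _; rewrite D.
have Lm3 : loaded w x m3 by apply: loaded_agree Ag3 Lm2.
have Hd3 : drop (ptr m3 pH) w = enc_nats (ri_plan x) by agsimp.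
apply: wp_if; apply: (wp_cplan nB wE LB Lm3 W1 Hd3) => m4 Ag4.
case Pl: (is_plan _ _); last first.
  by apply: (dead false) => //; case/and4P => _ _ _; rewrite Pl.
have Lm4 : loaded w x m4 by apply: loaded_agree Ag4 Lm3.
apply: (wp_csearch nB wE LB Lm4).
  by move=> A y A4; rewrite (proj2 Ag4) ?(proj2 Ag3) ?F2 // ?inE; lia.
move=> b _ ->; rewrite sav_solvable // pmE /reuse_promise W1 W2 D Pl.
by split=> [|[]].
Qed.

Theorem plan_modification_in_PSPACE : in_PSPACE plan_modification.
Proof.
have ok : okc 14 23 cdecide by [].
(* Pointers 0 to 13 and arrays 0 to 22 are in use. The constant 6 is forced by the empty word, for
   which the space bound [n * n + 3 * n + 6] equals 6. *)
exists (ptm 14 23 cdecide), 6, 2.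
apply: (@ptm_decides 14 23 cdecide _ _ ok _ (fun n => n * n + 3 * n + 4)) => //.
  by move=> n; rewrite -mulnn; nia.
by move=> w; have [b [m [t H]]] := wp_cdecide w; exists b, m, t.
Qed.

(** * The planning instance of a space-bounded machine *)

Definition op_triple (o : operator) := (op_pre o, op_add o, op_del o).
Definition triple_op (t : seq nat * seq nat * seq nat) := Op t.1.1 t.1.2 t.2.
Lemma op_tripleK : cancel op_triple triple_op. Proof. by case. Qed.
HB.instance Definition _ := Equality.copy operator (can_type op_tripleK).

(* Which cell a condition of an operator template refers to, relative to the
   position [i] of the operator; the second component is the offset in the block
   of [W] conditions of that cell. *)
Variant place := Fixed | Here | Before | After.
Definition place_code (v : place) : nat :=
  match v with Fixed => 0 | Here => 1 | Before => 2 | After => 3 end.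
Lemma place_codeK : cancel place_code (nth Fixed [:: Fixed; Here; Before; After]).
Proof. by case. Qed.
HB.instance Definition _ := Equality.copy place (can_type place_codeK).

Definition tnum : eqType := (place * nat)%type.
Definition toper : eqType := (seq tnum * seq tnum * seq tnum)%type.

(** For [i = 0], [Before] is again cell 0, as a left move at the end of the tape stays there. *)
Definition pos_of (i : nat) (v : place) : nat :=
  match v with Fixed => 0 | Here => i | Before => i.-1 | After => i.+1 end.
Definition tval (W i : nat) (t : tnum) : nat := pos_of i t.1 * W + t.2.
Definition tinst (W i : nat) (t : toper) : operator :=
  Op (map (tval W i) t.1.1) (map (tval W i) t.1.2) (map (tval W i) t.2).

Section Instance.
Variable M : TM.

Definition blk : nat := #|tm_sym M| + #|tm_state M|.
(** Conditions 0 and 1 are reserved; the shift by 2 places all cell and head conditions above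
    them. *)
Definition offc (a : tm_sym M) : nat := (enum_rank a).+2.
Definition offh (q : tm_state M) : nat := (#|tm_sym M| + enum_rank q).+2.
Definition target_place (mv : move) : place :=
  match mv with MLeft => Before | MRight => After | MStay => Here end.

(** [apply_op] deletes before it adds, so an unchanged symbol or head condition survives although it
    occurs in both lists. *)
Definition tmove (q : tm_state M) (a : tm_sym M) : toper :=
  let: (q', a', mv) := tm_delta q a in
  let del := [:: (Here, offh q); (Here, offc a)] in
  (del, [:: (Here, offc a'); (target_place mv, offh q')], del).
(** Halting states get no operators, because [step] freezes them whatever [tm_delta] says. *)
Definition tmoves : seq toper :=
  [seq tmove u.1 u.2 | u <- enum {: tm_state M * tm_sym M} &
     (u.1 != tm_acc M) && (u.1 != tm_rej M)].
Definition taccept : toper := ([:: (Here, offh (tm_acc M))], [:: (Fixed, 0)], [::]).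
Definition topers : seq toper := taccept :: tmoves.

Variables (Z : nat) (w : seq bool).

Definition insym (j : nat) : tm_sym M :=
  if j < size w then tm_in M (nth false w j) else tm_blank M.

(* Condition 0 is the goal; condition 1 enables the operator that reaches it in
   one step and is the only difference between the two initial states. *)
Definition shortcut : operator := Op [:: 1] [:: 0] [::].
Definition inst_ops : seq operator :=
  shortcut :: flatten [seq [seq tinst blk i t | t <- topers] | i <- iota 0 Z].
Definition inst_init : seq nat :=
  offh (tm_start M) :: [seq j * blk + offc (insym j) | j <- iota 0 Z].
(** One block beyond the [Z] cells is provided since an operator for the last cell may mention the
    head on cell [Z]. The given plan [[:: 0]] consists of [shortcut]. *)
Definition inst : reuse_input :=
  RI (Z.+1 * blk + 2) inst_ops (1 :: inst_init) inst_init [:: 0] [:: 0].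

Definition cellc (i : nat) (a : tm_sym M) : nat := i * blk + offc a.
Definition headc (i : nat) (q : tm_state M) : nat := i * blk + offh q.

Lemma off_inj i j r s : r < blk -> s < blk ->
  (i * blk + r.+2 == j * blk + s.+2) = (i == j) && (r == s).
Proof.
move=> rb sb; apply/eqP/andP => [|[/eqP -> /eqP -> //]].
rewrite !addnS => -[E]; have b0 : 0 < blk by lia.
have := congr1 (fun y => y %/ blk) E; rewrite !divnMDl // !divn_small // !addn0 => Eij.
by move: E; rewrite Eij => /addnI ->; rewrite !eqxx.
Qed.

Lemma ltc (a : tm_sym M) : enum_rank a < blk.
Proof. by apply: ltn_addr. Qed.
Lemma lth (q : tm_state M) : #|tm_sym M| + enum_rank q < blk.
Proof. by rewrite ltn_add2l. Qed.

Lemma cellc_eq i a j b : (cellc i a == cellc j b) = (i == j) && (a == b).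
Proof.
by rewrite /cellc off_inj ?ltc // (inj_eq val_inj) (inj_eq enum_rank_inj).
Qed.

Lemma headc_eq i q j r : (headc i q == headc j r) = (i == j) && (q == r).
Proof.
by rewrite /headc off_inj ?lth // eqn_add2l (inj_eq val_inj) (inj_eq enum_rank_inj).
Qed.

Lemma cellc_headc i a j q : (cellc i a == headc j q) = false.
Proof.
rewrite /headc /cellc off_inj ?lth ?ltc //; apply/negbTE; rewrite negb_and; apply/orP; right.
by rewrite neq_ltn ltn_addr.
Qed.

Lemma cellc_ge2 i a : 1 < cellc i a. Proof. by rewrite /cellc /offc !addnS. Qed.
Lemma headc_ge2 i q : 1 < headc i q. Proof. by rewrite /headc /offh !addnS. Qed.

Lemma off_bound i r : i <= Z -> r < blk -> i * blk + r.+2 < Z.+1 * blk + 2.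
Proof.
move=> iZ rb; rewrite addn2 !addnS !ltnS.
apply: (@leq_trans (i.+1 * blk)); last by rewrite leq_mul2r ltnS iZ orbT.
by rewrite mulSn addnC ltn_add2r.
Qed.

Lemma apply_mem o s c : (c \in apply_op o s) = (c \in s) && (c \notin op_del o) || (c \in op_add o).
Proof. by rewrite mem_cat mem_filter andbC. Qed.

(** Head conditions are described up to [Z], where a right move from the last cell would lead, cell
    contents only below [Z]. The absence of condition 1 keeps [shortcut] inapplicable. *)
Definition sim (s : seq nat) (c : config M) : Prop :=
  [/\ forall i a, i < Z -> (cellc i a \in s) = (tat (tm_blank M) (cfg_tape c) i == a),
      forall i q, i <= Z -> (headc i q \in s) = (i == tpos (cfg_tape c)) && (q == c_state c)
    & 1 \notin s].

(** The only applicable transition operator is the one of the current head position, state and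
    symbol, so a plan cannot deviate from the run of [M]. *)
Lemma sim_move s c i q a : sim s c -> i < Z -> ~~ halted c ->
  (applicable (tinst blk i (tmove q a)) s <->
     [/\ i = tpos (cfg_tape c), q = c_state c & a = c_head c]) /\
  (applicable (tinst blk i (tmove q a)) s -> sim (apply_op (tinst blk i (tmove q a)) s) (step c)).
Proof.
move=> [Sc Sh S1] iZ Hc.
case Ed: (tm_delta q a) => [[q' a'] mv].
have Eo : tinst blk i (tmove q a) = Op [:: headc i q; cellc i a]
   [:: cellc i a'; headc (mvpos i mv) q'] [:: headc i q; cellc i a].
  by rewrite /tmove Ed /tinst /=; case: mv {Ed}.
have App : applicable (tinst blk i (tmove q a)) s <->
     [/\ i = tpos (cfg_tape c), q = c_state c & a = c_head c].
  rewrite Eo /applicable /= andbT Sh ?(ltnW iZ) // Sc //.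
  split=> [/andP[/andP[/eqP -> /eqP ->] /eqP <-]|[-> -> ->]].
    by split=> //; rewrite tat_pos.
  by rewrite !eqxx tat_pos eqxx.
split=> // /App[Ei Eq Ea]; rewrite Eo.
rewrite (step_act (q := q') (a := a') (mv := mv) Hc) -?Eq -?Ea //.
have Et tp : cfg_tape (mkcfg (M := M) q' tp) = tp by case: tp.
split=> [j b jZ|j r jZ|]; rewrite apply_mem /=.
- rewrite Et tat_act -Ei Sc // !inE !cellc_headc !cellc_eq orbF.
  case: (j =P i) => [->|_] /=; last by rewrite andbT orbF.
  rewrite Ei tat_pos -/(c_head c) -[th _]/(c_head c) -Ea.
  by rewrite [a == b]eq_sym [a' == b]eq_sym; case: (b == a).
- rewrite Et tpos_act -Ei Sh // !inE ![headc _ _ == cellc _ _]eq_sym !cellc_headc !headc_eq orbF.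
  by rewrite -Ei -Eq andbN.
- rewrite (negbTE S1) /= !inE; have := cellc_ge2 i a'; have := headc_ge2 (mvpos i mv) q'.
  by case: (1 =P cellc _ _) => [<-//|_]; case: (1 =P headc _ _) => [<-|].
Qed.

Hypothesis Zspace : forall t, space (run M w t) <= Z.

Lemma tpos_run t : tpos (cfg_tape (run M w t)) < Z.
Proof. by have := Zspace t; rewrite /space /tpos /=; lia. Qed.

Lemma tat_init j : tat (tm_blank M) (cfg_tape (run M w 0)) j = insym j.
Proof.
rewrite /insym /run /=; case: w => [|b w'] /=.
  by case: j => [|j] //; rewrite /tat /= nth_nil.
case: j => [|j] //=; rewrite ltnS /tat /=; case: ltnP => Hj.
  by rewrite (nth_map false).
by rewrite nth_default ?size_map.
Qed.

Lemma sim_init : sim inst_init (run M w 0).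
Proof.
have Es : c_state (run M w 0) = tm_start M by rewrite /run /=; case: w.
have Ep : tpos (cfg_tape (run M w 0)) = 0 by rewrite /run /=; case: w.
have Eh : offh (tm_start M) = headc 0 (tm_start M) by [].
split=> [i a iZ|i q iZ|]; rewrite inE Eh.
- rewrite cellc_headc /= tat_init; apply/mapP/eqP => [[j]|<-].
    by rewrite mem_iota => _ /eqP; rewrite cellc_eq => /andP[/eqP -> /eqP ->].
  by exists i; rewrite // mem_iota.
- rewrite headc_eq Es Ep; apply/orP/idP => [[->//|/mapP[j _ /eqP]]|->]; last by left.
  by rewrite eq_sym cellc_headc.
- rewrite negb_or neq_ltn headc_ge2 /=; apply/mapP => -[j _ E].
  by have := cellc_ge2 j (insym j); rewrite -[cellc _ _]/(_ * _ + _) -E.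
Qed.

Lemma inst_opsP o :
  o \in inst_ops <->
  [\/ o = shortcut,
      exists2 i, i < Z & o = tinst blk i taccept |
      exists i q a, [/\ i < Z, q != tm_acc M, q != tm_rej M & o = tinst blk i (tmove q a)]].
Proof.
rewrite inE; split=> [/orP[/eqP ->|/flatten_mapP[i]]|]; first by apply: Or31.
  rewrite mem_iota => iZ /mapP[t]; rewrite /topers inE => /orP[/eqP ->|/mapP[[q a] qa ->]] ->.
    by apply: Or32; exists i.
  by move: qa; rewrite mem_filter => /andP[/andP[/= q1 q2] _]; apply: Or33; exists i, q, a.
have H i t : i < Z -> t \in topers -> tinst blk i t \in inst_ops.
  move=> iZ tT; rewrite inE; apply/orP; right; apply/flatten_mapP; exists i.
    by rewrite mem_iota.
  exact: map_f.
case=> [->|[i iZ ->]|[i [q [a [iZ q1 q2 ->]]]]]; rewrite ?eqxx //.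
  by apply: H => //; rewrite inE eqxx.
apply: H => //; rewrite inE; apply/orP; right; apply/mapP; exists (q, a) => //.
by rewrite mem_filter /= q1 q2 mem_enum.
Qed.

Lemma exec_cons i p s :
  i < size inst_ops -> applicable (nth shortcut inst_ops i) s ->
  exec (ri_D inst) (i :: p) s = exec (ri_D inst) p (apply_op (nth shortcut inst_ops i) s).
Proof. by move=> iL; rewrite /= iL (set_nth_default shortcut) // => ->. Qed.

Lemma sim_forward t : exists p s, exec (ri_D inst) p inst_init = Some s /\ sim s (run M w t).
Proof.
elim: t => [|t [p [s [Ep Hs]]]]; first by exists [::], inst_init; split=> //; apply: sim_init.
have [Hh|Hh] := boolP (halted (run M w t)).
  by exists p, s; split=> //; rewrite /run iterS /step -/(run M w t) Hh.
set c := run M w t in Hs Hh.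
have iZ := tpos_run t; rewrite -/c in iZ.
have [H1 H2] := sim_move (c_state c) (c_head c) Hs iZ Hh.
have app := proj2 H1 (And3 erefl erefl erefl).
set o := tinst _ _ _ in H1 H2 app.
have oI : o \in inst_ops.
  apply/inst_opsP; apply: Or33; exists (tpos (cfg_tape c)), (c_state c), (c_head c).
  by move: Hh; rewrite negb_or => /andP[].
exists (rcons p (index o inst_ops)), (apply_op o s); split; last exact: H2.
rewrite -cats1 exec_cat Ep -[obind _ _]/(exec (ri_D inst) [:: index o inst_ops] s).
by rewrite exec_cons ?index_mem ?nth_index.
Qed.

(** A step of a plan is either a step of the machine or the accepting operator, which leaves [t] as
    it is. The second conjunct persists because condition 0 is added only in the accepting state,
    where no transition operator applies any more. *)
Lemma sim_backward p s :
  exec (ri_D inst) p inst_init = Some s ->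
  exists t, sim s (run M w t) /\ (0 \in s -> c_state (run M w t) = tm_acc M).
Proof.
elim/last_ind: p s => [|p i IH] s.
  case=> <-; exists 0; split; first exact: sim_init.
  rewrite inE => /orP[/eqP E|/mapP[j _ E]].
    by have := headc_ge2 0 (tm_start M); rewrite -[headc _ _]/(offh _) -E.
  by have := cellc_ge2 j (insym j); rewrite -[cellc _ _]/(_ * _ + _) -E.
rewrite -cats1 exec_cat; case E: (exec _ p _) => [s0|] //=.
case: ifP => // iL; case: ifP => // app [<-] {s}.
have [t [Hs H0]] := IH _ E.
set c := run M w t in Hs H0.
have oI : nth (Op [::] [::] [::]) inst_ops i \in inst_ops by apply: mem_nth.
move: (nth _ _ i) app oI => o app /inst_opsP oI.
case: (Hs) => Sc Sh S1.
case: oI app => [->|[j jZ ->]|[j [q [a [jZ q1 q2 ->]]]]] app.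
- by move: app; rewrite /applicable /= (negbTE S1).
- have Eq : c_state c = tm_acc M.
    by move: app; rewrite /applicable /= andbT Sh ?(ltnW jZ) // => /andP[_ /eqP].
  exists t; split=> //; split=> [k a kZ|k q kZ|]; rewrite apply_mem /= !inE ?andbT.
  + by rewrite Sc //; case: (cellc k a =P _) (cellc_ge2 k a) => [->//|_ _]; rewrite orbF.
  + by rewrite Sh //; case: (headc k q =P _) (headc_ge2 k q) => [->//|_ _]; rewrite orbF.
  + by rewrite (negbTE S1).
have [Hh|Hh] := boolP (halted c).
  have : headc j q \in s0 by move: app; rewrite /applicable /tmove; case: (tm_delta q a) => [[? ?] ?] /andP[].
  rewrite Sh ?(ltnW jZ) // => /andP[_ /eqP Eq].
  by move: Hh; rewrite /halted -Eq (negbTE q1) (negbTE q2).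
have [_ H] := sim_move q a Hs jZ Hh.
exists t.+1; rewrite /run iterS -/(run M w t) -/c; split; first exact: H.
rewrite apply_mem /tmove; case: (tm_delta q a) => [[q' a'] mv] /=.
rewrite !inE => /orP[/andP[/H0 Ea _]|/orP[]/eqP E0].
- by move: Hh; rewrite /halted Ea eqxx.
- by have := cellc_ge2 j a'; rewrite -[cellc _ _]/(tval blk j (Here, offc a')) -E0.
- have := headc_ge2 (pos_of j (target_place mv)) q'.
  by rewrite -[headc _ _]/(tval blk j (target_place mv, offh q')) -E0.
Qed.

Lemma inst_solvable : solvable (ri_D inst) <-> exists t, c_state (run M w t) = tm_acc M.
Proof.
split=> [[p]|[t Et]].
  rewrite /is_plan; case E: (exec _ _ _) => [s|] //=; rewrite andbT => s0.
  by have [t [_ H]] := sim_backward E; exists t; apply: H.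
have [p [s [Ep [Sc Sh S1]]]] := sim_forward t.
set o := tinst blk (tpos (cfg_tape (run M w t))) taccept.
have oI : o \in inst_ops.
  by apply/inst_opsP; apply: Or32; exists (tpos (cfg_tape (run M w t))) => //; apply: tpos_run.
have app : applicable o s.
  by rewrite /applicable /= andbT Sh ?Et ?eqxx // ltnW ?tpos_run.
exists (rcons p (index o inst_ops)).
rewrite /is_plan -cats1 exec_cat Ep -[obind _ _]/(exec (ri_D inst) [:: index o inst_ops] s).
by rewrite exec_cons ?index_mem ?nth_index //= mem_cat inE orbT.
Qed.

Lemma inst_promise : reuse_promise inst.
Proof.
have ok0 : 0 < Z.+1 * blk + 2 by rewrite addn2.
have ok1 : 1 < Z.+1 * blk + 2 by rewrite addn2.
have okc i a : i <= Z -> cellc i a < Z.+1 * blk + 2 by move=> iZ; apply: off_bound; rewrite ?ltc.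
have okh i q : i <= Z -> headc i q < Z.+1 * blk + 2 by move=> iZ; apply: off_bound; rewrite ?lth.
have okI : all (fun c => c < Z.+1 * blk + 2) inst_init.
  apply/allP => c; rewrite inE => /orP[/eqP ->|/mapP[j]]; first exact: (okh 0).
  by rewrite mem_iota => /ltnW jZ ->; apply: okc.
have okO : all (fun o => [&& all (fun c => c < Z.+1 * blk + 2) (op_pre o),
   all (fun c => c < Z.+1 * blk + 2) (op_add o) & all (fun c => c < Z.+1 * blk + 2) (op_del o)]) inst_ops.
  apply/allP => o /inst_opsP[->|[i iZ ->]|[i [q [a [iZ _ _ ->]]]]].
  - by rewrite /= ok0 ok1.
  - by rewrite /= [tval _ _ _]/(headc i _) okh ?ok0 // ltnW.
  rewrite /tmove; case: (tm_delta q a) => [[q' a'] mv] /=.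
  rewrite -!/(headc i _) -!/(cellc i _) !okc ?okh ?(ltnW iZ) //=.
  by case: (mv) => /=; lia.
have okG : all (fun c => c < Z.+1 * blk + 2) [:: 0] by rewrite /= ok0.
have N1 : 1 \notin inst_init by case: sim_init.
apply/and4P; split.
- by apply/and3P; split; [rewrite -[s_init _]/(1 :: inst_init) -cat1s all_cat all_seq1 ok1|..].
- by apply/and3P; split.
- rewrite /differ_in_one (@eq_count _ _ (pred1 1)) => [|c].
    by rewrite count_uniq_mem ?iota_uniq // mem_iota add0n ok1.
  rewrite [c \in ri_init_o _]inE -[ri_init inst]/inst_init -[pred1 1 c]/(c == 1).
  by case: (c =P 1) => [->|_]; [rewrite (negbTE N1)|rewrite orFb eqxx].
- by rewrite /is_plan /= andbT mem_cat inE orbT.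
Qed.

End Instance.

(** * Computing the instance in polynomial time *)

(** Here time is recorded and pointers are unbounded; this suits a polynomial-time reduction, whose
    space is bounded by its time. *)
Definition wpt (T : nat) (c : cmd) (m : memory) (Q : memory -> Prop) : Prop :=
  exists b m' t, [/\ ev None c m b m' t, t <= T & Q m'].

Lemma wpt_le T T' c m (Q Q' : memory -> Prop) :
  T <= T' -> (forall m', Q m' -> Q' m') -> wpt T c m Q -> wpt T' c m Q'.
Proof.
move=> LT HQ [b [m' [t [H Lt HQm]]]]; exists b, m', t; split=> //.
  exact: leq_trans LT.
exact: HQ.
Qed.

Lemma wpt_leT T T' c m Q : T <= T' -> wpt T c m Q -> wpt T' c m Q.
Proof. by move=> LT; apply: wpt_le. Qed.

Lemma wpt_seq T1 T2 c1 c2 m Q :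
  wpt T1 c1 m (fun m1 => wpt T2 c2 m1 Q) -> wpt (T1 + T2) (CSeq c1 c2) m Q.
Proof.
move=> [b [m1 [t1 [H1 L1 [b2 [m2 [t2 [H2 L2 HQ]]]]]]]].
by exists b2, m2, (t1 + t2); split; [apply: ev_seq H1 H2|apply: leq_add|].
Qed.

Lemma wpt_pure c m (Q : memory -> Prop) : pure c -> Q m -> wpt (csize c) c m Q.
Proof. by move=> /(ev_pure None m)[t Lt H] HQ; exists (beval c m), m, t. Qed.

Lemma wpt_if T c c1 c2 m Q :
  pure c -> wpt T (if beval c m then c1 else c2) m Q -> wpt (csize c + T) (CIf c c1 c2) m Q.
Proof.
move=> /(ev_pure None m)[t Lt H] [b2 [m2 [t2 [H2 L2 HQ]]]].
by exists b2, m2, (t + t2); split; [apply: ev_if H H2|apply: leq_add|].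
Qed.

Lemma wpt_set x v b m (Q : memory -> Prop) :
  Q (seta m x (ptr m v) b) -> wpt 1 (CSet x v b) m Q.
Proof. by move=> HQ; exists true, (seta m x (ptr m v) b), 1; split=> //; constructor. Qed.

Lemma wpt_right v m (Q : memory -> Prop) :
  Q (setp m v (ptr m v).+1) -> wpt 1 (CRight v) m Q.
Proof. by move=> HQ; exists true, (setp m v (ptr m v).+1), 1; split=> //; constructor. Qed.

Lemma wpt_zero v m (Q : memory -> Prop) :
  v != 0 -> ptr m 0 = 0 -> Q (setp m v 0) -> wpt (4 * ptr m v + 3) (czero v) m Q.
Proof. by move=> v0 E0 HQ; have [t Lt H] := ev_czero None v0 E0; exists true, (setp m v 0), t. Qed.

Lemma wpt_copy v u m (Q : memory -> Prop) :
  v != 0 -> v != u -> ptr m 0 = 0 -> Q (setp m v (ptr m u)) ->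
  wpt (4 * (ptr m v + ptr m u) + 6) (ccopy v u) m Q.
Proof.
move=> v0 vu E0 HQ; have [t Lt H] := ev_ccopy (B := None) v0 vu E0 isT.
by exists true, (setp m v (ptr m u)), t.
Qed.

(** [T + 4] is the body plus 3 for the test and 1 for the move of [j]; resetting [j] and the last
    test give [4 * ptr m j + 6]. *)
Lemma wpt_for j e c T N (I : nat -> memory -> Prop) m (Q : memory -> Prop) :
  j != 0 -> ptr m 0 = 0 -> (forall i m1, I i m1 -> ptr m1 j = i /\ ptr m1 e = N) ->
  I 0 (setp m j 0) ->
  (forall i m1, i < N -> I i m1 -> wpt T c m1 (fun m2 => ptr m2 j = i /\ I i.+1 (setp m2 j i.+1))) ->
  (forall m1, I N m1 -> Q m1) ->
  wpt (4 * ptr m j + 6 + N * (T + 4)) (cfor j e c) m Q.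
Proof.
move=> j0 E0 IE I0 IS HQ.
have -> : 4 * ptr m j + 6 + N * (T + 4) = (4 * ptr m j + 3) + (3 + N * (T + 4)) by lia.
apply: wpt_seq; apply: wpt_zero => //.
suff H d i m1 : i + d = N -> I i m1 ->
    wpt (3 + d * (T + 4)) (CWhile (cnot (CSame j e)) (CSeq c (CRight j))) m1 Q by apply: (H N 0).
elim: d i m1 => [|d IH] i m1 Ed Ii; have [Ej Ee] := IE _ _ Ii;
  have [t Lt Ht] := ev_pure None m1 (c := cnot (CSame j e)) isT; rewrite /= Ej Ee in Lt Ht.
  exists true, m1, t; split=> //; last by apply: HQ; rewrite -Ed addn0.
  by apply: ev_stop; rewrite -Ed addn0 eqxx in Ht.
have Li : i < N by lia.
rewrite (ltn_eqF Li) in Ht.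
have [b2 [m2 [t2 [H2 L2 [Ej2 I2]]]]] := IS _ _ Li Ii.
have Ed2 : i.+1 + d = N by lia.
have [b3 [m3 [t3 [H3 L3 HQ3]]]] := IH _ _ Ed2 I2.
exists b3, m3, (t + (t2 + 1) + t3); split=> //; last by rewrite mulSn; lia.
apply: (ev_go Ht _ H3); apply: ev_seq H2 _.
by have := @ev_right None j m2 isT; rewrite Ej2; apply.
Qed.

(* Pointer 4 is the output position; arrays 2 and 3 hold the output. *)
Local Notation pO := 4.
Local Notation pT := 5.
Local Notation pL := 3.
Local Notation pS := 2.
Local Notation pS1 := 6.
Local Notation pY := 7.
Local Notation pJJ := 8.
Local Notation aOut := [:: 2; 3].

Definition cemit b := CSeq (CSet 2 pO b) (CSeq (CSet 3 pO true) (CRight pO)).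
Fixpoint cemits (s : seq bool) : cmd :=
  if s is b :: s' then CSeq (cemit b) (cemits s') else cskip.

(** The output pointer is exempt from the bound [K]: it is never reset nor used as a loop bound, so
    the output may be longer than [K] without affecting the cost of loops. *)
Record outst (K : nat) (m : memory) (s : seq bool) : Prop := Outst {
  os_home : ptr m 0 = 0;
  os_small : forall v, v != pO -> ptr m v <= K;
  os_pos : ptr m pO = size s;
  os_dom : forall j, arr m 3 j = (j < size s);
  os_bit : forall j, j < size s -> arr m 2 j = nth false s j }.

Lemma outst_emit K m s b : outst K m s ->
  outst K (setp (seta (seta m 2 (size s) b) 3 (size s) true) pO (size s).+1) (rcons s b).
Proof.
case=> H1 H2 H3 H4 H5; split=> //=.
- by move=> v vO; rewrite (negbTE vO); apply: H2.
- by rewrite size_rcons.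
- by move=> j; rewrite size_rcons ltnS [j <= _]leq_eqVlt H4; case: eqP.
- move=> j; rewrite size_rcons ltnS nth_rcons [j <= _]leq_eqVlt.
  by case: eqP => [->|_] /=; [rewrite ltnn|move=> jL; rewrite jL H5].
Qed.

Lemma wpt_cemits K m s g (Q : memory -> Prop) :
  outst K m s ->
  (forall m', agree [:: pO] aOut m m' -> outst K m' (s ++ g) -> Q m') ->
  wpt (3 * size g + 1) (cemits g) m Q.
Proof.
elim: g m s => [|b g IH] m s Hm HQ.
  by apply: (wpt_pure (c := cskip)) => //; apply: HQ; rewrite ?cats0.
rewrite /= mulnS -addnA; apply: wpt_seq.
apply: (wpt_seq (T1 := 1) (T2 := 2)); apply: wpt_set.
apply: (wpt_seq (T1 := 1) (T2 := 1)); apply: wpt_set; apply: wpt_right.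
rewrite /= (os_pos Hm); apply: (IH _ _ (outst_emit b Hm)) => m' Ag Hm'.
apply: HQ; last by rewrite -cat_rcons.
apply: agree_trans Ag; apply: agree_setp => //; do 2 (apply: agree_seta; first by []).
exact: agree_refl.
Qed.

(* [c] runs in time O(K^d) on memories whose pointers are at most [K], and from
   [m] it appends to the output any [g] with [R m g]. *)
Definition emits (P : seq nat) (d : nat) (c : cmd) (R : memory -> seq bool -> Prop) : Prop :=
  exists A, forall K m s g, outst K m s -> R m g ->
    wpt (A * K.+1 ^ d) c m (fun m' => outst K m' (s ++ g) /\ agree P aOut m m').

Lemma emits_weaken P d c (R : memory -> seq bool -> Prop) P' d' R' :
  {subset P <= P'} -> d <= d' -> (forall m g, R' m g -> R m g) ->
  emits P d c R -> emits P' d' c R'.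
Proof.
move=> HP Hd HR [A H]; exists A => K m s g Hm /HR Rm.
apply: wpt_le (H K m s g Hm Rm); first by rewrite leq_mul2l leq_pexp2l ?orbT.
by move=> m' [H1 H2]; split=> //; apply: agree_sub H2.
Qed.

Lemma emits_const P d s0 : pO \in P -> emits P d (cemits s0) (fun _ g => g = s0).
Proof.
move=> OP; exists (3 * size s0 + 1) => K m s g Hm ->.
apply: (wpt_leT (T := 3 * size s0 + 1)); first by rewrite leq_pmulr // expn_gt0.
apply: (wpt_cemits Hm) => m' Ag Hm'; split=> //.
by apply: agree_incl _ Ag; rewrite /= OP.
Qed.

Lemma emits_seq P d c1 c2 R1 R2 :
  emits P d c1 R1 -> emits P d c2 R2 ->
  emits P d (CSeq c1 c2) (fun m g => exists g1 g2, [/\ g = g1 ++ g2, R1 m g1 &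
     forall m', agree P aOut m m' -> R2 m' g2]).
Proof.
move=> [A1 H1] [A2 H2]; exists (A1 + A2) => K m s g Hm [g1 [g2 [-> r1 r2]]].
rewrite mulnDl; apply: wpt_seq; apply: wpt_le (H1 K m s g1 Hm r1) => // m1 [Hm1 Ag1].
apply: wpt_le (H2 K m1 _ g2 Hm1 (r2 _ Ag1)) => // m2; rewrite -catA => -[Hm2 Ag2].
by split=> //; apply: agree_trans Ag1 Ag2.
Qed.

Lemma emits_if P d c c1 c2 R1 R2 : pure c ->
  emits P d c1 R1 -> emits P d c2 R2 ->
  emits P d (CIf c c1 c2) (fun m g => if beval c m then R1 m g else R2 m g).
Proof.
move=> pc [A1 H1] [A2 H2]; exists (csize c + (A1 + A2)) => K m s g Hm Rg.
apply: (wpt_leT (T := csize c + (A1 + A2) * K.+1 ^ d)).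
  by rewrite [leqRHS]mulnDl leq_add2r leq_pmulr // expn_gt0.
apply: wpt_if => //; case: (beval c m) Rg => Rg.
  by apply: wpt_le (H1 K m s g Hm Rg) => //; rewrite mulnDl leq_addr.
by apply: wpt_le (H2 K m s g Hm Rg) => //; rewrite mulnDl leq_addl.
Qed.

Lemma emits_for P d j e c R :
  j \notin 0 :: pO :: P -> e \notin j :: P -> 0 \notin P -> e != pO -> emits P d c R ->
  emits (j :: P) d.+1 (cfor j e c) (fun m g => exists G : nat -> seq bool,
    g = flatten (map G (iota 0 (ptr m e))) /\
    forall i m', i < ptr m e -> agree (j :: P) aOut m m' -> ptr m' j = i -> R m' (G i)).
Proof.
rewrite !inE !negb_or => /and3P[j0 jO jP] /andP[ej eP] zP eO [A H].
(* The overhead of a loop is at most [4 * K + 6] at the start and 4 in each of at most [K] rounds,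
   in total at most [14 * K.+1]. *)
exists (A + 14) => K m s g Hm [G [-> HG]].
have [Z0 Hs _ _ _] := Hm.
have eK : ptr m e <= K by apply: Hs.
have jK : ptr m j <= K by apply: Hs.
apply: (wpt_leT (T := 4 * ptr m j + 6 + ptr m e * (A * K.+1 ^ d + 4))).
- have Kd : 0 < K.+1 ^ d by rewrite expn_gt0.
  apply: (@leq_trans (4 * K + 6 + K * (A * K.+1 ^ d + 4))).
    by apply: leq_add; [lia|apply: leq_mul].
  rewrite expnS; set X := K.+1 ^ d in Kd *.
  have : K <= K * X by rewrite leq_pmulr.
  rewrite mulnDr mulnCA; nia.
apply: (wpt_for (I := fun i m1 => [/\ ptr m1 j = i, i <= ptr m e, agree (j :: P) aOut m m1 &
   outst K m1 (s ++ flatten (map G (iota 0 i)))])) => //.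
- by move=> i m1 [E1 _ Ag _]; split=> //; rewrite (proj1 Ag e) // inE negb_or ej.
- split; rewrite /= ?eqxx //; first by apply: agree_setp; rewrite ?inE ?eqxx.
  rewrite cats0; case: Hm => h1 h2 h3 h4 h5; split=> //=.
  + by rewrite [0 == j]eq_sym (negbTE j0).
  + by move=> v vO; case: ifP => // _; apply: Hs.
  + by rewrite [4 == j]eq_sym (negbTE jO).
- move=> i m1 Li [E1 _ Ag1 Hm1].
  apply: wpt_le (H K m1 _ (G i) Hm1 (HG _ _ Li Ag1 E1)) => // m2 [Hm2 Ag2].
  have E2 : ptr m2 j = i by rewrite (proj1 Ag2).
  split=> //; split; rewrite /= ?eqxx //.
    apply: agree_setp; first by rewrite inE eqxx.
    apply: agree_trans Ag1 _; apply: agree_sub Ag2 => // z zP'; by rewrite inE zP' orbT.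
  have -> : s ++ flatten (map G (iota 0 i.+1)) = (s ++ flatten (map G (iota 0 i))) ++ G i.
    by rewrite -addn1 iotaD map_cat flatten_cat /= cats0 catA.
  case: Hm2 => h1 h2 h3 h4 h5; split=> //=.
  + by rewrite [0 == j]eq_sym (negbTE j0).
  + by move=> v vO; case: ifP => // _; [lia|apply: h2].
  + by rewrite [4 == j]eq_sym (negbTE jO).
- by move=> m1 [_ _ Ag1 Hm1].
Qed.

(** * Emitting the code of the instance *)

Definition cunary (W v k : nat) : cmd :=
  CSeq (cfor pT v (cemits (nseq W true))) (cemits (enc_nat k)).
(** The first round of the loop emits nothing, which yields the predecessor of the position of [pL],
    truncated at 0 as [pos_of] requires. *)
Definition cbefore (W k : nat) : cmd :=
  CSeq (cfor pT pL (CIf (CSame pT 0) (cemits [::]) (cemits (nseq W true)))) (cemits (enc_nat k)).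
Definition cnum (W : nat) (t : tnum) : cmd :=
  match t.1 with
  | Fixed => cemits (enc_nat t.2)
  | Here => cunary W pL t.2
  | After => cunary W pL (W + t.2)
  | Before => cbefore W t.2
  end.
Fixpoint cseqs (T : Type) (f : T -> cmd) (l : seq T) : cmd :=
  if l is x :: l' then CSeq (f x) (cseqs f l') else cemits [::].
Definition cnumlist (W : nat) (l : seq tnum) : cmd :=
  CSeq (cemits (enc_nat (size l))) (cseqs (cnum W) l).
Definition coper (W : nat) (t : toper) : cmd :=
  CSeq (cnumlist W t.1.1) (CSeq (cnumlist W t.1.2) (cnumlist W t.2)).

Lemma enc_natD a b : nseq a true ++ enc_nat b = enc_nat (a + b).
Proof. by rewrite /enc_nat catA -nseqD. Qed.

Lemma flatten_nseq N W : flatten [seq nseq W true | _ <- iota 0 N] = nseq (N * W) true.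
Proof.
elim: N 0 => //= N IH i; by rewrite IH -nseqD mulSn.
Qed.

Lemma emits_cunary W v k : v \notin [:: pT; pO] ->
  emits [:: pT; pO] 1 (cunary W v k) (fun m g => g = enc_nat (ptr m v * W + k)).
Proof.
rewrite !inE negb_or => /andP[vT vO].
have H1 : emits [:: pO] 0 (cemits (nseq W true)) (fun _ g => g = nseq W true).
  exact: emits_const.
have H2 := emits_for (P := [:: pO]) (j := pT) (e := v) isT _ isT vO H1.
have /H2{H2} H2 : v \notin [:: pT; pO] by rewrite !inE negb_or vT.
have H3 : emits [:: pT; pO] 1 (cemits (enc_nat k)) (fun _ g => g = enc_nat k).
  exact: emits_const.
apply: emits_weaken (emits_seq H2 H3) => // m g ->.
exists (nseq (ptr m v * W) true), (enc_nat k); split=> //; first by rewrite enc_natD.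
by exists (fun _ => nseq W true); rewrite flatten_nseq.
Qed.

Lemma emits_cbefore W k :
  emits [:: pT; pO] 1 (cbefore W k)
    (fun m g => ptr m 0 = 0 /\ g = enc_nat ((ptr m pL).-1 * W + k)).
Proof.
have H0 : emits [:: pO] 0 (cemits [::]) (fun _ g => g = [::]) by apply: emits_const.
have H1 : emits [:: pO] 0 (cemits (nseq W true)) (fun _ g => g = nseq W true).
  exact: emits_const.
have H2 := emits_for (P := [:: pO]) (j := pT) (e := pL) isT isT isT isT (emits_if (c := CSame pT 0) isT H0 H1).
have H3 : emits [:: pT; pO] 1 (cemits (enc_nat k)) (fun _ g => g = enc_nat k).
  exact: emits_const.
apply: emits_weaken (emits_seq H2 H3) => // m g [Z0 ->].
exists (nseq ((ptr m pL).-1 * W) true), (enc_nat k); split=> //; first by rewrite enc_natD.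
exists (fun i => if i == 0 then [::] else nseq W true); split.
  case: (ptr m pL) => //= N; rewrite -flatten_nseq; congr flatten.
  by rewrite -[1]addn0 iotaDl -map_comp /=; apply: eq_map.
by move=> i m' Li Ag Ei; rewrite /= Ei (proj1 Ag) // Z0; case: eqP.
Qed.

Definition emitsL (c : cmd) (h : nat -> seq bool) : Prop :=
  emits [:: pT; pO] 1 c (fun m g => ptr m 0 = 0 /\ g = h (ptr m pL)).

Lemma emitsL_const s0 : emitsL (cemits s0) (fun _ => s0).
Proof. by apply: (emits_weaken _ _ _ (emits_const (P := [:: pT; pO]) 1 s0 isT)) => // m g []. Qed.

Lemma emitsL_seq c1 c2 h1 h2 :
  emitsL c1 h1 -> emitsL c2 h2 -> emitsL (CSeq c1 c2) (fun i => h1 i ++ h2 i).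
Proof.
move=> H1 H2; apply: emits_weaken (emits_seq H1 H2) => // m g [Z0 ->].
exists (h1 (ptr m pL)), (h2 (ptr m pL)); split=> // m' Ag.
by rewrite !(proj1 Ag).
Qed.

Lemma emitsL_ext c h h' : h =1 h' -> emitsL c h -> emitsL c h'.
Proof. by move=> E; apply: emits_weaken => // m g [Z0 ->]; rewrite E. Qed.

Lemma emitsL_seqs (T : Type) (f : T -> cmd) (h : T -> nat -> seq bool) l :
  (forall x, emitsL (f x) (h x)) -> emitsL (cseqs f l) (fun i => flatten [seq h x i | x <- l]).
Proof.
move=> H; elim: l => [|x l IH]; first exact: emitsL_const.
exact: emitsL_seq (H x) IH.
Qed.

Lemma emitsL_cnum W t : emitsL (cnum W t) (fun i => enc_nat (tval W i t)).
Proof.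
case: t => [[] k]; rewrite /cnum /tval /=.
- exact: emitsL_const.
- by apply: (emits_weaken _ _ _ (emits_cunary W (v := pL) k isT)) => // m g [].
- exact: emits_cbefore.
- apply: (emits_weaken _ _ _ (emits_cunary W (v := pL) (W + k) isT)) => // m g [_ ->].
  by rewrite mulSn addnCA addnA.
Qed.

Lemma emitsL_numlist W l : emitsL (cnumlist W l) (fun i => enc_nats (map (tval W i) l)).
Proof.
apply: emitsL_ext (emitsL_seq (emitsL_const _) (emitsL_seqs l (@emitsL_cnum W))) => i.
by rewrite /enc_nats size_map -map_comp.
Qed.

Lemma emitsL_oper W t : emitsL (coper W t) (fun i => enc_op (tinst W i t)).
Proof.
exact: (emitsL_seq (emitsL_numlist W _) (emitsL_seq (emitsL_numlist W _) (emitsL_numlist W _))).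
Qed.

Lemma enc_flatten (T : Type) (enc : T -> seq bool) (ss : seq (seq T)) :
  flatten (map enc (flatten ss)) = flatten [seq flatten (map enc s) | s <- ss].
Proof. by elim: ss => //= s ss <-; rewrite map_cat flatten_cat. Qed.

Section Emit.
Variable M : TM.
Let W := blk M.

Definition ready (Z : nat) (w : seq bool) (m : memory) : Prop :=
  [/\ ptr m 0 = 0, ptr m pS = Z, ptr m pS1 = Z.+1,
      arr m 0 = nth false w & arr m 1 = fun j => j < size w].

(* [Z] and [w] are quantified inside, so that the time bound hidden in [emits]
   does not depend on them. *)
Definition emitsR (c : cmd) (g : nat -> seq bool -> seq bool) : Prop :=
  emits [:: pL; pT; pO] 2 c (fun m g' => exists Z w, ready Z w m /\ g' = g Z w).

Lemma ready_agree Z w m m' :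
  agree [:: pL; pT; pO] aOut m m' -> ready Z w m -> ready Z w m'.
Proof. by move=> Ag [h1 h2 h3 h4 h5]; split; rewrite ?(proj1 Ag) ?(proj2 Ag). Qed.

Lemma emitsR_seq c1 c2 g1 g2 :
  emitsR c1 g1 -> emitsR c2 g2 -> emitsR (CSeq c1 c2) (fun Z w => g1 Z w ++ g2 Z w).
Proof.
move=> H1 H2; apply: emits_weaken (emits_seq H1 H2) => // m g [Z [w [Rm ->]]].
exists (g1 Z w), (g2 Z w); split=> //; first by exists Z, w.
by move=> m' Ag; exists Z, w; split=> //; apply: ready_agree Ag Rm.
Qed.

Lemma emitsR_ext c g g' : (forall Z w, g Z w = g' Z w) -> emitsR c g -> emitsR c g'.
Proof.
by move=> E; apply: emits_weaken => // m g0 [Z [w [Rm ->]]]; exists Z, w; rewrite E.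
Qed.

Lemma emitsR_const g : emitsR (cemits g) (fun _ _ => g).
Proof.
by apply: (emits_weaken _ _ _ (emits_const (P := [:: pL; pT; pO]) 2 g isT)) => // m g' [Z [w []]].
Qed.

Lemma sub_pL : {subset [:: pT; pO] <= [:: pL; pT; pO]}.
Proof. by move=> z; rewrite !inE => ->; rewrite orbT. Qed.

Lemma emitsR_unary V v k (N : nat -> nat) :
  v \notin [:: pT; pO] -> (forall Z w m, ready Z w m -> ptr m v = N Z) ->
  emitsR (cunary V v k) (fun Z _ => enc_nat (N Z * V + k)).
Proof.
move=> vP HN; apply: (emits_weaken sub_pL _ _ (emits_cunary V k vP)) => // m g [Z [w [Rm ->]]].
by rewrite (HN _ _ _ Rm).
Qed.

Definition cins : cmd :=
  CIf (CTest 1 pL) (CIf (CTest 0 pL) (cunary W pL (offc (tm_in M true)))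
                                     (cunary W pL (offc (tm_in M false))))
      (cunary W pL (offc (tm_blank M))).

Lemma emitsR_ops : emitsR (cfor pL pS (cseqs (coper W) (topers M))) (fun Z _ =>
  flatten (map enc_op (flatten [seq [seq tinst W i t | t <- topers M] | i <- iota 0 Z]))).
Proof.
have H := emits_for (P := [:: pT; pO]) (j := pL) (e := pS) isT isT isT isT
  (emitsL_seqs (topers M) (@emitsL_oper W)).
apply: emits_weaken H => // m g [Z [w [[Z0 ES _ _ _] ->]]].
exists (fun i => flatten [seq enc_op (tinst W i t) | t <- topers M]); split.
  rewrite enc_flatten -map_comp ES; congr flatten; apply: eq_map => i /=.
  by rewrite -map_comp.
by move=> i m' Li Ag Ei; rewrite (proj1 Ag) // Ei.
Qed.

Lemma emitsR_init : emitsR (cfor pL pS cins) (fun Z w =>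
  flatten (map enc_nat [seq j * W + offc (insym M w j) | j <- iota 0 Z])).
Proof.
have U k := emits_cunary W (v := pL) k isT.
have H := emits_for (P := [:: pT; pO]) (j := pL) (e := pS) isT isT isT isT
  (emits_if (c := CTest 1 pL) isT (emits_if (c := CTest 0 pL) isT (U _) (U _)) (U _)).
apply: emits_weaken (H _ _ _) => // m g [Z [w [[Z0 ES _ A0 A1] ->]]].
exists (fun j => enc_nat (j * W + offc (insym M w j))); split; first by rewrite -map_comp ES.
move=> i m' Li Ag Ei; rewrite /= Ei !(proj2 Ag) // A0 A1 /insym.
by case: ltnP => // _; case: (nth false w i).
Qed.

(** The calls of [cunary] made directly here write the counts: [Z.+1 * W + 2] conditions,
    [Z * size (topers M) + 1] operators, and [Z + 2] and [Z + 1] conditions in the two initial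
    states. *)
Definition cinst : cmd :=
  CSeq (cunary W pS1 2) (CSeq (CSeq (cunary (size (topers M)) pS 1)
    (CSeq (cemits (enc_op shortcut)) (cfor pL pS (cseqs (coper W) (topers M)))))
  (CSeq (CSeq (cunary 1 pS 2) (CSeq (cemits (enc_nat 1)) (CSeq (cemits (enc_nat (offh (tm_start M))))
        (cfor pL pS cins))))
  (CSeq (CSeq (cunary 1 pS 1) (CSeq (cemits (enc_nat (offh (tm_start M)))) (cfor pL pS cins)))
  (CSeq (cemits (enc_nats [:: 0])) (cemits (enc_nats [:: 0])))))).

Lemma emitsR_inst : emitsR cinst (fun Z w => enc_input (inst M Z w)).
Proof.
have S Z w m : ready Z w m -> ptr m pS = id Z by case.
have S1 Z w m : ready Z w m -> ptr m pS1 = Z.+1 by case.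
pose C g := emitsR_const g.
have H1 := emitsR_unary (v := pS1) W 2 isT S1.
have H2 := emitsR_seq (emitsR_unary (v := pS) (size (topers M)) 1 isT S)
  (emitsR_seq (C (enc_op shortcut)) emitsR_ops).
have H3 := emitsR_seq (emitsR_unary (v := pS) 1 2 isT S) (emitsR_seq (C (enc_nat 1))
  (emitsR_seq (C (enc_nat (offh (tm_start M)))) emitsR_init)).
have H4 := emitsR_seq (emitsR_unary (v := pS) 1 1 isT S)
  (emitsR_seq (C (enc_nat (offh (tm_start M)))) emitsR_init).
have H5 := C (enc_nats [:: 0]).
apply: emitsR_ext (emitsR_seq H1 (emitsR_seq H2 (emitsR_seq H3 (emitsR_seq H4
  (emitsR_seq H5 H5))))) => Z w.
rewrite /enc_input; congr (_ ++ _); congr (_ ++ _); last congr (_ ++ _); last congr (_ ++ _).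
- have Es : size (inst_ops M Z) = Z * size (topers M) + 1.
    rewrite /inst_ops /= size_flatten /shape -map_comp addn1; congr _.+1.
    by elim: Z 0 => //= z IH i; rewrite IH size_map mulSn.
  by rewrite -[RHS]/(enc_ops (inst_ops M Z)) /enc_ops Es.
- by rewrite /enc_nats /= size_map size_iota muln1 addn2.
- by rewrite /enc_nats /= size_map size_iota muln1 addn1.
Qed.

End Emit.

(** * Computing the space bound on a pointer *)

Fixpoint crights (v c : nat) : cmd :=
  if c is c'.+1 then CSeq (CRight v) (crights v c') else cskip.
Definition cmul : cmd :=
  CSeq (czero pY) (CSeq (cfor pL pS (cfor pJJ pN (CRight pY))) (ccopy pS pY)).
Fixpoint cpow (k : nat) : cmd := if k is k'.+1 then CSeq cmul (cpow k') else cskip.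
(** [pS] is advanced to [c], multiplied [k] times by the length [n] of the input and advanced by [c]
    again, which is the value [c * n ^ k + c] of the space bound. *)
Definition cprep (c k : nat) : cmd :=
  CSeq (CWhile (CTest 1 pN) (CRight pN)) (CSeq (crights pS c) (CSeq (cpow k)
  (CSeq (crights pS c) (CSeq (ccopy pS1 pS) (CRight pS1))))).

Section Prep.
Variables (w : seq bool) (K : nat).
Local Notation n := (size w).

Record prepst (m : memory) (z : nat) : Prop := Prepst {
  pr_home : ptr m 0 = 0;
  pr_small : forall v, ptr m v <= K;
  pr_out : ptr m pO = 0;
  pr_arr : arr m = arr (mem0 w);
  pr_N : ptr m pN = n;
  pr_S : ptr m pS = z }.

Lemma wpt_setlen m (Q : memory -> Prop) : arr m = arr (mem0 w) -> ptr m pN = 0 ->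
  Q (setp m pN n) -> wpt (2 * n + 1) (CWhile (CTest 1 pN) (CRight pN)) m Q.
Proof.
suff H d m1 : arr m1 = arr (mem0 w) -> ptr m1 pN + d = n -> Q (setp m1 pN n) ->
    wpt (2 * d + 1) (CWhile (CTest 1 pN) (CRight pN)) m1 Q.
  by move=> Ea E0; apply: H; rewrite // E0.
elim: d m1 => [|d IH] m1 Ea Ed HQ;
  have [t Lt H] := ev_pure None m1 (c := CTest 1 pN) isT; rewrite /= Ea /= in H Lt.
  exists true, m1, t; split=> //; last by move: HQ; rewrite -Ed addn0 setp_id.
  by apply: ev_stop; rewrite -Ed addn0 ltnn in H.
have Ln : ptr m1 pN < n by lia.
rewrite Ln in H.
have [||b [m' [t' [H' L' HQ']]]] := IH (setp m1 pN (ptr m1 pN).+1) Ea.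
- by rewrite /= addSnnS.
- by rewrite setp_setp.
exists b, m', (t + 1 + t'); split=> //; last lia.
exact: (ev_go H (@ev_right None pN m1 isT) H').
Qed.

Lemma wpt_crights c m z (Q : memory -> Prop) :
  prepst m z -> z + c <= K -> (forall m', prepst m' (z + c) -> Q m') ->
  wpt (c + 1) (crights pS c) m Q.
Proof.
elim: c m z => [|c IH] m z Hm Hz HQ.
  by apply: (wpt_pure (c := cskip)) => //; apply: HQ; rewrite addn0.
rewrite addSn -add1n; apply: wpt_seq; apply: wpt_right.
apply: (IH _ z.+1); rewrite ?addSnnS //.
case: Hm => h1 h2 h3 h4 h5 h6; split; rewrite /= ?h6 //.
by move=> v; case: eqP => // _; lia.
Qed.

(** The constant 100 is a generous bound for a reset, two nested loops and a copy. *)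
Lemma wpt_cmul m z (Q : memory -> Prop) :
  prepst m z -> z * n <= K -> (forall m', prepst m' (z * n) -> Q m') ->
  wpt (100 * K.+1 ^ 2) cmul m Q.
Proof.
move=> Hm Hz HQ; have [h1 h2 h3 h4 h5 h6] := Hm.
apply: (wpt_leT (T := (4 * K + 3) + ((4 * K + 6 + z * ((4 * K + 6 + n * (1 + 4)) + 4)) + (8 * K + 6)))).
  have zK : z <= K by rewrite -h6.
  have nK : n <= K by rewrite -h5.
  by rewrite -mulnn; nia.
apply: wpt_seq; apply: wpt_leT (wpt_zero _ _ _) => //.
  by rewrite leq_add2r leq_mul2l h2.
set m1 := setp m pY 0.
have P1 : prepst m1 z by split=> // v /=; case: eqP.
apply: wpt_seq.
apply: (wpt_leT (T := 4 * ptr m1 pL + 6 + z * ((4 * K + 6 + n * (1 + 4)) + 4))).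
  by rewrite leq_add2r leq_add2r leq_mul2l (pr_small P1).
apply: (wpt_for (N := z) (I := fun i m2 => [/\ ptr m2 pL = i, ptr m2 pY = i * n & prepst m2 z])) => //.
- by move=> i m2 [E1 _ P2]; split=> //; apply: pr_S P2.
- by split=> //; split=> // v /=; do 2 case: eqP => // _.
- move=> i m2 Li [E2 Y2 P2].
  have iK : i * n + n <= K by apply: leq_trans Hz; rewrite addnC -mulSn leq_mul2r Li orbT.
  apply: (wpt_leT (T := 4 * ptr m2 pJJ + 6 + n * (1 + 4))).
    by rewrite leq_add2r leq_add2r leq_mul2l (pr_small P2).
  apply: (wpt_for (N := n) (I := fun j m3 =>
    [/\ ptr m3 pJJ = j, ptr m3 pL = i, ptr m3 pY = i * n + j & prepst m3 z])) => //.
  + exact: pr_home P2.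
  + by move=> j m3 [E3 _ _ P3]; split=> //; apply: pr_N P3.
  + case: P2 => g1 g2 g3 g4 g5 g6; split; rewrite /= ?Y2 ?addn0 //.
    by split=> // v /=; case: eqP.
  + move=> j m3 Lj [E3 L3 Y3 [g1 g2 g3 g4 g5 g6]]; apply: wpt_right.
    split=> //; split; rewrite /= ?Y3 ?addnS //; split=> // v /=.
    by do 2 (case: eqP => // _; first lia).
  + move=> m3 [E3 L3 Y3 [g1 g2 g3 g4 g5 g6]]; split=> //; split; rewrite /= ?Y3 //.
      by rewrite mulSn addnC.
    by split=> // v /=; case: eqP => // _; have := g2 pS; rewrite g6; lia.
move=> m2 [E2 Y2 [g1 g2 g3 g4 g5 g6]].
apply: (wpt_leT (T := 4 * (ptr m2 pS + ptr m2 pY) + 6)).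
  by have := g2 pS; have := g2 pY; lia.
apply: wpt_copy => //; apply: HQ; split; rewrite /= ?Y2 //.
by move=> v; case: eqP.
Qed.

(** The bound is required for every intermediate product because [z * n ^ i] is not monotone in [i]
    when [n = 0]. *)
Lemma wpt_cpow k m z (Q : memory -> Prop) :
  prepst m z -> (forall i, i <= k -> z * n ^ i <= K) -> (forall m', prepst m' (z * n ^ k) -> Q m') ->
  wpt ((100 * k).+1 * K.+1 ^ 2) (cpow k) m Q.
Proof.
elim: k m z => [|k IH] m z Hm Hz HQ.
  apply: (wpt_leT (T := 1)); first by rewrite muln0 mul1n expn_gt0.
  by apply: (wpt_pure (c := cskip)) => //; apply: HQ; rewrite muln1.
rewrite mulnS -addnS mulnDl; apply: wpt_seq.
have Hz1 : z * n <= K by have := Hz 1 isT; rewrite expn1.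
apply: (wpt_cmul Hm Hz1) => m1 P1; apply: (IH _ _ P1).
  by move=> i Li; rewrite -mulnA -expnS; apply: Hz.
by move=> m2; rewrite -mulnA -expnS; apply: HQ.
Qed.

Lemma wpt_cprep c k (Q : memory -> Prop) :
  let Z := c * n ^ k + c in K = Z + n + 1 ->
  (forall m, outst K m [::] -> ptr m pS = Z -> ptr m pS1 = Z.+1 -> arr m = arr (mem0 w) -> Q m) ->
  wpt ((2 * c + 100 * k + 30) * K.+1 ^ 2) (cprep c k) (mem0 w) Q.
Proof.
move=> Z EK HQ.
have EZ : Z = c * n ^ k + c by [].
apply: (wpt_leT (T := (2 * n + 1) + ((c + 1) + ((100 * k).+1 * K.+1 ^ 2 +
  ((c + 1) + ((8 * K + 6) + 1)))))).
  have nK : n <= K by lia.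
  by rewrite -mulnn; nia.
apply: wpt_seq; apply: wpt_setlen => //; set m0 := setp _ _ _.
have P0 : prepst m0 0 by split=> // v /=; case: eqP => // _; lia.
apply: wpt_seq; apply: (wpt_crights P0); first lia.
rewrite add0n => m1 P1; apply: wpt_seq; apply: (wpt_cpow P1).
  move=> i Li; apply: (@leq_trans Z); last lia.
  (* For the empty word the product is [c] before the first multiplication and 0 afterwards; the
     summand [c] of [Z] covers it. *)
  rewrite EZ; have [n0|n0] := posnP n.
    by rewrite n0; case: i {Li} => [|i]; rewrite ?muln1 ?leq_addl // exp0n // muln0.
  by rewrite (leq_trans _ (leq_addr _ _)) // leq_mul2l leq_pexp2l ?orbT.
move=> m2 P2; apply: wpt_seq; apply: (wpt_crights P2); rewrite -EZ; first lia.
move=> m3 P3; apply: wpt_seq; have [h1 h2 h3 h4 h5 h6] := P3.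
apply: (wpt_leT (T := 4 * (ptr m3 pS1 + ptr m3 pS) + 6)).
  by have := h2 pS1; have := h2 pS; lia.
apply: wpt_copy => //; apply: wpt_right; apply: HQ; rewrite //= ?h6 //.
split=> //=; rewrite ?h4 //.
by move=> v vO; case: eqP => // _; lia.
Qed.

End Prep.

(** * Polynomial bounds and the reduction *)

Definition polyb (f : nat -> nat) : Prop := exists c k, forall n, f n <= c * n ^ k + c.

Lemma polyb_le f g : (forall n, f n <= g n) -> polyb g -> polyb f.
Proof. by move=> H [c [k Hg]]; exists c, k => n; apply: leq_trans (H n) (Hg n). Qed.

Lemma polyb_const a : polyb (fun _ => a).
Proof. by exists a, 0 => n; rewrite leq_addl. Qed.

Lemma polyb_id : polyb id.
Proof. by exists 1, 1 => n; rewrite expn1 mul1n leq_addr. Qed.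

(** The summand 1 is for [n = 0] and [a = 0], where the left side is 1 and the power on the right
    may be 0. *)
Lemma expn_addl_le n a b : n ^ a <= n ^ (a + b) + 1.
Proof.
have [->|n0] := posnP n; first by case: a => [|a]; [rewrite addn1|rewrite exp0n].
by apply: leq_trans (leq_addr _ _); rewrite leq_pexp2l // leq_addr.
Qed.

Lemma polyb_add f g : polyb f -> polyb g -> polyb (fun n => f n + g n).
Proof.
move=> [c [k Hf]] [d [l Hg]]; exists (2 * (c + d)), (k + l) => n.
apply: leq_trans (leq_add (Hf n) (Hg n)) _.
have H1 := expn_addl_le n k l; have := expn_addl_le n l k; rewrite [l + k]addnC => H2.
nia.
Qed.

Lemma polyb_mul f g : polyb f -> polyb g -> polyb (fun n => f n * g n).
Proof.
move=> [c [k Hf]] [d [l Hg]]; exists (3 * (c * d)), (k + l) => n.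
apply: leq_trans (leq_mul (Hf n) (Hg n)) _.
have H1 := expn_addl_le n k l; have := expn_addl_le n l k; rewrite [l + k]addnC => H2.
have -> : (c * n ^ k + c) * (d * n ^ l + d) = (c * d) * (n ^ k * n ^ l + n ^ k + n ^ l + 1) by lia.
rewrite -expnD; have -> : 3 * (c * d) * n ^ (k + l) + 3 * (c * d) = (c * d) * (3 * n ^ (k + l) + 3) by lia.
by rewrite leq_mul2l; apply/orP; right; lia.
Qed.

Lemma polyb_exp f k : polyb f -> polyb (fun n => f n ^ k).
Proof.
move=> Hf; elim: k => [|k IH]; first exact: polyb_const.
by apply: polyb_le (polyb_mul Hf IH) => n; rewrite expnS.
Qed.

Lemma okc_cemits s : okc 9 4 (cemits s).
Proof. by elim: s. Qed.

Lemma okc_cinst M : okc 9 4 (cinst M).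
Proof.
have U W v k : v < 9 -> okc 9 4 (cunary W v k) by move=> v9; rewrite /= !okc_cemits v9.
have Sq (T : Type) (f : T -> cmd) l : (forall x, okc 9 4 (f x)) -> okc 9 4 (cseqs f l).
  by move=> H; elim: l => //= x l ->; rewrite H.
have Nm W t : okc 9 4 (cnum W t).
  by case: t => [[] k]; rewrite /cnum /= ?okc_cemits.
have Op W t : okc 9 4 (coper W t) by rewrite /coper /cnumlist /= !okc_cemits !Sq.
by rewrite /cinst /cins /= !okc_cemits !Sq.
Qed.

Lemma okc_crights c : okc 9 4 (crights pS c).
Proof. by elim: c. Qed.

Lemma okc_cpow k : okc 9 4 (cpow k).
Proof. by elim: k. Qed.

Theorem plan_modification_hard : PSPACE_hard plan_modification.
Proof.
move=> L [M [c [k HM]]].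
pose Z n := c * n ^ k + c; pose K n := Z n + n + 1.
exists (fun w => enc_input (inst M (Z (size w)) w)); split; last first.
  move=> w; have [_ [HS HL]] := HM w; rewrite HL -(inst_solvable HS); split=> [H|[x [Ex [_ H]]]].
    by exists (inst M (Z (size w)) w); split=> //; split=> //; apply: inst_promise.
  by rewrite (enc_input_inj Ex).
(* [A] is chosen before any input word, so the time bound [T] below is uniform in the input. *)
have [A HA] := emitsR_inst M.
pose prog := CSeq (cprep c k) (CSeq (cinst M) (CConst true)).
pose T n := (2 * c + 100 * k + 30) * (K n).+1 ^ 2 + (A * (K n).+1 ^ 2 + 1).
have polyK : polyb (fun n => (K n).+1).
  have P1 := polyb_mul (polyb_const c) (polyb_exp k polyb_id).
  have P2 := polyb_add (polyb_add P1 (polyb_const c)) (polyb_add polyb_id (polyb_const 2)).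
  by apply: polyb_le P2 => n; rewrite /K /Z /=; lia.
have polyT : polyb T.
  have P2 := polyb_exp 2 polyK.
  exact: (polyb_add (polyb_mul (polyb_const _) P2)
    (polyb_add (polyb_mul (polyb_const A) P2) (polyb_const 1))).
have [c' [k' H']] : polyb (fun n => T n * (2 * T n + 6) + 1).
  exact: (polyb_add (polyb_mul polyT (polyb_add (polyb_mul (polyb_const 2) polyT) (polyb_const 6)))
    (polyb_const 1)).
have ok : okc 9 4 prog.
  rewrite -[okc _ _ _]/(okc 9 4 (cprep c k) && (okc 9 4 (cinst M) && true)) okc_cinst /=.
  by rewrite !okc_crights okc_cpow.
exists (ptm 9 4 prog), c', k'.
apply: (@ptm_computes 9 4 prog _ _ ok _ T) => // w.
set n := size w; have [_ [HS _]] := HM w.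
have [b [m [t [Hev Lt Hm]]]] : wpt (T n) prog (mem0 w)
    (fun m => outst (K n) m (enc_input (inst M (Z n) w))).
  apply: wpt_seq; apply: (wpt_cprep (K := K n) (c := c) (k := k)) => // m Hm ES ES1 EA.
  apply: wpt_seq; apply: wpt_le (HA (K n) m [::] (enc_input (inst M (Z n) w)) Hm _) => //.
    by move=> m' [Hm' _]; apply: (wpt_pure (c := CConst true)).
  by exists (Z n), w; split=> //; split; rewrite ?EA //; apply: os_home Hm.
(* [wpt] forgets the returned Boolean; the final [CConst true] of [prog] determines it. *)
have bT : b = true.
  inversion Hev; subst; match goal with H : ev _ (CSeq _ (CConst _)) _ _ _ _ |- _ => inversion H end.
  by subst; match goal with H : ev _ (CConst _) _ _ _ _ |- _ => inversion H end.
by exists m, t; rewrite bT in Hev; case: Hm => _ _ H1 H2 H3; split.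
Qed.

Theorem theorem1 : PSPACE_complete plan_modification.
Proof. exact: (conj plan_modification_in_PSPACE plan_modification_hard). Qed.
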